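(* Let $r$ be a positive integer and let $\Upsilon\in H^\infty(\mathcal B(\mathbb C^r,\ell^2))$ be an inner matrix function. Let $\mathcal L=\operatorname{Ker}T_{\Upsilon^{\rm t}}\subset H^2(\ell^2)$, which is invariant under multiplication by $z$, and let $\Theta$ be an inner matrix function such that $\mathcal L=\Theta H^2(\mathcal K)$, where $\mathcal K=\ell^2$ or $\mathcal K=\mathbb C^m$ for some positive integer $m$. Then $\Theta$ is co-outer and the matrix function $\begin{pmatrix}\Upsilon&\overline{\Theta}\end{pmatrix}$ is unitary-valued (almost everywhere on the unit circle $\mathbb T$).
   Context: Operators between spaces $\ell^2$, $\mathbb C^k$ are identified with (possibly infinite) matrices in the standard bases; $A^{\rm t}$ is the transpose and $\overline{A}$ the entrywise complex conjugate of a matrix $A$. $\mathcal B(\mathcal H,\mathcal K)$ is the space of bounded linear operators from $\mathcal H$ to $\mathcal K$, and $H^\infty(\mathcal B(\mathcal H,\mathcal K))$ is the space of bounded analytic $\mathcal B(\mathcal H,\mathcal K)$-valued functions. For separable Hilbert spaces $\mathcal H,\mathcal K$, $H^2_{\rm s}(\mathcal B(\mathcal H,\mathcal K))$ is the space of analytic $\mathcal B(\mathcal H,\mathcal K)$-valued functions $F$ on the unit disk with $F(z)x\in H^2(\mathcal K)$ for every $x\in\mathcal H$. Such an $F$ is inner if $F(\zeta)^*F(\zeta)=I$ for almost all $\zeta\in\mathbb T$; outer if $\{Fq:q\text{ is a polynomial in }H^2(\mathcal H)\}$ is dense in $H^2(\mathcal K)$; co-outer if $F^{\rm t}$ is outer.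 $T_{\Upsilon^{\rm t}}:H^2(\ell^2)\to H^2(\mathbb C^r)$ is the Toeplitz operator $T_{\Upsilon^{\rm t}}f=\mathbb P_+(\Upsilon^{\rm t}f)$, where $\mathbb P_+$ is the orthogonal projection of $L^2$ onto $H^2$. $\begin{pmatrix}\Upsilon&\overline{\Theta}\end{pmatrix}$ is the block matrix function with values in $\mathcal B(\mathbb C^r\oplus\mathcal K,\ell^2)$. *)

(* Defs.v *)
From HB Require Import structures.
From mathcomp Require Import all_boot all_order all_algebra.
From mathcomp Require Import complex.
From mathcomp Require Import all_classical all_reals all_analysis.

Set Implicit Arguments.
Unset Strict Implicit.
Unset Printing Implicit Defensive.

Import Order.TTheory GRing.Theory Num.Theory.
Import numFieldNormedType.Exports.

Local Open Scope classical_set_scope.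
Local Open Scope ring_scope.
Local Open Scope complex_scope.

(* The complex field is [R[i]], with [R] any [realType]; since [R[i]] carries no
   topology in the library, complex limits, sums and integrals are taken on real
   and imaginary parts. *)

(** * Square-summable families and matrices of operators *)

Definition vec (R : realType) (I : choiceType) := I -> R[i].
Definition mx (R : realType) (J I : choiceType) := J -> I -> R[i].

(* [FinDim m] stands for C^m and [InfDim] for l^2, through the index set of
   the standard basis. *)
Inductive hdim := FinDim of nat | InfDim.
Definition idx (d : hdim) : choiceType :=
  match d with FinDim m => 'I_m | InfDim => nat end.

Definition rsum (R : realType) (I : choiceType) (x : I -> R) : R :=
  fine (\esum_(i in [set: I]) (Num.max (x i) 0)%:E)
  - fine (\esum_(i in [set: I]) (Num.max (- x i) 0)%:E).

(* The sum of an absolutely summable family; the value is meaningless (but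
   defined) on the other families. *)
Definition csum (R : realType) (I : choiceType) (x : I -> R[i]) : R[i] :=
  rsum (fun i => complex.Re (x i)) +i* rsum (fun i => complex.Im (x i)).

(* The l^2 norm; x is in l^2(I) iff it is finite. *)
Definition l2norm (R : realType) (I : choiceType) (x : vec R I) : \bar R :=
  sqrte (\esum_(i in [set: I]) (Normc.normc (x i) ^+ 2)%:E).

Definition in_l2 (R : realType) (I : choiceType) (x : vec R I) : Prop :=
  (l2norm x < +oo)%E.

Definition dotv (R : realType) (I : choiceType) (x y : vec R I) : R[i] :=
  csum (fun i => x i * conjc (y i)).

Definition mulmv (R : realType) (J I : choiceType) (A : mx R J I) (x : vec R I)
  : vec R J := fun j => csum (fun i => A j i * x i).

Definition mulmm (R : realType) (K J I : choiceType)
    (A : mx R K J) (B : mx R J I) : mx R K I :=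
  fun k i => csum (fun j => A k j * B j i).

Definition idm (R : realType) (I : choiceType) : mx R I I :=
  fun i i' => (i == i')%:R.

Definition trm (R : realType) (J I : choiceType) (A : mx R J I) : mx R I J :=
  fun i j => A j i.

Definition conjm (R : realType) (J I : choiceType) (A : mx R J I) : mx R J I :=
  fun j i => conjc (A j i).

Definition adjm (R : realType) (J I : choiceType) (A : mx R J I) : mx R I J :=
  conjm (trm A).

Definition rowm (R : realType) (J I1 I2 : choiceType)
    (A : mx R J I1) (B : mx R J I2) : mx R J (I1 + I2)%type :=
  fun j i => match i with inl i1 => A j i1 | inr i2 => B j i2 end.

(* A matrix defines a bounded operator l^2(I) -> l^2(J) iff its [opnorm] is
   finite: if some row of A is not in l^2, its truncations (for which [csum]
   is a finite sum) already make the supremum infinite. *)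
Definition opnorm (R : realType) (J I : choiceType) (A : mx R J I) : \bar R :=
  ereal_sup [set l2norm (mulmv A x) | x in [set x | (l2norm x <= 1)%E]].

Definition bounded_op (R : realType) (J I : choiceType) (A : mx R J I) : Prop :=
  (opnorm A < +oo)%E.

Definition unitary_op (R : realType) (J I : choiceType) (A : mx R J I) : Prop :=
  [/\ bounded_op A, mulmm (adjm A) A = @idm R I
    & mulmm A (adjm A) = @idm R J].

(** * The unit disk and the unit circle *)

(* Functions on the disk are represented by total functions on R[i]: the
   analyticity, norm and boundary-value notions below only read their values
   inside the disk. *)
Definition disk (R : realType) (z : R[i]) : Prop := Normc.normc z < 1.

Definition expi (R : realType) (t : R) : R[i] := cos t +i* sin t.

Definition angles (R : realType) : set R := [set` `[0 : R, 2 * pi]].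

Definition ae_circle (R : realType) (P : R[i] -> Prop) : Prop :=
  {ae (@lebesgue_measure R), forall t : R,
      @angles R t -> P (expi t)}.

(* Integrals with respect to normalized Lebesgue measure on the circle. *)
Definition circle_eint (R : realType) (g : R[i] -> \bar R) : \bar R :=
  ((2 * pi)^-1%:E * \int[@lebesgue_measure R]_(t in @angles R) g (expi t))%E.

Definition circle_int (R : realType) (g : R[i] -> R[i]) : R[i] :=
  ((2 * pi)^-1
     * Rintegral (@lebesgue_measure R) (@angles R) (fun t => complex.Re (g (expi t))))
  +i*
  ((2 * pi)^-1
     * Rintegral (@lebesgue_measure R) (@angles R) (fun t => complex.Im (g (expi t)))).

(* Boundary values: entrywise radial limits (existing almost everywhere for
   functions in H^2, by Fatou's theorem). *)
Definition radial_lim (R : realType) (f : R[i] -> R[i]) (zeta : R[i]) : R[i] :=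
  lim (complex.Re (f (s%:C * zeta)) @[s --> (1 : R)^'-])
  +i* lim (complex.Im (f (s%:C * zeta)) @[s --> (1 : R)^'-]).

Definition bdv (R : realType) (I : choiceType) (f : R[i] -> vec R I)
  : R[i] -> vec R I := fun zeta i => radial_lim (fun z => f z i) zeta.

Definition bdm (R : realType) (J I : choiceType) (F : R[i] -> mx R J I)
  : R[i] -> mx R J I := fun zeta j i => radial_lim (fun z => F z j i) zeta.

(** * Hardy spaces *)

(* A vector- or operator-valued function is analytic on the disk iff it is the
   sum there of a power series with coefficients in l^2(I), resp. bounded
   operators, converging in norm. *)
Definition analyticv (R : realType) (I : choiceType) (f : R[i] -> vec R I)
  : Prop :=
  exists a : nat -> vec R I,
    (forall n, in_l2 (a n)) /\
    forall z, disk z ->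
      l2norm (fun i => f z i - \sum_(k < n) z ^+ k * a k i)
        @[n --> \oo] --> 0%E.

Definition analyticm (R : realType) (J I : choiceType) (F : R[i] -> mx R J I)
  : Prop :=
  exists A : nat -> mx R J I,
    (forall n, bounded_op (A n)) /\
    forall z, disk z ->
      opnorm (fun j i => F z j i - \sum_(k < n) z ^+ k * A k j i)
        @[n --> \oo] --> 0%E.

Definition h2norm (R : realType) (I : choiceType) (f : R[i] -> vec R I)
  : \bar R :=
  ereal_sup [set sqrte (circle_eint (fun zeta => (l2norm (f (s%:C * zeta)%R) ^+ 2)%E))
            | s in [set s : R | 0 <= s < 1]].

Definition in_H2 (R : realType) (I : choiceType) (f : R[i] -> vec R I) : Prop :=
  analyticv f /\ (h2norm f < +oo)%E.

Definition in_Hinf (R : realType) (J I : choiceType) (F : R[i] -> mx R J I)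
  : Prop :=
  analyticm F /\ (ereal_sup [set opnorm (F z) | z in @disk R] < +oo)%E.

Definition in_H2s (R : realType) (J I : choiceType) (F : R[i] -> mx R J I)
  : Prop :=
  analyticm F /\ forall x : vec R I, in_l2 x -> in_H2 (fun z => mulmv (F z) x).

Definition inner (R : realType) (J I : choiceType) (F : R[i] -> mx R J I)
  : Prop :=
  in_H2s F /\
  ae_circle (fun zeta => mulmm (adjm (bdm F zeta)) (bdm F zeta) = @idm R I).

Definition vec_poly (R : realType) (I : choiceType) (q : R[i] -> vec R I)
  : Prop :=
  exists (n : nat) (a : nat -> vec R I),
    (forall k, in_l2 (a k)) /\
    q = (fun z i => \sum_(k < n) z ^+ k * a k i).

Definition outer (R : realType) (J I : choiceType) (F : R[i] -> mx R J I)
  : Prop :=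
  in_H2s F /\
  forall g : R[i] -> vec R J, in_H2 g -> forall e : R, 0 < e ->
    exists2 q : R[i] -> vec R I, vec_poly q &
      (h2norm (fun z j => mulmv (F z) (q z) j - g z j)%R < e%:E)%E.

Definition co_outer (R : realType) (J I : choiceType) (F : R[i] -> mx R J I)
  : Prop := outer (fun z => trm (F z)).

(** * Toeplitz operators *)

Definition in_L2 (R : realType) (I : choiceType) (g : R[i] -> vec R I) : Prop :=
  [/\ forall i, measurable_fun (@angles R) (fun t : R => complex.Re (g (expi t) i)),
      forall i, measurable_fun (@angles R) (fun t : R => complex.Im (g (expi t) i))
    & (circle_eint (fun zeta => l2norm (g zeta) ^+ 2) < +oo)%E].

(* [riesz_proj g h]: the orthogonal projection of g in L^2 onto H^2 is h, i.e.
   h is in H^2 and g - h is orthogonal to H^2. *)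
Definition riesz_proj (R : realType) (I : choiceType)
    (g : R[i] -> vec R I) (h : R[i] -> vec R I) : Prop :=
  [/\ in_L2 g, in_H2 h
    & forall k, in_H2 k ->
        circle_int (fun zeta =>
          dotv (fun i => g zeta i - bdv h zeta i) (bdv k zeta)) = 0].

(* [toeplitz Phi f h]: T_Phi f = h, for a symbol Phi given on the circle. *)
Definition toeplitz (R : realType) (J I : choiceType) (Phi : R[i] -> mx R J I)
    (f : R[i] -> vec R I) (h : R[i] -> vec R J) : Prop :=
  riesz_proj (fun zeta => mulmv (Phi zeta) (bdv f zeta)) h.

Definition ker_toeplitz (R : realType) (J I : choiceType)
    (Phi : R[i] -> mx R J I) : set (R[i] -> vec R I) :=
  [set f | in_H2 f /\ toeplitz Phi f (fun _ _ => 0)].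

(* Theta H^2(K), functions being compared on the disk only. *)
Definition range_H2 (R : realType) (J I : choiceType)
    (Theta : R[i] -> mx R J I) : set (R[i] -> vec R J) :=
  [set f | exists2 h, in_H2 h & forall z, disk z -> f z = mulmv (Theta z) (h z)].

(* Main.v *)
(* On the circle, [f] in [H^2] lies in the kernel of the Toeplitz operator iff [Upsilon^t f = 0] almost
   everywhere, because [Upsilon^t f] has no negative Fourier coefficients; in particular
   [Upsilon^t Theta = 0].  Conversely, Cramer's rule turns the r x r minors of [Upsilon] into bounded
   analytic vectors annihilated by [Upsilon^t].  They lie in the kernel, hence in the range of
   [Theta(zeta)] for almost every [zeta]; where some minor is nonzero, the vectors orthogonal to all of
   them are the combinations of the columns of [conj Upsilon(zeta)], so these columns and those of
   [Theta(zeta)] together span l^2.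

   If [g] in [H^2(K)] is orthogonal to [Theta^t] times every polynomial, then
   [conj(zeta) Theta conj(g)] has no negative Fourier coefficients and is annihilated by [Upsilon^t], so
   it equals [Theta h] with [h] in [H^2(K)].  As [Theta] is isometric, [conj(zeta g) = h], and comparing
   Fourier coefficients gives [g = 0]. *)
Require Import Defs.
From mathcomp Require Import all_boot all_order all_algebra.
From mathcomp Require Import complex ring lra.
From mathcomp Require Import all_classical all_reals all_analysis measurable_realfun.

Set Implicit Arguments.
Unset Strict Implicit.
Unset Printing Implicit Defensive.

Import Order.TTheory GRing.Theory Num.Theory.
Import numFieldNormedType.Exports.

Local Open Scope classical_set_scope.
Local Open Scope ring_scope.
Local Open Scope complex_scope.

(** * Summable families *)

(** Boundary values are radial limits, so the passage between disk and circle has to be established: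
    Fatou's theorem, by the Poisson kernel at Lebesgue points, and measurability of the limits. The
    common notion is [HB a g]: [g] is the mean-square sum of a Fourier series with coefficients [a]
    of index >= 0. Products of two such functions are merely integrable, so identities on the circle
    come from uniqueness of Fourier coefficients in L^1.

    A nonzero minor exists wherever the columns of [Upsilon] are orthonormal, since they then have
    rank r; this is a pointwise fact, and only countably many choices of rows are involved.

    For co-outerness, orthogonality removes from Theta conj(g) every frequency <= 0, index 0
    included. The factor conj(zeta) shifts the remaining ones to indices >= 0, whereas conj(zeta g)
    has only indices <= -1; without the shift, constants would survive the comparison. Since the H^2
    norm is the l^2 norm of the coefficients, density is proved in l^2 over pairs (power,
    coordinate), by projection onto a subspace. *)

Notation normc := Normc.normc.

Section RealSums.
Context {R : realType} {I : choiceType}.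
Implicit Types (x y p n : I -> R).

Definition essum p : \bar R := \esum_(i in [set: I]) (p i)%:E.
Definition fsum p := (essum (fun i => `|p i|%R) < +oo)%E.

Lemma essum_ge0 p : (forall i, 0 <= p i) -> (0 <= essum p)%E.
Proof. by move=> p0; apply: esum_ge0 => i _; rewrite lee_fin. Qed.

Lemma le_essum p n : (forall i, p i <= n i) -> (essum p <= essum n)%E.
Proof. by move=> h; apply: le_esum => i _; rewrite lee_fin. Qed.

Lemma eq_essum p n : (forall i, p i = n i) -> essum p = essum n.
Proof. by move=> h; congr essum; apply/funext. Qed.

Lemma fsum_le p n : (forall i, `|p i| <= `|n i|) -> fsum n -> fsum p.
Proof. by move=> h; apply: le_lt_trans; exact: le_essum. Qed.

Lemma fsum_pos p : (forall i, 0 <= p i) -> fsum p = (essum p < +oo)%E.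
Proof.
by move=> p0; rewrite /fsum; congr (_ < _)%E; apply: eq_essum => i; rewrite ger0_norm.
Qed.

Lemma fsum_fin p : (forall i, 0 <= p i) -> fsum p -> essum p \is a fin_num.
Proof. by move=> p0; rewrite fsum_pos// ge0_fin_numE// essum_ge0. Qed.

Lemma essumD p n : (forall i, 0 <= p i) -> (forall i, 0 <= n i) ->
  essum (fun i => p i + n i) = (essum p + essum n)%E.
Proof.
by move=> p0 n0; rewrite /essum -esumD//= => i _; rewrite lee_fin.
Qed.

Lemma fsumD p n : fsum p -> fsum n -> fsum (fun i => p i + n i).
Proof.
rewrite /fsum => fp fn.
apply: (@le_lt_trans _ _ (essum (fun i => (`|p i| + `|n i|)%R))).
  by apply: le_essum => i; exact: ler_normD.
by rewrite essumD// lte_add_pinfty.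
Qed.

Lemma fsumN p : fsum p -> fsum (fun i => - p i).
Proof. by apply: fsum_le => i; rewrite normrN. Qed.

Lemma essumZ (k : R) p : 0 <= k -> (forall i, 0 <= p i) ->
  essum (fun i => k * p i) = (k%:E * essum p)%E.
Proof.
move=> k0 p0; rewrite /essum /esum -ereal_supZl//; last first.
  by apply/set0P; exists (\sum_(x \in set0) (p x)%:E)%E; exists set0 => //; split.
congr ereal_sup; rewrite image_comp; apply: eq_imagel => A _ /=.
by rewrite ge0_mule_fsumr.
Qed.

Lemma fsumZ (k : R) p : fsum p -> fsum (fun i => k * p i).
Proof.
rewrite /fsum => fp; rewrite (eq_essum (n := fun i => `|k| * `|p i|)).
  by rewrite essumZ// lte_mul_pinfty// ?lee_fin// essum_ge0.
by move=> i; rewrite normrM.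
Qed.

Let maxNB (a b : R) : Num.max (a - b) 0 + b = Num.max (- (a - b)) 0 + a.
Proof. by case: (leP (a - b) 0); case: (leP (- (a - b)) 0); lra. Qed.

(** [rsum] is defined through positive and negative parts; any other decomposition into nonnegative
    summable parts gives the same value, since max(a - b, 0) + b = max(b - a, 0) + a termwise.
    Linearity of [rsum] rests on this freedom. *)
Lemma rsumB p n : (forall i, 0 <= p i) -> (forall i, 0 <= n i) ->
  fsum p -> fsum n ->
  rsum (fun i => p i - n i) = fine (essum p) - fine (essum n).
Proof.
move=> p0 n0 fp fn; rewrite /rsum.
have mx0 (a : R) : 0 <= Num.max a 0 by rewrite le_max lexx orbT.
have fA : essum (fun i => Num.max (p i - n i) 0) \is a fin_num.
  apply: fsum_fin => //; apply: fsum_le (fsumD fp fn) => i.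
  rewrite !ger0_norm ?addr_ge0//.
  by rewrite ge_max addr_ge0// andbT lerD2l (le_trans (y := 0))// oppr_le0.
have fB : essum (fun i => Num.max (- (p i - n i)) 0) \is a fin_num.
  apply: fsum_fin => //; apply: fsum_le (fsumD fp fn) => i.
  rewrite !ger0_norm ?addr_ge0// ge_max addr_ge0// andbT opprB addrC lerD2r.
  by rewrite (le_trans (y := 0))// oppr_le0.
have := @eq_essum (fun i => Num.max (p i - n i) 0 + n i)
  (fun i => Num.max (- (p i - n i)) 0 + p i) (fun i => maxNB _ _).
rewrite !essumD//; try (by move=> i; exact: mx0).
move=> /(congr1 fine); rewrite !fineD ?fA ?fB ?fsum_fin// -!/(essum _).
by move: (fine _) (fine _) (fine _) (fine _) => a b c d; lra.

Qed.

Definition pos x i := Num.max (x i) 0.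
Definition neg x i := Num.max (- x i) 0.
Lemma pos_ge0 x i : 0 <= pos x i. Proof. by rewrite le_max lexx orbT. Qed.
Lemma neg_ge0 x i : 0 <= neg x i. Proof. by rewrite le_max lexx orbT. Qed.
Lemma posneg x i : x i = pos x i - neg x i.
Proof. by rewrite /pos /neg; case: (leP (x i) 0); case: (leP (- x i) 0); lra. Qed.
Lemma pos_le x i : pos x i <= `|x i|.
Proof. by rewrite /pos ge_max normr_ge0 ler_norm. Qed.
Lemma neg_le x i : neg x i <= `|x i|.
Proof. by rewrite /neg ge_max normr_ge0 -normrN ler_norm. Qed.
Lemma fsum_posi x : fsum x -> fsum (pos x).
Proof. by apply: fsum_le => i; rewrite ger0_norm ?pos_le ?pos_ge0. Qed.
Lemma fsum_neg x : fsum x -> fsum (neg x).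
Proof. by apply: fsum_le => i; rewrite ger0_norm ?neg_le ?neg_ge0. Qed.

Lemma eq_rsum x y : (forall i, x i = y i) -> rsum x = rsum y.
Proof. by move=> h; congr rsum; apply/funext. Qed.

Lemma rsum_pos p : (forall i, 0 <= p i) -> fsum p -> rsum p = fine (essum p).
Proof.
move=> p0 fp; rewrite (@eq_rsum _ (fun i => p i - 0)); last by move=> i; rewrite subr0.
have z0 : essum (fun=> 0) = 0%E by rewrite /essum esum1.
by rewrite rsumB// ?z0 ?subr0// fsum_pos// z0.
Qed.

Lemma rsumD x y : fsum x -> fsum y -> rsum (fun i => x i + y i) = rsum x + rsum y.
Proof.
move=> fx fy.
rewrite (@eq_rsum _ (fun i => (pos x i + pos y i) - (neg x i + neg y i))); last first.
  by move=> i; rewrite [x i]posneg [y i]posneg; lra.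
have [px py] := (fsum_posi fx, fsum_posi fy).
have [nx ny] := (fsum_neg fx, fsum_neg fy).
rewrite rsumB; try (by move=> i; rewrite addr_ge0 ?pos_ge0 ?neg_ge0); try exact: fsumD.
rewrite !essumD; try exact: pos_ge0; try exact: neg_ge0.
rewrite !fineD ?fsum_fin//; try exact: pos_ge0; try exact: neg_ge0.
by rewrite /rsum -!/(essum _) -!/(pos _) -!/(neg _); lra.
Qed.

Lemma rsumN x : rsum (fun i => - x i) = - rsum x.
Proof.
rewrite /rsum opprB; congr (fine _ - fine _).
by apply: eq_esum => i _; rewrite opprK.
Qed.

Lemma rsumZ k x : fsum x -> rsum (fun i => k * x i) = k * rsum x.
Proof.
wlog k0 : k / 0 <= k.
  move=> H fx; case: (leP 0 k) => k0; first exact: H.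
  rewrite -[in LHS](opprK k); under eq_rsum do rewrite mulNr.
  by rewrite rsumN H ?oppr_ge0 ?ltW//; lra.
move=> fx; rewrite (@eq_rsum _ (fun i => k * pos x i - k * neg x i)); last first.
  by move=> i; rewrite [x i]posneg; lra.
have [p0 n0] := (pos_ge0 x, neg_ge0 x).
have [px nx] := (fsum_posi fx, fsum_neg fx).
rewrite rsumB; try (by move=> i; exact: mulr_ge0); try exact: fsumZ.
by rewrite !essumZ// !fineM ?fsum_fin//= -mulrBr.
Qed.

Lemma rsum_le x y : fsum x -> fsum y -> (forall i, x i <= y i) -> rsum x <= rsum y.
Proof.
move=> fx fy xy; rewrite -subr_ge0 -rsumN -rsumD//; last exact: fsumN.
rewrite rsum_pos ?fine_ge0 ?essum_ge0//; try (by move=> i; rewrite subr_ge0).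
by apply: fsumD => //; exact: fsumN.
Qed.

Lemma fsum_norm x : fsum x -> fsum (fun i => `|x i|).
Proof. by apply: fsum_le => i; rewrite normr_id. Qed.

Lemma essum_seq (s : seq I) p : uniq s -> (forall i, 0 <= p i) ->
  (forall i, i \notin s -> p i = 0) -> essum p = (\sum_(i <- s) p i)%:E.
Proof.
move=> us p0 ps; rewrite /essum.
have -> : \esum_(i in [set: I]) (p i)%:E = \esum_(i in [set` s]) (p i)%:E.
  rewrite [RHS]esum_mkcond; apply: eq_esum => i _.
  by case: ifPn => //; rewrite notin_setE /= => /negP/ps ->.
rewrite esum_fset//; last by move=> i _; rewrite lee_fin.
by rewrite -fsbig_seq// sumEFin.
Qed.

Lemma fsum_seq (s : seq I) x : uniq s -> (forall i, i \notin s -> x i = 0) -> fsum x.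
Proof.
by move=> us xs; rewrite /fsum (essum_seq us)// ?ltry// => i /xs ->; rewrite normr0.
Qed.

Lemma rsum_seq (s : seq I) x : uniq s -> (forall i, i \notin s -> x i = 0) ->
  rsum x = \sum_(i <- s) x i.
Proof.
move=> us xs; rewrite /rsum -!/(essum _) -/(pos x) -/(neg x).
rewrite !(essum_seq us) ?fineE; try exact: pos_ge0; try exact: neg_ge0.
- by rewrite /= -sumrB; apply: eq_bigr => i _; rewrite -posneg.
- by move=> i /xs xi; rewrite /neg xi oppr0 max_r.
- by move=> i /xs xi; rewrite /pos xi max_r.
Qed.

Lemma sum_le_essum (s : seq I) p : uniq s -> (forall i, 0 <= p i) ->
  ((\sum_(i <- s) p i)%:E <= essum p)%E.
Proof.
move=> us p0; rewrite -[X in (X <= _)%E](_ : essum (fun i => if i \in s then p i else 0) = _).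
  by apply: le_essum => i; case: ifP.
rewrite (essum_seq us); last 2 first.
- by move=> i; case: ifP.
- by move=> i /negbTE ->.
by congr EFin; apply: eq_big_seq => i ->.
Qed.

Lemma essum_le_ub (M : \bar R) p : (forall i, 0 <= p i) ->
  (forall s : seq I, uniq s -> ((\sum_(i <- s) p i)%:E <= M)%E) -> (essum p <= M)%E.
Proof.
move=> p0 H; apply: ge_ereal_sup => _ [F [finF _] <-].
by rewrite fsbig_finite// sumEFin; exact: H.
Qed.

End RealSums.

Lemma essum_exchange (R : realType) (I J : choiceType) (p : I -> J -> R) :
  (forall i j, 0 <= p i j) ->
  (\esum_(i in [set: I]) \esum_(j in [set: J]) (p i j)%:E =
  \esum_(j in [set: J]) \esum_(i in [set: I]) (p i j)%:E)%E.
Proof.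
move=> p0; rewrite (@esum_esum R I J setT (fun=> setT)); last by move=> i j _ _; rewrite lee_fin.
rewrite (@esum_esum R J I setT (fun=> setT)); last by move=> i j _ _; rewrite lee_fin.
rewrite (reindex_esum ([set z | setT z.1 /\ setT z.2] : set (J * I)) _ (fun z => (z.2, z.1)))//.
split => //= [[z1 z2] [w1 w2] _ _ [-> ->]//|[i j] _].
by exists (j, i).
Qed.

(** * Moduli of complex numbers *)

Section Modulus.
Context {R : realType}.
Implicit Types (z w : R[i]).

(** Squares of moduli are kept polynomial in the real and imaginary parts, so that [ring] settles
    identities and measurability is immediate. *)
Definition sqn z : R := complex.Re z ^+ 2 + complex.Im z ^+ 2.

Lemma sqnE z : normc z ^+ 2 = sqn z.
Proof. by case: z => a b; rewrite /= sqr_sqrtr// addr_ge0// sqr_ge0. Qed.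

Lemma sqn_ge0 z : 0 <= sqn z.
Proof. by rewrite addr_ge0// sqr_ge0. Qed.

Lemma normc_ge0 z : 0 <= normc z.
Proof. by case: z => a b; exact: sqrtr_ge0. Qed.

Lemma sqnM z w : sqn (z * w) = sqn z * sqn w.
Proof. by case: z w => a b [c d]; rewrite /sqn /=; ring. Qed.

Lemma normcM z w : normc (z * w) = normc z * normc w.
Proof. exact: Normc.normcM. Qed.

Lemma normcJ z : normc (conjc z) = normc z.
Proof. by case: z => a b /=; rewrite sqrrN. Qed.

Lemma sqnJ z : sqn (conjc z) = sqn z.
Proof. by case: z => a b; rewrite /sqn /= sqrrN. Qed.

Lemma sqn0 : sqn 0 = 0.
Proof. by rewrite /sqn /= expr0n addr0. Qed.

Lemma sqn1 : sqn 1 = 1.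
Proof. by rewrite /sqn /= expr0n expr1n addr0. Qed.

Lemma sqn_eq0 z : sqn z = 0 -> z = 0.
Proof. by rewrite -sqnE => /eqP; rewrite sqrf_eq0 => /eqP/Normc.eq0_normc. Qed.

Lemma mulJc z : z * conjc z = (sqn z)%:C.
Proof.
by case: z => a b; apply/eqP; rewrite eq_complex /sqn /=; apply/andP; split; apply/eqP; ring.
Qed.

Lemma normcD z w : normc (z + w) <= normc z + normc w.
Proof. exact: le_normcD. Qed.

Lemma normcN z : normc (- z) = normc z.
Proof. by case: z => a b /=; rewrite !sqrrN. Qed.

Lemma normc_real (x : R) : normc x%:C = `|x|.
Proof. by rewrite /= expr0n addr0 sqrtr_sqr. Qed.

Lemma normcX z n : normc (z ^+ n) = normc z ^+ n.
Proof. by elim: n => [|n IH]; rewrite ?Normc.normc1// !exprS normcM IH. Qed.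

Lemma Re_le z : `|complex.Re z| <= normc z.
Proof.
case: z => a b /=; rewrite -sqrtr_sqr ler_sqrt ?lerDl ?sqr_ge0//.
by rewrite addr_ge0// sqr_ge0.
Qed.

Lemma Im_le z : `|complex.Im z| <= normc z.
Proof.
case: z => a b /=; rewrite -sqrtr_sqr ler_sqrt ?lerDr ?sqr_ge0//.
by rewrite addr_ge0// sqr_ge0.
Qed.

Lemma normc_le z : normc z <= `|complex.Re z| + `|complex.Im z|.
Proof.
rewrite -(@ler_pXn2r _ 2)// ?nnegrE ?normc_ge0 ?addr_ge0// sqnE /sqn sqrrD !real_normK ?num_real//.
by rewrite -addrA lerD2l lerDr mulrn_wge0// mulr_ge0.
Qed.

Lemma ReD z w : complex.Re (z + w) = complex.Re z + complex.Re w.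
Proof. by case: z w => [? ?] [? ?]. Qed.
Lemma ImD z w : complex.Im (z + w) = complex.Im z + complex.Im w.
Proof. by case: z w => [? ?] [? ?]. Qed.
Lemma ReN z : complex.Re (- z) = - complex.Re z.
Proof. by case: z. Qed.
Lemma ImN z : complex.Im (- z) = - complex.Im z.
Proof. by case: z. Qed.
Lemma ReM z w : complex.Re (z * w) = complex.Re z * complex.Re w - complex.Im z * complex.Im w.
Proof. by case: z w => [? ?] [? ?]. Qed.
Lemma ImM z w : complex.Im (z * w) = complex.Re z * complex.Im w + complex.Im z * complex.Re w.
Proof. by case: z w => [? ?] [? ?]. Qed.
Lemma ReJ z : complex.Re (conjc z) = complex.Re z.
Proof. by case: z. Qed.
Lemma ImJ z : complex.Im (conjc z) = - complex.Im z.
Proof. by case: z. Qed.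

Lemma Re_sum T (s : seq T) (F : T -> R[i]) :
  complex.Re (\sum_(i <- s) F i) = \sum_(i <- s) complex.Re (F i).
Proof. by elim: s => [|a s IH]; rewrite ?big_nil// !big_cons ReD IH. Qed.
Lemma Im_sum T (s : seq T) (F : T -> R[i]) :
  complex.Im (\sum_(i <- s) F i) = \sum_(i <- s) complex.Im (F i).
Proof. by elim: s => [|a s IH]; rewrite ?big_nil// !big_cons ImD IH. Qed.
Lemma complexP z w : complex.Re z = complex.Re w -> complex.Im z = complex.Im w -> z = w.
Proof. by case: z w => [? ?] [? ?] /= -> ->. Qed.

(** Arithmetic-geometric mean inequality with a free weight; choosing [k] only after summation or
    integration yields bounds of Cauchy-Schwarz type. *)
Lemma normcM_le (k : R) z w : 0 < k -> normc (z * w) <= (k * sqn z + k^-1 * sqn w) / 2.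
Proof.
move=> k0; rewrite normcM -!sqnE; set a := normc z; set b := normc w.
have := sqr_ge0 (k * a - b); rewrite -(@pmulr_rge0 _ k^-1) ?invr_gt0//.
have -> : k^-1 * (k * a - b) ^+ 2 = k * a ^+ 2 - 2 * (a * b) + k^-1 * b ^+ 2.
  by field; rewrite gt_eqF.
by lra.
Qed.

Lemma sqnD z w : sqn (z + w) <= 2 * sqn z + 2 * sqn w.
Proof.
case: z w => a b [c d]; rewrite /sqn /= -subr_ge0.
have -> : 2 * (a ^+ 2 + b ^+ 2) + 2 * (c ^+ 2 + d ^+ 2) - ((a + c) ^+ 2 + (b + d) ^+ 2)
  = (a - c) ^+ 2 + (b - d) ^+ 2 by ring.
by rewrite addr_ge0 ?sqr_ge0.
Qed.

Lemma sqnN z : sqn (- z) = sqn z.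
Proof. by rewrite /sqn ReN ImN !sqrrN. Qed.

End Modulus.

(** * Absolutely summable and square-summable complex families *)

Section ComplexSums.
Context {R : realType} {I : choiceType}.
Implicit Types (x y : I -> R[i]).

Definition asum x := fsum (fun i => normc (x i)).
Definition sqs x := essum (fun i => sqn (x i)).
Definition l2 x := (sqs x < +oo)%E.

Lemma asum_Re x : asum x -> fsum (fun i => complex.Re (x i)).
Proof. by apply: fsum_le => i; rewrite [leRHS]ger0_norm ?Re_le ?normc_ge0. Qed.
Lemma asum_Im x : asum x -> fsum (fun i => complex.Im (x i)).
Proof. by apply: fsum_le => i; rewrite [leRHS]ger0_norm ?Im_le ?normc_ge0. Qed.
Lemma asum_le x (p : I -> R) : (forall i, normc (x i) <= p i) -> fsum p -> asum x.
Proof.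
move=> h; apply: fsum_le => i; rewrite ger0_norm ?normc_ge0//.
by rewrite (le_trans (h i))// ler_norm.
Qed.
Lemma asum_ReIm x : fsum (fun i => complex.Re (x i)) -> fsum (fun i => complex.Im (x i)) -> asum x.
Proof.
move=> f g; apply: (asum_le (p := fun i => `|complex.Re (x i)| + `|complex.Im (x i)|)).
  by move=> i; exact: normc_le.
by apply: fsumD; exact: fsum_norm.
Qed.

Lemma asumD x y : asum x -> asum y -> asum (fun i => x i + y i).
Proof. by move=> fx fy; apply: asum_le (fsumD fx fy) => i; exact: normcD. Qed.
Lemma asumZ c x : asum x -> asum (fun i => c * x i).
Proof. by move=> fx; apply: asum_le (fsumZ (normc c) fx) => i; rewrite normcM. Qed.
Lemma asumJ x : asum x -> asum (fun i => conjc (x i)).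
Proof. by move=> fx; apply: asum_le fx => i; rewrite normcJ. Qed.
Lemma asumN x : asum x -> asum (fun i => - x i).
Proof. by move=> fx; apply: asum_le fx => i; rewrite normcN. Qed.

Lemma eq_csum x y : (forall i, x i = y i) -> csum x = csum y.
Proof. by move=> h; congr csum; apply/funext. Qed.

Lemma Re_csum x : complex.Re (csum x) = rsum (fun i => complex.Re (x i)).
Proof. by []. Qed.
Lemma Im_csum x : complex.Im (csum x) = rsum (fun i => complex.Im (x i)).
Proof. by []. Qed.

Lemma csumD x y : asum x -> asum y -> csum (fun i => x i + y i) = csum x + csum y.
Proof.
move=> fx fy; apply: complexP; [rewrite ReD|rewrite ImD].
  rewrite !Re_csum -rsumD; [|exact: asum_Re..].
  by apply: eq_rsum => i; rewrite ReD.
rewrite !Im_csum -rsumD; [|exact: asum_Im..].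
by apply: eq_rsum => i; rewrite ImD.
Qed.

Lemma csumZ c x : asum x -> csum (fun i => c * x i) = c * csum x.
Proof.
move=> fx; have [fR fI] := (asum_Re fx, asum_Im fx).
apply: complexP; [rewrite ReM|rewrite ImM]; rewrite !Re_csum !Im_csum -!rsumZ//.
  rewrite -rsumN -rsumD; [|exact: fsumZ|by apply: fsumN; exact: fsumZ].
  by apply: eq_rsum => i; rewrite ReM.
rewrite -rsumD; [|exact: fsumZ..].
by apply: eq_rsum => i; rewrite ImM.
Qed.

Lemma csumJ x : csum (fun i => conjc (x i)) = conjc (csum x).
Proof.
apply: complexP; [rewrite ReJ|rewrite ImJ]; rewrite ?Re_csum ?Im_csum -?rsumN;
  by apply: eq_rsum => i; rewrite ?ReJ ?ImJ.
Qed.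

Lemma csumN x : csum (fun i => - x i) = - csum x.
Proof.
apply: complexP; [rewrite ReN|rewrite ImN]; rewrite ?Re_csum ?Im_csum -?rsumN;
  by apply: eq_rsum => i; rewrite ?ReN ?ImN.
Qed.

Lemma csumB x y : asum x -> asum y -> csum (fun i => x i - y i) = csum x - csum y.
Proof. by move=> fx fy; rewrite csumD// ?csumN//; exact: asumN. Qed.

Lemma asum_fin x : asum x -> essum (fun i => normc (x i)) \is a fin_num.
Proof. by move=> fx; apply: fsum_fin => // i; exact: normc_ge0. Qed.

Lemma csum_norm x : asum x -> normc (csum x) <= fine (essum (fun i => normc (x i))).
Proof.
move=> fx; have [x0|x0] := eqVneq (csum x) 0.
  by rewrite x0 Normc.normc0 fine_ge0// essum_ge0// => i; exact: normc_ge0.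
set w := csum x; have n0 : normc w != 0 by apply: contra_neq x0 => /Normc.eq0_normc.
(* Multiplication by the unimodular [u] turns the sum into its modulus, so only a real part has to
   be compared with the sum of moduli. *)
pose u : R[i] := conjc w * (normc w)^-1%:C.
have nu : normc u = 1.
  by rewrite normcM normcJ normc_real ger0_norm ?invr_ge0 ?normc_ge0// divff.
have -> : normc w = complex.Re (csum (fun i => u * x i)).
  rewrite csumZ// /u -/w mulrAC (mulrC (conjc w)) mulJc -sqnE -rmorphM /=.
  by rewrite expr2 mulfK.
rewrite -[X in _ <= X]rsum_pos//; last by move=> i; exact: normc_ge0.
apply: rsum_le => //; first by apply: asum_Re; exact: asumZ.
move=> i; rewrite (le_trans (ler_norm _))// (le_trans (Re_le _))//.
by rewrite normcM nu mul1r.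
Qed.

Lemma csum_seq (s : seq I) x : uniq s -> (forall i, i \notin s -> x i = 0) ->
  csum x = \sum_(i <- s) x i.
Proof.
move=> us xs; by apply: complexP; rewrite ?Re_sum ?Im_sum ?Re_csum ?Im_csum; apply: rsum_seq => // i /xs ->.
Qed.

Lemma asum_seq (s : seq I) x : uniq s -> (forall i, i \notin s -> x i = 0) -> asum x.
Proof. by move=> us xs; apply: (fsum_seq us) => i /xs ->; rewrite Normc.normc0. Qed.

Lemma sqs_ge0 x : (0 <= sqs x)%E.
Proof. by apply: essum_ge0 => i; exact: sqn_ge0. Qed.

Lemma l2_fin x : l2 x -> sqs x \is a fin_num.
Proof. by move=> lx; rewrite ge0_fin_numE ?sqs_ge0. Qed.

Lemma l2_fsum x : l2 x = fsum (fun i => sqn (x i)).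
Proof. by rewrite fsum_pos// => i; exact: sqn_ge0. Qed.

Lemma l2norm_sqs x : l2norm x = sqrte (sqs x).
Proof. by congr sqrte; apply: eq_esum => i _; rewrite sqnE. Qed.

Lemma sqr_l2norm x : (l2norm x ^+ 2)%E = sqs x.
Proof. by rewrite l2norm_sqs sqr_sqrte// sqs_ge0. Qed.

Lemma in_l2P x : in_l2 x <-> l2 x.
Proof.
rewrite /in_l2 l2norm_sqs /l2.
by have := sqs_ge0 x; case: (sqs x) => //= r; rewrite !ltry.
Qed.

Lemma l2D x y : l2 x -> l2 y -> l2 (fun i => x i + y i).
Proof.
rewrite !l2_fsum => fx fy.
apply: fsum_le (fsumD (fsumZ 2 fx) (fsumZ 2 fy)) => i.
rewrite ger0_norm ?sqn_ge0// (le_trans (sqnD _ _))// ler_norm//.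
Qed.

Lemma l2Z c x : l2 x -> l2 (fun i => c * x i).
Proof. by rewrite !l2_fsum => fx; apply: fsum_le (fsumZ (sqn c) fx) => i; rewrite sqnM. Qed.

Lemma l2J x : l2 (fun i => conjc (x i)) = l2 x.
Proof. by rewrite /l2 /sqs; congr (_ < _)%E; apply: eq_essum => i; rewrite sqnJ. Qed.

Lemma l2N x : l2 (fun i => - x i) = l2 x.
Proof. by rewrite /l2 /sqs; congr (_ < _)%E; apply: eq_essum => i; rewrite sqnN. Qed.

Lemma l2_seq (s : seq I) x : uniq s -> (forall i, i \notin s -> x i = 0) -> l2 x.
Proof.
by move=> us xs; rewrite l2_fsum; apply: (fsum_seq us) => i /xs ->; rewrite sqn0.
Qed.

Lemma l2M x y : l2 x -> l2 y -> asum (fun i => x i * y i).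
Proof.
rewrite !l2_fsum => fx fy; apply: asum_le (fsumD fx fy) => i.
apply: le_trans (@normcM_le _ 1 _ _ ltr01) _; rewrite invr1 !mul1r.
by have := sqn_ge0 (x i); have := sqn_ge0 (y i); lra.
Qed.

Lemma csum_sqn x : l2 x -> csum (fun i => x i * conjc (x i)) = (fine (sqs x))%:C.
Proof.
move=> lx; rewrite (eq_csum (fun i => mulJc (x i))); apply: complexP; rewrite ?Re_csum ?Im_csum.
  by rewrite /= rsum_pos// -?l2_fsum// => i; exact: sqn_ge0.
by rewrite (rsum_seq (s := [::]))// big_nil.
Qed.

Lemma le_sqr_of_amgm (w a b : R) : 0 <= w -> 0 <= a -> 0 <= b ->
  (forall k, 0 < k -> w <= (k * a + k^-1 * b) / 2) -> w ^+ 2 <= a * b.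
Proof.
move=> w0 a0 b0 H; have [->|wn0] := eqVneq w 0; first by rewrite expr0n mulr_ge0.
have {wn0}w0 : 0 < w by rewrite lt_neqAle eq_sym wn0.
have [aw|a_] := leP a 0.
  have a00 : a = 0 by apply/eqP; rewrite eq_le aw.
  (* For a = 0 the bound at this [k] is w b / (2 (b + 1)), which is smaller than w: a
     contradiction. *)
  have k0 : 0 < (b + 1) / w by rewrite divr_gt0// ltr_wpDl.
  have := H _ k0; rewrite a00 invf_div mulr0 add0r mul0r.
  suff : w / (b + 1) * b < w by lra.
  by rewrite mulrAC ltr_pdivrMr ?ltr_wpDl// ltr_pM2l// ltrDl.
(* The weight k = w / a turns the hypothesis into w <= (w + a b / w) / 2, which is the claim after
   multiplication by w. *)
have := H _ (divr_gt0 w0 a_); rewrite invf_div divfK ?gt_eqF// => /(ler_wpM2l (ltW w0)).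
have -> : w * ((w + a / w * b) / 2) = (w ^+ 2 + a * b) / 2 by field; rewrite gt_eqF.
rewrite expr2; lra.
Qed.

(** The weighted mean inequality is summed over the index for every [k], and the best weight is
    taken only afterwards, by [le_sqr_of_amgm]. *)
Lemma cauchy_schwarz x y : l2 x -> l2 y ->
  sqn (csum (fun i => x i * y i)) <= fine (sqs x) * fine (sqs y).
Proof.
move=> lx ly; rewrite -sqnE; apply: le_sqr_of_amgm; rewrite ?normc_ge0 ?fine_ge0 ?sqs_ge0//.
move=> k k0; apply: le_trans (csum_norm (l2M lx ly)) _.
move: (lx) (ly); rewrite !l2_fsum => fx fy.
have h (c : R) z : 0 < c -> forall i : I, 0 <= c * sqn (z i).
  by move=> c0 i; rewrite mulr_ge0 ?sqn_ge0 ?ltW.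
have K0 : 0 < k / 2 by rewrite divr_gt0.
have K1 : 0 < k^-1 / 2 by rewrite divr_gt0// invr_gt0.
have -> : (k * fine (sqs x) + k^-1 * fine (sqs y)) / 2 =
   fine (essum (fun i => k / 2 * sqn (x i) + k^-1 / 2 * sqn (y i))).
  rewrite essumD; try exact: h.
  rewrite !essumZ ?(ltW K0) ?(ltW K1)//; try by move=> i; exact: sqn_ge0.
  have [sx sy] := (l2_fin lx, l2_fin ly).
  by rewrite fineD ?fin_numM// !fineM//=; lra.
apply: fine_le.
- exact: (asum_fin (l2M lx ly)).
- apply: fsum_fin => [i|]; first by rewrite addr_ge0 ?h.
  by apply: fsumD; exact: fsumZ.
- apply: le_essum => i; apply: le_trans (@normcM_le _ k _ _ k0) _.
  by rewrite le_eqVlt; apply/orP; left; apply/eqP; lra.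
Qed.

End ComplexSums.

Lemma csum_ord {R : realType} n (x : 'I_n -> R[i]) : csum x = \sum_i x i.
Proof.
rewrite (csum_seq (enum_uniq 'I_n)); last by move=> i; rewrite mem_enum.
by rewrite enumT.
Qed.

Lemma essum_sumtype {R : realType} (I J : choiceType) (p : (I + J)%type -> R) :
  (forall i, 0 <= p i) ->
  essum p = (essum (fun i => p (inl i)) + essum (fun j => p (inr j)))%E.
Proof.
move=> p0; rewrite /essum.
rewrite (esumID (range inl)); last by move=> i _; rewrite lee_fin.
rewrite !setTI; congr (_ + _)%E.
  by rewrite esum_image// => i j _ _ [].
rewrite (_ : ~` _ = range inr).
  by rewrite esum_image// => i j _ _ [].
apply/seteqP; split => [[i|j] //= h|_ [j _ <-] [i _]//]; by [case: h; exists i|exists j].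
Qed.

Lemma csum_sumtype {R : realType} (I J : choiceType) (x : (I + J)%type -> R[i]) :
  asum (fun i => x (inl i)) -> asum (fun j => x (inr j)) ->
  csum x = csum (fun i => x (inl i)) + csum (fun j => x (inr j)).
Proof.
move=> fx fy.
have H (f : R[i] -> R) : fsum (fun i => f (x (inl i))) -> fsum (fun j => f (x (inr j))) ->
    rsum (fun i => f (x i)) = rsum (fun i => f (x (inl i))) + rsum (fun j => f (x (inr j))).
  move=> gx gy; rewrite /rsum -!/(essum _).
  rewrite !(essum_sumtype (p := fun _ => Num.max _ 0)); try by move=> i; rewrite le_max lexx orbT.
  have [px py] := (fsum_posi gx, fsum_posi gy).
  have [nx ny] := (fsum_neg gx, fsum_neg gy).
  rewrite !fineD; try (by apply: fsum_fin => // i; exact: pos_ge0);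
   try (by apply: fsum_fin => // i; exact: neg_ge0).
  by lra.
apply: complexP; [rewrite ReD !Re_csum|rewrite ImD !Im_csum].
  by apply: (H (@complex.Re R)); exact: asum_Re.
by apply: (H (@complex.Im R)); exact: asum_Im.
Qed.

Lemma rsum_iterated (R : realType) (I J : choiceType) (x : I -> J -> R) :
  (\esum_(i in [set: I]) \esum_(j in [set: J]) `|x i j|%:E < +oo)%E ->
  rsum (fun i => rsum (x i)) = fine (\esum_(i in [set: I]) essum (pos (x i))) -
    fine (\esum_(i in [set: I]) essum (neg (x i))).
Proof.
move=> fx.
have fxi i : fsum (x i).
  rewrite /fsum; apply: le_lt_trans fx.
  rewrite -(@esum_set1 _ _ i (fun i => essum (fun j => `|x i j|))) ?essum_ge0//.
  rewrite esum_mkcond; apply: le_esum => k _; case: ifP => // _; exact: essum_ge0.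
have K (p : I -> J -> R) : (forall i j, 0 <= p i j) -> (forall i j, p i j <= `|x i j|) ->
    fsum (fun i => fine (essum (p i))) /\
    essum (fun i => fine (essum (p i))) = \esum_(i in [set: I]) essum (p i).
  move=> p0 px.
  have E : essum (fun i => fine (essum (p i))) = \esum_(i in [set: I]) essum (p i).
    apply: eq_esum => i _; rewrite fineK//; apply: fsum_fin => //.
    by apply: fsum_le (fxi i) => j; rewrite ger0_norm.
  split => //; rewrite fsum_pos ?E; last by move=> i; rewrite fine_ge0// essum_ge0.
  by apply: le_lt_trans fx; apply: le_esum => i _; exact: le_essum.
have [fp Ep] := K _ (fun i => pos_ge0 (x i)) (fun i => pos_le (x i)).
have [fn En] := K _ (fun i => neg_ge0 (x i)) (fun i => neg_le (x i)).
rewrite -Ep -En -rsumB//; first by move=> i; rewrite fine_ge0// essum_ge0// => j; exact: pos_ge0.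
by move=> i; rewrite fine_ge0// essum_ge0// => j; exact: neg_ge0.
Qed.

Lemma rsum_exchange (R : realType) (I J : choiceType) (x : I -> J -> R) :
  (\esum_(i in [set: I]) \esum_(j in [set: J]) `|x i j|%:E < +oo)%E ->
  rsum (fun i => rsum (x i)) = rsum (fun j => rsum (x^~ j)).
Proof.
move=> fx; have fx' := fx; rewrite essum_exchange// in fx'.
rewrite (rsum_iterated fx) (rsum_iterated (x := fun j i => x i j) fx').
by congr (fine _ - fine _); rewrite /essum essum_exchange// => i j; rewrite ?pos_ge0 ?neg_ge0.
Qed.

Lemma csum_exchange (R : realType) (I J : choiceType) (x : I -> J -> R[i]) :
  (\esum_(i in [set: I]) essum (fun j => normc (x i j)) < +oo)%E ->
  csum (fun i => csum (x i)) = csum (fun j => csum (x^~ j)).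
Proof.
move=> fx; apply: complexP; rewrite ?Re_csum ?Im_csum.
  rewrite [LHS]rsum_exchange//; apply: le_lt_trans fx.
  by apply: le_esum => i _; apply: le_essum => j; exact: Re_le.
rewrite [LHS]rsum_exchange//; apply: le_lt_trans fx.
by apply: le_esum => i _; apply: le_essum => j; exact: Im_le.
Qed.

(** * The circle parametrised by angles *)

Section Circle.
Context {R : realType}.
Local Notation mu := (@lebesgue_measure R).
Local Notation D := (@angles R).

#[global] Instance ae_filter : @Filter R (nbhs (almost_everywhere mu)).
Proof. exact: (ae_filter_ringOfSetsType mu). Qed.

Definition aeD (P : R -> Prop) := {ae mu, forall t, D t -> P t}.

Lemma mD : measurable (D : set (measurableTypeR R)).
Proof. exact: measurable_itv. Qed.

Lemma pi2_gt0 : 0 < 2 * pi :> R.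
Proof. by rewrite mulr_gt0// pi_gt0. Qed.

Lemma mu_D : mu D = (2 * pi)%:E.
Proof.
by rewrite /angles lebesgue_measure_itv /= lte_fin pi2_gt0 oppr0 adde0.
Qed.

Lemma aeDW (P : R -> Prop) : (forall t, P t) -> aeD P.
Proof. by move=> h; apply: aeW => t _. Qed.

Lemma aeD_imp (P Q : R -> Prop) : (forall t, D t -> P t -> Q t) -> aeD P -> aeD Q.
Proof. by rewrite /aeD => h; apply: filterS => t Pt Dt; apply: h => //; exact: Pt. Qed.

Lemma aeD_and (P Q : R -> Prop) : aeD P -> aeD Q -> aeD (fun t => P t /\ Q t).
Proof. by rewrite /aeD => p q; apply: filterS2 p q => t Pt Qt Dt; split; [exact: Pt|exact: Qt]. Qed.

Lemma aeD_forall (I : countType) (P : I -> R -> Prop) :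
  (forall i, aeD (P i)) -> aeD (fun t => forall i, P i t).
Proof.
move=> h; have : {ae mu, forall t, forall n, D t -> oapp (P^~ t) True (unpickle (s := I) n)}.
  apply: ae_foralln => n; case: (unpickle n) => [i|] /=; first exact: h.
  exact: aeW.
by rewrite /aeD; apply: filterS => t H Dt i; have := H (pickle i) Dt; rewrite pickleK.
Qed.

(** * Measurable complex functions of the angle *)

Definition cmeas (g : R -> R[i]) :=
  measurable_fun D (fun t => complex.Re (g t)) /\ measurable_fun D (fun t => complex.Im (g t)).

Lemma eq_cmeas f g : (forall t, f t = g t) -> cmeas f -> cmeas g.
Proof. by move=> /funext ->. Qed.

Lemma cmeas_cst c : cmeas (fun=> c).
Proof. by split; exact: measurable_cst. Qed.

Lemma cmeasD f g : cmeas f -> cmeas g -> cmeas (fun t => f t + g t).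
Proof.
move=> [f1 f2] [g1 g2]; split; [under eq_fun do rewrite ReD|under eq_fun do rewrite ImD];
  exact: measurable_funD.
Qed.

Lemma cmeasM f g : cmeas f -> cmeas g -> cmeas (fun t => f t * g t).
Proof.
move=> [f1 f2] [g1 g2]; split; [under eq_fun do rewrite ReM|under eq_fun do rewrite ImM].
  by apply: measurable_funB; exact: measurable_funM.
by apply: measurable_funD; exact: measurable_funM.
Qed.

Lemma cmeasN f : cmeas f -> cmeas (fun t => - f t).
Proof.
move=> mf; apply: (@eq_cmeas (fun t => (-1) * f t)); first by move=> t; rewrite mulN1r.
by apply: cmeasM => //; exact: cmeas_cst.
Qed.

Lemma cmeasB f g : cmeas f -> cmeas g -> cmeas (fun t => f t - g t).
Proof. by move=> mf mg; apply: cmeasD => //; exact: cmeasN. Qed.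

Lemma cmeasJ f : cmeas f -> cmeas (fun t => conjc (f t)).
Proof.
move=> [f1 f2]; split; [under eq_fun do rewrite ReJ|under eq_fun do rewrite ImJ] => //.
exact: measurableT_comp.
Qed.

Lemma measurable_sqn f : cmeas f -> measurable_fun D (fun t => sqn (f t)).
Proof. by move=> [f1 f2]; apply: measurable_funD; apply: measurable_funX. Qed.

Lemma measurable_normc f : cmeas f -> measurable_fun D (fun t => normc (f t)).
Proof.
move=> /measurable_sqn mf.
have -> : (fun t => normc (f t)) = (fun t => Num.sqrt (sqn (f t))).
  by apply/funext => t; rewrite -sqnE sqrtr_sqr ger0_norm ?normc_ge0.
apply: measurableT_comp mf; apply: continuous_measurable_fun; exact: sqrt_continuous.
Qed.

Lemma cmeas_expi : cmeas (@expi R).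
Proof.
split; apply: measurable_funTS; apply: continuous_measurable_fun;
  [exact: continuous_cos|exact: continuous_sin].
Qed.

Lemma cmeas_expiX n : cmeas (fun t : R => expi t ^+ n).
Proof.
elim: n => [|n IH].
  by apply: (@eq_cmeas (fun=> 1)) (cmeas_cst _) => t; rewrite expr0.
apply: (@eq_cmeas (fun t => expi t * expi t ^+ n)); first by move=> t; rewrite exprS.
by apply: cmeasM => //; exact: cmeas_expi.
Qed.

(** * Countable sums *)

Section Countable.
Context {I : countType}.

(** Reindexing along [pickle] turns the sum over a countable type into a series over [nat], with
    value 0 at codes that are not reached, so that monotone convergence for series becomes
    available. *)
Lemma essum_nneseries (p : I -> R) : (forall i, 0 <= p i) ->
  essum p = (\sum_(n <oo) (oapp p 0 (pickle_inv (T := I) n))%:E)%E.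
Proof.
move=> p0; rewrite nneseries_esumT; last first.
  by move=> n; rewrite lee_fin; case: pickle_inv.
rewrite [RHS](_ : _ = \esum_(n in range (@pickle I)) (oapp p 0 (pickle_inv (T := I) n))%:E).
  rewrite esum_image; last by move=> i j _ _ /(pcan_inj pickleK).
  by apply: eq_esum => i _; rewrite pickleK_inv.
rewrite [RHS]esum_mkcond; apply: eq_esum => n _; case: ifPn => //.
rewrite notin_setE /= => h; case E: pickle_inv => [i|] //=.
by exfalso; apply: h; exists i => //; have := pickle_invK (T := I) n; rewrite E.
Qed.

Lemma measurable_essum (p : I -> R -> R) : (forall i t, 0 <= p i t) ->
  (forall i, measurable_fun D (p i)) ->
  measurable_fun D (fun t => essum (fun i => p i t)).
Proof.
move=> p0 mp; under eq_fun do rewrite essum_nneseries//.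
apply: ge0_emeasurable_sum => [n t _ _|n _]; first by rewrite lee_fin; case: pickle_inv => /=.
apply/measurable_EFinP; case: (pickle_inv n) => [i|] /=; first exact: mp.
exact: measurable_cst.
Qed.

Lemma measurable_rsum (x : I -> R -> R) :
  (forall i, measurable_fun D (x i)) -> measurable_fun D (fun t => rsum (fun i => x i t)).
Proof.
move=> mx; apply: measurable_funB; apply: measurableT_comp => //.
  apply: (@measurable_essum (fun i t => Num.max (x i t) 0)) => [i t|i].
    exact: (pos_ge0 (x ^~ t)).
  by apply: measurable_maxr => //; exact: measurable_cst.
apply: (@measurable_essum (fun i t => Num.max (- x i t) 0)) => [i t|i].
  exact: (neg_ge0 (x ^~ t)).
by apply: measurable_maxr; [exact: measurableT_comp|exact: measurable_cst].
Qed.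

Lemma cmeas_csum (x : I -> R -> R[i]) :
  (forall i, cmeas (x i)) -> cmeas (fun t => csum (fun i => x i t)).
Proof.
move=> mx; split.
  by apply: (@measurable_rsum (fun i t => complex.Re (x i t))) => i; have [] := mx i.
by apply: (@measurable_rsum (fun i t => complex.Im (x i t))) => i; have [] := mx i.
Qed.

End Countable.

(** * Means over the circle *)

Definition mE (p : R -> \bar R) : \bar R := ((2 * pi)^-1%:E * \int[mu]_(t in D) p t)%E.

Let c0 : 0 <= (2 * pi)^-1 :> R. Proof. by rewrite invr_ge0 ltW ?pi2_gt0. Qed.
Lemma mE_ge0 p : (forall t, 0 <= p t)%E -> (0 <= mE p)%E.
Proof. by move=> p0; rewrite mule_ge0 ?lee_fin// integral_ge0. Qed.

Lemma eq_mE p q : (forall t, p t = q t) -> mE p = mE q.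
Proof. by move=> /funext ->. Qed.

Lemma ae_le_mE (p q : R -> \bar R) : (forall t, 0 <= p t)%E -> (forall t, 0 <= q t)%E ->
  measurable_fun D p -> measurable_fun D q ->
  aeD (fun t => p t <= q t)%E -> (mE p <= mE q)%E.
Proof.
move=> p0 q0 mp mq h; apply: lee_wpmul2l; first by rewrite lee_fin.
by apply: ae_ge0_le_integral => //; exact: mD.
Qed.

Lemma le_mE (p q : R -> \bar R) : (forall t, 0 <= p t)%E ->
  measurable_fun D p -> measurable_fun D q ->
  (forall t, p t <= q t)%E -> (mE p <= mE q)%E.
Proof.
move=> p0 mp mq h; apply: ae_le_mE => //; last exact: aeDW.
by move=> t; exact: le_trans (h t).
Qed.

Lemma ae_eq_mE (p q : R -> \bar R) : (forall t, 0 <= p t)%E -> (forall t, 0 <= q t)%E ->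
  measurable_fun D p -> measurable_fun D q ->
  aeD (fun t => p t = q t)%E -> mE p = mE q.
Proof.
by move=> p0 q0 mp mq h; apply/eqP; rewrite eq_le; apply/andP; split;
  apply: ae_le_mE => //; apply: aeD_imp h => t _ ->.
Qed.

Lemma mED (p q : R -> \bar R) : (forall t, 0 <= p t)%E -> (forall t, 0 <= q t)%E ->
  measurable_fun D p -> measurable_fun D q ->
  mE (fun t => p t + q t)%E = (mE p + mE q)%E.
Proof.
move=> p0 q0 mp mq; rewrite /mE ge0_integralD//; last exact: mD.
by rewrite ge0_muleDr// integral_ge0.
Qed.

Lemma mEZ (k : R) (p : R -> \bar R) : 0 <= k -> (forall t, 0 <= p t)%E ->
  measurable_fun D p -> mE (fun t => k%:E * p t)%E = (k%:E * mE p)%E.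
Proof.
move=> k0 p0 mp; rewrite /mE ge0_integralZl_EFin//; last exact: mD.
by rewrite muleCA.
Qed.

Lemma mE_cst (k : R) : mE (fun=> k%:E) = k%:E.
Proof.
rewrite /mE integral_cst; last exact: mD.
rewrite [X in (_ * X)%E](_ : _ = k%:E * (2 * pi)%:E)%E; last by congr (_ * _)%E; exact: mu_D.
by rewrite -!EFinM mulrC mulfK// gt_eqF// pi2_gt0.
Qed.

Lemma mE_lty (p : R -> \bar R) : (mE p < +oo)%E -> (forall t, 0 <= p t)%E ->
  (\int[mu]_(t in D) p t < +oo)%E.
Proof.
move=> + p0; have : (0 <= \int[mu]_(t in D) p t)%E by exact: integral_ge0.
rewrite /mE; case: integral => [r||]//; first by rewrite !ltry.
by rewrite gt0_muley// lte_fin invr_gt0 pi2_gt0.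
Qed.

Lemma mE_ae_fin (p : R -> \bar R) : (forall t, 0 <= p t)%E -> measurable_fun D p ->
  (mE p < +oo)%E -> aeD (fun t => p t < +oo)%E.
Proof.
move=> p0 mp /mE_lty/(_ p0) fp.
have ip : mu.-integrable D p.
  by apply/integrableP; split => //; under eq_integral do rewrite gee0_abs//.
have := integrable_ae mD ip; apply: filterS => t h Dt.
by rewrite -ge0_fin_numE ?p0//; exact: h.
Qed.

Lemma mE_essum {I : countType} (p : I -> R -> R) : (forall i t, 0 <= p i t) ->
  (forall i, measurable_fun D (p i)) ->
  mE (fun t => essum (fun i => p i t)) = \esum_(i in [set: I]) mE (fun t => (p i t)%:E).
Proof.
move=> p0 mp; rewrite /mE; under eq_integral do rewrite essum_nneseries//.
rewrite integral_nneseries; first last.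
- by move=> n t _; rewrite lee_fin; case: pickle_inv => /=.
- move=> n; apply/measurable_EFinP; case: (pickle_inv n) => [i|] /=; first exact: mp.
  exact: measurable_cst.
- exact: mD.
pose q i := (\int[mu]_(t in D) (p i t)%:E)%E.
have q0 i : (0 <= q i)%E by apply: integral_ge0 => t _; rewrite lee_fin.
have -> : (\sum_(n <oo) \int[mu]_(t in D) (oapp (p^~ t) 0 (pickle_inv (T := I) n))%:E)%E
    = \esum_(i in [set: I]) q i.
  rewrite nneseries_esumT; last first.
    by move=> n; apply: integral_ge0 => t _; rewrite lee_fin; case: pickle_inv => /=.
  rewrite [LHS](_ : _ = \esum_(n in range (@pickle I)) (oapp q 0 (pickle_inv (T := I) n)))%E.
    rewrite esum_image; last by move=> i j _ _ /(pcan_inj pickleK).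
    by apply: eq_esum => i _; rewrite pickleK_inv.
  rewrite [RHS]esum_mkcond; apply: eq_esum => n _; case: ifPn.
    by rewrite inE /= => -[i _ <-]; rewrite pickleK_inv.
  rewrite notin_setE /= => h; case E: pickle_inv => [i|] /=; last exact: integral0.
  by exfalso; apply: h; exists i => //; have := pickle_invK (T := I) n; rewrite E.
rewrite /esum -ereal_supZl//; last first.
  by apply/set0P; exists (\sum_(x \in set0) (q x))%E; exists set0 => //; split.
congr ereal_sup; rewrite image_comp; apply: eq_imagel => A _ /=.
by rewrite ge0_mule_fsumr.
Qed.

End Circle.

Section ComplexMeans.
Context {R : realType}.
Local Notation mu := (@lebesgue_measure R).
Local Notation D := (@angles R).
Implicit Types (f g u v : R -> R[i]).

(** For a function of the form g (expi t) this is convertible with [circle_int], which lets the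
    orthogonality relation of [riesz_proj] be rewritten as a [cmean]. *)
Definition cmean g : R[i] :=
  ((2 * pi)^-1 * Rintegral mu D (fun t => complex.Re (g t)))
  +i* ((2 * pi)^-1 * Rintegral mu D (fun t => complex.Im (g t))).

Definition m1 g : \bar R := mE (fun t => (normc (g t))%:E).
Definition m2 g : \bar R := mE (fun t => (sqn (g t))%:E).
Definition cint1 g := cmeas g /\ (m1 g < +oo)%E.
Definition cint2 g := cmeas g /\ (m2 g < +oo)%E.

Lemma m1_ge0 g : (0 <= m1 g)%E.
Proof. by apply: mE_ge0 => t; rewrite lee_fin normc_ge0. Qed.
Lemma m2_ge0 g : (0 <= m2 g)%E.
Proof. by apply: mE_ge0 => t; rewrite lee_fin sqn_ge0. Qed.

Lemma Emeasurable_normc g : cmeas g -> measurable_fun D (fun t => (normc (g t))%:E).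
Proof. by move=> /measurable_normc/measurable_EFinP. Qed.
Lemma Emeasurable_sqn g : cmeas g -> measurable_fun D (fun t => (sqn (g t))%:E).
Proof. by move=> /measurable_sqn/measurable_EFinP. Qed.

Lemma integrable_le_normc (p : R -> R) g : cint1 g -> measurable_fun D p ->
  (forall t, `|p t| <= normc (g t)) -> mu.-integrable D (EFin \o p).
Proof.
move=> [mg fg] mp h; apply/integrableP; split; first exact/measurable_EFinP.
apply: le_lt_trans (mE_lty fg _); last by move=> t; rewrite lee_fin normc_ge0.
apply: ge0_le_integral => //; first exact: mD.
- by apply: measurableT_comp => //; exact/measurable_EFinP.
- exact: Emeasurable_normc.
- by move=> t _; rewrite /= lee_fin.
Qed.

Lemma integrable_Re g : cint1 g -> mu.-integrable D (EFin \o (fun t => complex.Re (g t))).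
Proof. by move=> ig; apply: (integrable_le_normc ig) => [|t]; [case: ig => -[]|exact: Re_le]. Qed.
Lemma integrable_Im g : cint1 g -> mu.-integrable D (EFin \o (fun t => complex.Im (g t))).
Proof. by move=> ig; apply: (integrable_le_normc ig) => [|t]; [case: ig => -[]|exact: Im_le]. Qed.

Lemma cint1_le f (p : R -> \bar R) : cmeas f -> measurable_fun D p ->
  (forall t, (normc (f t))%:E <= p t)%E -> (mE p < +oo)%E -> cint1 f.
Proof.
move=> mf mp h fp; split => //; apply: le_lt_trans fp; apply: le_mE => //.
- by move=> t; rewrite lee_fin normc_ge0.
- exact: Emeasurable_normc.
Qed.

Lemma le_m1 f g : cmeas f -> cmeas g -> (forall t, normc (f t) <= normc (g t)) -> (m1 f <= m1 g)%E.
Proof.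
move=> mf mg h; apply: le_mE => [t|||t]; rewrite ?lee_fin ?normc_ge0//; exact: Emeasurable_normc.
Qed.
Lemma m1D f g : cmeas f -> cmeas g -> (m1 (fun t => (f t + g t)%R) <= m1 f + m1 g)%E.
Proof.
move=> mf mg; rewrite -mED; try by move=> t; rewrite lee_fin normc_ge0.
- apply: le_mE => [t|||t].
  + by rewrite lee_fin normc_ge0.
  + by apply: Emeasurable_normc; exact: cmeasD.
  + by apply: emeasurable_funD; exact: Emeasurable_normc.
  + by rewrite -EFinD lee_fin normcD.
- exact: Emeasurable_normc.
- exact: Emeasurable_normc.
Qed.

Lemma m1Z c f : cmeas f -> m1 (fun t => c * f t) = ((normc c)%:E * m1 f)%E.
Proof.
move=> mf; rewrite -mEZ ?normc_ge0//; last exact: Emeasurable_normc.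
- by apply: eq_mE => t; rewrite normcM.
- by move=> t; rewrite lee_fin normc_ge0.
Qed.

Lemma cint1D f g : cint1 f -> cint1 g -> cint1 (fun t => f t + g t).
Proof.
move=> [mf ff] [mg fg]; split; first exact: cmeasD.
by apply: le_lt_trans (m1D mf mg) _; rewrite lte_add_pinfty.
Qed.

Lemma cint1Z c f : cint1 f -> cint1 (fun t => c * f t).
Proof.
move=> [mf ff]; split; first by apply: cmeasM => //; exact: cmeas_cst.
by rewrite m1Z// lte_mul_pinfty// lee_fin normc_ge0.
Qed.

Lemma eq_cmean f g : (forall t, f t = g t) -> cmean f = cmean g.
Proof. by move=> /funext ->. Qed.

Lemma cint1N f : cint1 f -> cint1 (fun t => - f t).
Proof.
by move=> /(cint1Z (-1)); congr cint1; apply/funext => t; rewrite mulN1r.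
Qed.

Lemma cint1B f g : cint1 f -> cint1 g -> cint1 (fun t => f t - g t).
Proof. by move=> If Ig; apply: cint1D => //; exact: cint1N. Qed.

Lemma cint1J f : cint1 f -> cint1 (fun t => conjc (f t)).
Proof.
move=> [mf ff]; split; first exact: cmeasJ.
by rewrite /m1; under eq_mE do rewrite normcJ.
Qed.

Lemma cint1_bound (M : R) f : cmeas f -> (forall t, normc (f t) <= M) -> cint1 f.
Proof.
move=> mf h; apply: (cint1_le (p := fun=> M%:E)) => //.
by rewrite mE_cst ltry.
Qed.

Lemma cint1M_bound (M : R) f g : cmeas f -> (forall t, normc (f t) <= M) -> cint1 g ->
  cint1 (fun t => f t * g t).
Proof.
move=> mf h [mg fg].
have [_ K] : cint1 (fun t => M%:C * g t) by apply: cint1Z.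
split; first exact: cmeasM.
apply: le_lt_trans K; apply: le_m1; try (apply: cmeasM => //; exact: cmeas_cst).
move=> t; rewrite !normcM ler_wpM2r ?normc_ge0// normc_real.
by rewrite (le_trans (h t))// ler_norm.
Qed.

Lemma cint1_sum (I : Type) (s : seq I) (f : I -> R -> R[i]) :
  (forall i, cint1 (f i)) -> cint1 (fun t => \sum_(i <- s) f i t).
Proof.
move=> If; elim: s => [|i s IH].
  have -> : (fun t => \sum_(i <- [::]) f i t) = (fun=> 0) by apply/funext => t; rewrite big_nil.
  by apply: (cint1_bound (M := 0)) => [|t]; [exact: cmeas_cst|rewrite Normc.normc0].
have -> : (fun t => \sum_(j <- i :: s) f j t) = (fun t => f i t + \sum_(j <- s) f j t).
  by apply/funext => t; rewrite big_cons.
exact: cint1D.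
Qed.

Lemma cmeanD f g : cint1 f -> cint1 g -> cmean (fun t => f t + g t) = cmean f + cmean g.
Proof.
move=> If Ig; apply: complexP; [rewrite ReD /=|rewrite ImD /=]; rewrite -mulrDr.
  rewrite -RintegralD; [|exact: mD|exact: integrable_Re..].
  by congr (_ * _); apply: eq_Rintegral => t _; rewrite ReD.
rewrite -RintegralD; [|exact: mD|exact: integrable_Im..].
by congr (_ * _); apply: eq_Rintegral => t _; rewrite ImD.
Qed.

Lemma cmeanZ c f : cint1 f -> cmean (fun t => c * f t) = c * cmean f.
Proof.
move=> If; have [fR fI] := (integrable_Re If, integrable_Im If).
have E (a b : R) (p q : R -> R) : mu.-integrable D (EFin \o p) -> mu.-integrable D (EFin \o q) ->
    Rintegral mu D (fun t => a * p t + b * q t) = a * Rintegral mu D p + b * Rintegral mu D q.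
  move=> ip iq; rewrite RintegralD; last 3 first.
  - exact: mD.
  - exact: (integrableZl mD a ip).
  - exact: (integrableZl mD b iq).
  by rewrite !RintegralZl//; exact: mD.
apply: complexP; [rewrite ReM /=|rewrite ImM /=].
  transitivity ((2 * pi)^-1 * Rintegral mu D (fun t => complex.Re c * complex.Re (f t) +
      (- complex.Im c) * complex.Im (f t))).
    by congr (_ * _); apply: eq_Rintegral => t _; rewrite ReM; ring.
  by rewrite E//; ring.
transitivity ((2 * pi)^-1 * Rintegral mu D (fun t => complex.Re c * complex.Im (f t) +
      complex.Im c * complex.Re (f t))).
  by congr (_ * _); apply: eq_Rintegral => t _; rewrite ImM; ring.
by rewrite E//; ring.
Qed.

Lemma cmeanN f : cint1 f -> cmean (fun t => - f t) = - cmean f.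
Proof.
by move=> If; rewrite -mulN1r -cmeanZ//; apply: eq_cmean => t; rewrite mulN1r.
Qed.

Lemma cmeanB f g : cint1 f -> cint1 g -> cmean (fun t => f t - g t) = cmean f - cmean g.
Proof. by move=> If Ig; rewrite cmeanD ?cmeanN//; exact: cint1N. Qed.

Lemma cmeanJ f : cint1 f -> cmean (fun t => conjc (f t)) = conjc (cmean f).
Proof.
move=> If; apply: complexP; [rewrite ReJ /=|rewrite ImJ /=].
  by congr (_ * _); apply: eq_Rintegral => t _; rewrite ReJ.
rewrite -mulrN; congr (_ * _); rewrite -mulN1r -RintegralZl; [|exact: mD|exact: integrable_Im].
by apply: eq_Rintegral => t _; rewrite ImJ mulN1r.
Qed.

Lemma cmean0 : cmean (fun=> 0) = 0.
Proof.
have -> : cmean (fun=> 0) = cmean (fun=> 0 * 0) by apply: eq_cmean => t; rewrite mulr0.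
rewrite cmeanZ ?mul0r//.
by apply: (cint1_bound (M := 0)) => [|t]; [exact: cmeas_cst|rewrite Normc.normc0].
Qed.

Lemma cmean_cst c : cmean (fun=> c) = c.
Proof.
have E (k : R) : (2 * pi)^-1 * Rintegral mu D (fun=> k) = k.
  rewrite Rintegral_cst; last exact: mD.
  have -> : fine (mu D) = 2 * pi by rewrite (_ : mu D = (2 * pi)%:E)//; exact: mu_D.
  by rewrite mulrC mulfK// gt_eqF// pi2_gt0.
by apply: complexP; rewrite /= E.
Qed.

Lemma cmean_sum (I : Type) (s : seq I) (f : I -> R -> R[i]) : (forall i, cint1 (f i)) ->
  cmean (fun t => \sum_(i <- s) f i t) = \sum_(i <- s) cmean (f i).
Proof.
move=> If; elim: s => [|i s IH].
  by rewrite big_nil -[RHS]cmean0; apply: eq_cmean => t; rewrite big_nil.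
rewrite big_cons -IH -cmeanD//; last exact: cint1_sum.
by apply: eq_cmean => t; rewrite big_cons.
Qed.

Lemma Rint_le (p : R -> R) g : cint1 g -> measurable_fun D p ->
  (forall t, `|p t| <= normc (g t)) -> `|(2 * pi)^-1 * Rintegral mu D p| <= fine (m1 g).
Proof.
move=> Ig mp h; have ip := integrable_le_normc Ig mp h.
have i0 : 0 <= (2 * pi)^-1 :> R by rewrite invr_ge0 ltW ?pi2_gt0.
have fg : (\int[mu]_(t in D) (normc (g t))%:E < +oo)%E.
  by case: Ig => _ fg; apply: (mE_lty fg) => t; rewrite lee_fin normc_ge0.
have g0 : (0 <= \int[mu]_(t in D) (normc (g t))%:E)%E.
  by apply: integral_ge0 => t _; rewrite lee_fin normc_ge0.
rewrite normrM ger0_norm// /m1 /mE fineM ?ge0_fin_numE ?ltry//=.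
apply: ler_wpM2l => //; apply: le_trans (le_normr_Rintegral _ ip) _; first exact: mD.
apply: fine_le; rewrite ?ge0_fin_numE//.
- apply: le_lt_trans fg; apply: ge0_le_integral => //; first exact: mD.
  + by apply/measurable_EFinP; apply: measurableT_comp.
  + by case: Ig => mg _; exact: Emeasurable_normc.
  + by move=> t _; rewrite lee_fin.
- by apply: integral_ge0 => t _; rewrite lee_fin.
- apply: ge0_le_integral => //; first exact: mD.
  + by apply/measurable_EFinP; apply: measurableT_comp.
  + by case: Ig => mg _; exact: Emeasurable_normc.
  + by move=> t _; rewrite lee_fin.
Qed.

(** The factor 2 comes from bounding real and imaginary parts separately; the estimate only serves
    to show that quantities tend to 0. *)
Lemma cmean_norm g : cint1 g -> normc (cmean g) <= 2 * fine (m1 g).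
Proof.
move=> Ig; apply: le_trans (normc_le _) _; rewrite mulrDl mul1r /=.
apply: lerD; apply: Rint_le => // [|t].
all: rewrite ?Re_le ?Im_le//; by case: Ig => -[].
Qed.

Lemma ae_eq_cmean f g : cmeas f -> cmeas g -> aeD (fun t => f t = g t) -> cmean f = cmean g.
Proof.
move=> [f1 f2] [g1 g2] h; apply: complexP => /=; congr (_ * _); rewrite /Rintegral;
  congr fine; apply: ae_eq_integral; try exact: mD; try exact/measurable_EFinP;
  by move: h; rewrite /aeD; apply: filterS => t H Dt; rewrite /= H.
Qed.

Lemma ae_eq_m2 f g : cmeas f -> cmeas g -> aeD (fun t => f t = g t) -> m2 f = m2 g.
Proof.
move=> mf mg h; apply: ae_eq_mE; try (by move=> t; rewrite lee_fin sqn_ge0);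
  try exact: Emeasurable_sqn.
by apply: aeD_imp h => t _ ->.
Qed.

(** * Square-integrable functions *)

Lemma m2Z c f : cmeas f -> m2 (fun t => c * f t) = ((sqn c)%:E * m2 f)%E.
Proof.
move=> mf; rewrite -mEZ ?sqn_ge0//; last exact: Emeasurable_sqn.
- by apply: eq_mE => t; rewrite sqnM.
- by move=> t; rewrite lee_fin sqn_ge0.
Qed.

Lemma m2D f g : cmeas f -> cmeas g ->
  (m2 (fun t => (f t + g t)%R) <= 2%:E * m2 f + 2%:E * m2 g)%E.
Proof.
move=> mf mg; have [sf sg] := (Emeasurable_sqn mf, Emeasurable_sqn mg).
have p0 (h : R -> R[i]) : forall t, (0 <= 2%:E * (sqn (h t))%:E)%E.
  by move=> t; rewrite mule_ge0// lee_fin sqn_ge0.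
have mz (h : R -> R[i]) : cmeas h -> measurable_fun D (fun t => 2%:E * (sqn (h t))%:E)%E.
  by move=> mh; apply: measurable_funeM; exact: Emeasurable_sqn.
rewrite -!mEZ//; try by move=> t; rewrite lee_fin sqn_ge0.
rewrite -mED; [|exact: p0|exact: p0|exact: mz..].
apply: le_mE => [t|||t].
- by rewrite lee_fin sqn_ge0.
- by apply: Emeasurable_sqn; exact: cmeasD.
- by apply: emeasurable_funD; exact: mz.
- by rewrite -!EFinM -EFinD lee_fin sqnD.
Qed.

Lemma cint2D f g : cint2 f -> cint2 g -> cint2 (fun t => f t + g t).
Proof.
move=> [mf ff] [mg fg]; split; first exact: cmeasD.
by apply: le_lt_trans (m2D mf mg) _; rewrite lte_add_pinfty// lte_mul_pinfty// lee_fin.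
Qed.

Lemma cint2Z c f : cint2 f -> cint2 (fun t => c * f t).
Proof.
move=> [mf ff]; split; first by apply: cmeasM => //; exact: cmeas_cst.
by rewrite m2Z// lte_mul_pinfty// lee_fin sqn_ge0.
Qed.

Lemma cint2N f : cint2 f -> cint2 (fun t => - f t).
Proof.
by move=> /(cint2Z (-1)); congr cint2; apply/funext => t; rewrite mulN1r.
Qed.

Lemma cint2B f g : cint2 f -> cint2 g -> cint2 (fun t => f t - g t).
Proof. by move=> If Ig; apply: cint2D => //; exact: cint2N. Qed.

Lemma cint2J f : cint2 f -> cint2 (fun t => conjc (f t)).
Proof.
move=> [mf ff]; split; first exact: cmeasJ.
by rewrite /m2; under eq_mE do rewrite sqnJ.
Qed.

Lemma cint2_bound (M : R) f : cmeas f -> (forall t, sqn (f t) <= M) -> cint2 f.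
Proof.
move=> mf h; split => //; apply: le_lt_trans (_ : mE (fun=> M%:E) < +oo)%E.
  by apply: le_mE => [t|||t]; rewrite ?lee_fin ?sqn_ge0//; exact: Emeasurable_sqn.
by rewrite mE_cst ltry.
Qed.

Lemma m1M (k : R) u v : 0 < k -> cmeas u -> cmeas v ->
  (m1 (fun t => (u t * v t)%R) <= (k / 2)%:E * m2 u + (k^-1 / 2)%:E * m2 v)%E.
Proof.
move=> k0 mf mg; have [sf sg] := (Emeasurable_sqn mf, Emeasurable_sqn mg).
have K0 : 0 <= k / 2 by rewrite divr_ge0// ltW.
have K1 : 0 <= k^-1 / 2 by rewrite divr_ge0// invr_ge0 ltW.
have p0 c (h : R -> R[i]) : 0 <= c -> forall t, (0 <= c%:E * (sqn (h t))%:E)%E.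
  by move=> c0 t; rewrite mule_ge0// lee_fin ?sqn_ge0.
have mz c (h : R -> R[i]) : cmeas h -> measurable_fun D (fun t => c%:E * (sqn (h t))%:E)%E.
  by move=> mh; apply: measurable_funeM; exact: Emeasurable_sqn.
rewrite -!mEZ//; try by move=> t; rewrite lee_fin sqn_ge0.
rewrite -mED; [|exact: p0|exact: p0|exact: mz..].
apply: le_mE => [t|||t].
- by rewrite lee_fin normc_ge0.
- by apply: Emeasurable_normc; exact: cmeasM.
- by apply: emeasurable_funD; exact: mz.
- rewrite -!EFinM -EFinD lee_fin; apply: le_trans (normcM_le _ _ k0) _.
  by rewrite le_eqVlt; apply/orP; left; apply/eqP; lra.
Qed.

Lemma cint2M u v : cint2 u -> cint2 v -> cint1 (fun t => u t * v t).
Proof.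
move=> [mu' fu] [mv fv]; split; first exact: cmeasM.
by apply: le_lt_trans (m1M ltr01 mu' mv) _; rewrite lte_add_pinfty// lte_mul_pinfty// lee_fin// divr_ge0// invr_ge0.
Qed.

Lemma cint2_1 u : cint2 u -> cint1 u.
Proof.
move=> Iu; have -> : u = (fun t => u t * 1) by apply/funext => t; rewrite mulr1.
apply: cint2M => //; apply: (cint2_bound (M := 1)); first exact: cmeas_cst.
by move=> t; rewrite sqn1.
Qed.

(** * Termwise integration *)

Definition rmean (p : R -> R) := (2 * pi)^-1 * Rintegral mu D p.

Lemma rmean_mE p : (forall t, 0 <= p t) -> rmean p = fine (mE (fun t => (p t)%:E)).
Proof.
move=> p0; rewrite /rmean /mE /Rintegral.
have : (0 <= \int[mu]_(t in D) (p t)%:E)%E by apply: integral_ge0 => t _; rewrite lee_fin.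
case: integral => [r| |]//= _; rewrite mulr0 gt0_muley//.
by rewrite lte_fin invr_gt0 pi2_gt0.
Qed.

Lemma mE_integrable (p : R -> R) : measurable_fun D p ->
  (mE (fun t => `|p t|%:E) < +oo)%E -> mu.-integrable D (EFin \o p).
Proof.
move=> mp fp; apply/integrableP; split; first exact/measurable_EFinP.
by apply: mE_lty fp _ => t; rewrite lee_fin.
Qed.

Lemma rmeanB p q : mu.-integrable D (EFin \o p) -> mu.-integrable D (EFin \o q) ->
  rmean (fun t => p t - q t) = rmean p - rmean q.
Proof. by move=> ip iq; rewrite /rmean RintegralB//; [rewrite mulrBr|exact: mD]. Qed.

(** Tonelli is applied to the positive and to the negative parts, both dominated by |p_i|, and the
    two results are subtracted by means of [rsumB]. *)
Lemma rmean_rsum {I : countType} (p : I -> R -> R) : (forall i, measurable_fun D (p i)) ->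
  (\esum_(i in [set: I]) mE (fun t => `|p i t|%:E) < +oo)%E ->
  [/\ aeD (fun t => fsum (fun i => p i t)),
     mu.-integrable D (EFin \o (fun t => rsum (fun i => p i t))) &
    rmean (fun t => rsum (fun i => p i t)) = rsum (fun i => rmean (p i))].
Proof.
move=> mp fp.
have K (q : I -> R -> R) : (forall i, measurable_fun D (q i)) -> (forall i t, 0 <= q i t) ->
    (forall i t, q i t <= `|p i t|) ->
  [/\ aeD (fun t => fsum (fun i => q i t)),
    mu.-integrable D (EFin \o (fun t => fine (essum (fun i => q i t)))),
    (forall i, mu.-integrable D (EFin \o q i)),
    fsum (fun i => rmean (q i)) &
    rmean (fun t => fine (essum (fun i => q i t))) = fine (essum (fun i => rmean (q i)))].
  move=> mq q0 qp.
  have S0 t : (0 <= essum (fun i => q i t))%E by exact: essum_ge0.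
  have mS : measurable_fun D (fun t => essum (fun i => q i t)) by exact: measurable_essum.
  have le i : (mE (fun t => (q i t)%:E) <= mE (fun t => `|p i t|%:E))%E.
    by apply: le_mE => [t|||t]; rewrite ?lee_fin//; apply/measurable_EFinP => //;
      apply: measurableT_comp.
  have ES : mE (fun t => essum (fun i => q i t)) = \esum_(i in [set: I]) mE (fun t => (q i t)%:E).
    exact: mE_essum.
  have fS : (mE (fun t => essum (fun i => q i t)) < +oo)%E.
    by rewrite ES; apply: le_lt_trans fp; apply: le_esum => i _.
  have qi i : (mE (fun t => (q i t)%:E) < +oo)%E.
    rewrite ES in fS; apply: le_lt_trans fS.
    have e0 j : (0 <= mE (fun t => (q j t)%:E))%E by apply: mE_ge0 => t; rewrite lee_fin.
    rewrite -(@esum_set1 _ _ i (fun j => mE (fun t => (q j t)%:E)))//.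
    by rewrite esum_mkcond; apply: le_esum => k _; case: ifP.
  have aS := mE_ae_fin S0 mS fS.
  have Eq i : rmean (q i) = fine (mE (fun t => (q i t)%:E)) by exact: rmean_mE.
  have EE : essum (fun i => rmean (q i)) = mE (fun t => essum (fun i => q i t)).
    rewrite ES; apply: eq_esum => i _; rewrite Eq fineK// ge0_fin_numE//.
    by apply: mE_ge0 => t; rewrite lee_fin.
  have aeq : aeD (fun t => (fine (essum (fun i => q i t)))%:E = essum (fun i => q i t)).
    by apply: aeD_imp aS => t _ h; rewrite fineK// ge0_fin_numE.
  have mf : measurable_fun D (fun t => fine (essum (fun i => q i t))).
    exact: measurableT_comp.
  have e : mE (fun t => (fine (essum (fun i => q i t)))%:E) = mE (fun t => essum (fun i => q i t)).
    by apply: ae_eq_mE => //; [move=> t; rewrite lee_fin fine_ge0|exact/measurable_EFinP].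
  split.
  - by apply: aeD_imp aS => t _ h; rewrite fsum_pos.
  - apply: mE_integrable => //.
    by under eq_mE do rewrite ger0_norm ?fine_ge0//; rewrite e.
  - by move=> i; apply: mE_integrable => //; under eq_mE do rewrite ger0_norm//.
  - rewrite fsum_pos ?EE// => i; rewrite Eq fine_ge0//; apply: mE_ge0 => t.
    by rewrite lee_fin.
  - by rewrite rmean_mE ?e ?EE// => t; exact: fine_ge0.
have mn i : measurable_fun D (fun t => - p i t) by exact: measurableT_comp.
have [a1 i1 j1 f1 e1] := K (fun i t => Num.max (p i t) 0)
  (fun i => measurable_maxr (mp i) (@measurable_cst _ _ _ _ _ _))
  (fun i t => pos_ge0 (p i) t) (fun i t => pos_le (p i) t).
have [a2 i2 j2 f2 e2] := K (fun i t => Num.max (- p i t) 0)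
  (fun i => measurable_maxr (mn i) (@measurable_cst _ _ _ _ _ _))
  (fun i t => neg_ge0 (p i) t) (fun i t => neg_le (p i) t).
split.
- apply: aeD_imp (aeD_and a1 a2) => t _ [h1 h2].
  have -> : (fun i => p i t) = (fun i => Num.max (p i t) 0 + - Num.max (- p i t) 0).
    by apply/funext => i; exact: (posneg (p ^~ t) i).
  by apply: fsumD => //; exact: fsumN.
- exact: (integrableB mD i1 i2).
- transitivity (rmean (fun t => fine (essum (fun i => Num.max (p i t) 0))) -
     rmean (fun t => fine (essum (fun i => Num.max (- p i t) 0)))).
    by rewrite -rmeanB.
  rewrite e1 e2 -rsumB//.
  + apply: eq_rsum => i; rewrite -rmeanB//.
    by congr (_ * _); apply: eq_Rintegral => t _; rewrite -(posneg (p i) t).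
  + by move=> i; rewrite rmean_mE ?fine_ge0 ?mE_ge0// => t; rewrite ?lee_fin ?le_max ?lexx ?orbT.
  + by move=> i; rewrite rmean_mE ?fine_ge0 ?mE_ge0// => t; rewrite ?lee_fin ?le_max ?lexx ?orbT.
Qed.

Lemma cint1_csum {I : countType} (g : I -> R -> R[i]) : (forall i, cmeas (g i)) ->
  (\esum_(i in [set: I]) m1 (g i) < +oo)%E ->
  [/\ aeD (fun t => asum (fun i => g i t)), cint1 (fun t => csum (fun i => g i t)) &
    cmean (fun t => csum (fun i => g i t)) = csum (fun i => cmean (g i))].
Proof.
move=> mg fg.
have K (p : I -> R -> R) : (forall i, measurable_fun D (p i)) ->
    (forall i t, `|p i t| <= normc (g i t)) ->
    (\esum_(i in [set: I]) mE (fun t => `|p i t|%:E) < +oo)%E.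
  move=> mp pg; apply: le_lt_trans fg; apply: le_esum => i _; apply: le_mE => [t|||t];
    rewrite ?lee_fin//; last exact: Emeasurable_normc.
  by apply/measurable_EFinP; apply: measurableT_comp.
have m1R i : measurable_fun D (fun t => complex.Re (g i t)) by case: (mg i).
have m1I i : measurable_fun D (fun t => complex.Im (g i t)) by case: (mg i).
have [a1 i1 e1] := rmean_rsum m1R (K _ m1R (fun i t => Re_le (g i t))).
have [a2 i2 e2] := rmean_rsum m1I (K _ m1I (fun i t => Im_le (g i t))).
have mc : cmeas (fun t => csum (fun i => g i t)) by exact: cmeas_csum.
split; last first.
- by apply: complexP; [exact: e1|exact: e2].
- apply: (cint1_le (p := fun t => `|complex.Re (csum (fun i => g i t))|%:E +
      `|complex.Im (csum (fun i => g i t))|%:E)%E) => //.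
  + by apply: emeasurable_funD; apply/measurable_EFinP; apply: measurableT_comp => //; case: mc.
  + by move=> t; rewrite -EFinD lee_fin; exact: normc_le.
  + rewrite mED; try (by move=> t; rewrite lee_fin);
      try (by apply/measurable_EFinP; apply: measurableT_comp => //; case: mc).
    have H (q : R -> R) : mu.-integrable D (EFin \o q) -> (mE (fun t => `|q t|%:E) < +oo)%E.
      by case/integrableP => _ h; rewrite /mE lte_mul_pinfty// lee_fin invr_ge0 ltW// pi2_gt0.
    by rewrite lte_add_pinfty//; exact: H.
- by apply: aeD_imp (aeD_and a1 a2) => t _ [h1 h2]; exact: asum_ReIm.
Qed.

End ComplexMeans.

(** * Series indexed by the natural numbers *)

Section NatSums.
Context {R : realType}.
Implicit Types (p : nat -> R) (x : nat -> R[i]).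

Lemma sum_nat_le p (s : seq nat) n : (forall k, 0 <= p k) -> uniq s ->
  (forall k, k \in s -> (k < n)%N) -> \sum_(k <- s) p k <= \sum_(k < n) p k.
Proof.
move=> p0 us sn; rewrite -(big_mkord xpredT p) /index_iota subn0.
rewrite -(perm_big _ (permEl (perm_filterC (mem s) (iota 0 n)))) big_cat /=.
rewrite (perm_big (seq.filter (mem s) (iota 0 n))) /=.
  by rewrite lerDl sumr_ge0.
apply: uniq_perm => //; first by rewrite filter_uniq// iota_uniq.
move=> k; rewrite mem_filter mem_iota /= add0n andbC.
by case: (boolP (k \in s)) => [/sn ->//|]; rewrite andbF.
Qed.

Lemma seq_nat_bound (s : seq nat) : exists n, forall k, k \in s -> (k < n)%N.
Proof.
exists (\max_(k <- s) k).+1 => k ks; rewrite ltnS.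
by rewrite (big_rem _ ks) /= leq_maxl.
Qed.

Lemma essum_nat_ub p (M : \bar R) : (forall k, 0 <= p k) ->
  (forall n, ((\sum_(k < n) p k)%:E <= M)%E) -> (essum p <= M)%E.
Proof.
move=> p0 H; apply: essum_le_ub => // s us.
have [n sn] := seq_nat_bound s.
by apply: le_trans (H n); rewrite lee_fin; exact: sum_nat_le.
Qed.

Lemma sum_nat_essum p n : (forall k, 0 <= p k) -> ((\sum_(k < n) p k)%:E <= essum p)%E.
Proof.
move=> p0; rewrite -(big_mkord xpredT p) /index_iota subn0.
by apply: sum_le_essum => //; exact: iota_uniq.
Qed.

Definition tailn (n : nat) p k := if (n <= k)%N then p k else 0.

Lemma tailn_ge0 n p : (forall k, 0 <= p k) -> forall k, 0 <= tailn n p k.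
Proof. by move=> p0 k; rewrite /tailn; case: ifP. Qed.

Lemma essum_split p n : (forall k, 0 <= p k) ->
  essum p = ((\sum_(k < n) p k)%:E + essum (tailn n p))%E.
Proof.
move=> p0; rewrite (eq_essum (n := fun k => (if k \in iota 0 n then p k else 0) + tailn n p k)).
  rewrite essumD; [|by move=> k; case: ifP|exact: tailn_ge0].
  congr (_ + _)%E; rewrite (essum_seq (iota_uniq 0 n)); last 2 first.
  - by move=> k; case: ifP.
  - by move=> k /negbTE ->.
  rewrite -(big_mkord xpredT p) /index_iota subn0; congr EFin.
  by apply: eq_big_seq => k ->.
by move=> k; rewrite /tailn mem_iota /= add0n ltnNge; case: leqP => _ /=; rewrite ?addr0 ?add0r.
Qed.

Lemma essum_tail p : (forall k, 0 <= p k) -> fsum p ->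
  forall e : R, 0 < e -> exists N, forall n, (N <= n)%N -> (essum (tailn n p) <= e%:E)%E.
Proof.
move=> p0 fp e e0; have fin := fsum_fin p0 fp.
suff [N HN] : exists N, (essum p - e%:E <= (\sum_(k < N) p k)%:E)%E.
  exists N => n Nn; apply: le_trans (_ : essum (tailn N p) <= _)%E.
    apply: le_essum => k; rewrite /tailn; case: leqP => nk; last by case: ifP.
    by rewrite (leq_trans Nn nk).
  move: HN fin; rewrite (essum_split N p0) fin_numD => + /andP[_ t].
  by rewrite -(fineK t) -EFinD !lee_fin; lra.
apply: contrapT => /forallNP H.
have : (essum p <= essum p - e%:E)%E.
  apply: essum_nat_ub => // n; have /negP := H n; rewrite -ltNge; exact: ltW.
by rewrite -(fineK fin) -EFinB lee_fin; lra.
Qed.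

Lemma fsum_tail p n : fsum p -> fsum (tailn n p).
Proof. by apply: fsum_le => k; rewrite /tailn; case: ifP; rewrite ?normr0. Qed.

Lemma geometric_fsum (q : R) : 0 <= q -> q < 1 -> fsum (fun k => q ^+ k).
Proof.
move=> q0 q1; rewrite fsum_pos; last by move=> k; exact: exprn_ge0.
apply: le_lt_trans (ltry (1 - q)^-1); apply: essum_nat_ub => [k|n]; first exact: exprn_ge0.
rewrite lee_fin -[leRHS]mul1r ler_pdivlMr ?subr_gt0//.
by have := subrX1 q n; have := exprn_ge0 n q0; lra.
Qed.

End NatSums.

(** * Trigonometric polynomials and their means *)

Section Trig.
Context {R : realType}.
Local Notation mu := (@lebesgue_measure R).
Local Notation D := (@angles R).
Implicit Types (a b : nat -> R[i]) (f g u v : R -> R[i]) (t : R).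

Lemma sum_iota (V : nmodType) (F : nat -> V) n : \sum_(k < n) F k = \sum_(k <- iota 0 n) F k.
Proof. by rewrite -(big_mkord xpredT F) /index_iota subn0. Qed.

Lemma conjM (z w : R[i]) : conjc (z * w) = conjc z * conjc w.
Proof. exact: (rmorphM (@conjc R)). Qed.
Lemma conjB (z w : R[i]) : conjc (z - w) = conjc z - conjc w.
Proof. exact: (rmorphB (@conjc R)). Qed.
Lemma conjD (z w : R[i]) : conjc (z + w) = conjc z + conjc w.
Proof. exact: (rmorphD (@conjc R)). Qed.
Lemma conjX (z : R[i]) n : conjc (z ^+ n) = conjc z ^+ n.
Proof. exact: (rmorphXn (@conjc R)). Qed.

Lemma sqn_expi t : sqn (expi t) = 1.
Proof. exact: cos2Dsin2. Qed.

Lemma sqn_expiX t n : sqn (expi t ^+ n) = 1.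
Proof. by elim: n => [|n IH]; rewrite ?expr0 ?sqn1// exprS sqnM sqn_expi IH mulr1. Qed.

Lemma normc_expiX t n : normc (expi t ^+ n) = 1.
Proof.
by apply/eqP; rewrite -sqrp_eq1 ?normc_ge0// sqnE sqn_expiX.
Qed.

Lemma expiXJ t n : expi t ^+ n * conjc (expi t ^+ n) = 1.
Proof. by rewrite mulJc sqn_expiX. Qed.

Lemma expiX_cosn t n : expi t ^+ n = cos (n%:R * t) +i* sin (n%:R * t).
Proof.
elim: n => [|n IH]; first by rewrite expr0 mul0r cos0 sin0.
rewrite exprS IH -addn1 natrD mulrDl mul1r cosD sinD /expi.
by apply: complexP => /=; ring.
Qed.

Lemma int_cosn n : (0 < n)%N -> Rintegral mu D (fun t => cos (n%:R * t)) = 0 /\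
  Rintegral mu D (fun t => sin (n%:R * t)) = 0.
Proof.
move=> n0; have nz : (n%:R : R) != 0 by rewrite pnatr_eq0 -lt0n.
have per2 k : cos ((k%:R : R) * (2 * pi)) = 1 /\ sin ((k%:R : R) * (2 * pi)) = 0.
  have : expi (2 * pi : R) ^+ k = 1.
    by rewrite /expi mulr_natl cos2pi sin2pi expr1n.
  by rewrite expiX_cosn => -[].
have [c1 s1] := per2 n.
have dS (x : R) : is_derive x 1 (fun t : R => n%:R^-1 * sin (n%:R * t)) (cos (n%:R * x)).
  by apply: is_derive_eq; rewrite !scaler1 /GRing.scale/=; field.
have dC (x : R) : is_derive x 1 (fun t : R => - n%:R^-1 * cos (n%:R * t)) (sin (n%:R * x)).
  by apply: is_derive_eq; rewrite !scaler1 /GRing.scale/=; field.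
have ctn (F : R -> R) (F' : R -> R) : (forall x : R, is_derive x 1 F (F' x)) -> continuous F.
  by move=> H x; apply: differentiable_continuous; apply/derivable1_diffP; case: (H x).
have FTC (F F' : R -> R) : (forall x : R, is_derive x 1 F (F' x)) -> continuous F' ->
    Rintegral mu D F' = F (2 * pi) - F 0.
  move=> H cF; rewrite /Rintegral /angles (@continuous_FTC2 _ F' F 0 (2 * pi)) ?pi2_gt0//.
  - exact: continuous_subspaceT.
  - split => [x _|  |]; first by case: (H x).
      by apply: cvg_at_right_filter; exact: (ctn _ _ H).
    by apply: cvg_at_left_filter; exact: (ctn _ _ H).
  - by move=> x _; rewrite derive1E; apply: derive_val.
have cmul : continuous (fun t : R => n%:R * t).
  by move=> x; apply: cvgM; [exact: cvg_cst|exact: cvg_id].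
split.
  rewrite (FTC _ _ dS); first by rewrite s1 !mulr0 sin0 mulr0 subrr.
  by move=> x; apply: continuous_comp; [exact: cmul|exact: continuous_cos].
rewrite (FTC _ _ dC); first by rewrite c1 !mulr0 cos0 subrr.
by move=> x; apply: continuous_comp; [exact: cmul|exact: continuous_sin].
Qed.

Lemma cint2_expiX n : cint2 (fun t => expi t ^+ n).
Proof. by apply: (cint2_bound (M := 1)) => [|t]; [exact: cmeas_expiX|rewrite sqn_expiX]. Qed.

Lemma cmean_expiX n : cmean (fun t => expi t ^+ n) = (n == 0)%:R.
Proof.
case: n => [|n]; first by rewrite -[RHS](cmean_cst 1); apply: eq_cmean => t; rewrite expr0.
have [c s] := @int_cosn n.+1 isT.
apply: complexP => /=.
  rewrite -[RHS](mulr0 (2 * pi)^-1) -c; congr (_ * _); apply: eq_Rintegral => t _.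
  by rewrite expiX_cosn.
rewrite -[RHS](mulr0 (2 * pi)^-1) -s; congr (_ * _); apply: eq_Rintegral => t _.
by rewrite expiX_cosn.
Qed.

Lemma cmean_expiXJ n m : cmean (fun t => expi t ^+ n * conjc (expi t ^+ m)) = (n == m)%:R.
Proof.
case: (leqP m n) => nm.
  transitivity (cmean (fun t => expi t ^+ (n - m))).
    apply: eq_cmean => t; rewrite -{1}(subnK nm) exprD -mulrA expiXJ mulr1//.
  by rewrite cmean_expiX subn_eq0; congr (_ %:R); rewrite eqn_leq nm andbT.
transitivity (cmean (fun t => conjc (expi t ^+ (m - n)))).
  apply: eq_cmean => t; rewrite -{1}(subnK (ltnW nm)) exprD conjM mulrCA expiXJ mulr1//.
rewrite cmeanJ; last exact/cint2_1/cint2_expiX.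
by rewrite cmean_expiX subn_eq0 leqNgt nm ltn_eqF// conjc0.
Qed.

(** The frequencies form an arbitrary list, so that blocks of a series are covered as well as its
    initial segments. *)
Definition trig (s : seq nat) a t := \sum_(k <- s) a k * expi t ^+ k.

Lemma cint2_sum (I : Type) (s : seq I) (f : I -> R -> R[i]) :
  (forall i, cint2 (f i)) -> cint2 (fun t => \sum_(i <- s) f i t).
Proof.
move=> If; elim: s => [|i s IH].
  apply: (cint2_bound (M := 0)) => [|t]; last by rewrite big_nil sqn0.
  by apply: (@eq_cmeas _ (fun=> 0)) (cmeas_cst _) => t; rewrite big_nil.
have -> : (fun t => \sum_(j <- i :: s) f j t) = (fun t => f i t + \sum_(j <- s) f j t).
  by apply/funext => t; rewrite big_cons.
exact: cint2D.
Qed.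

Lemma cint2_trig s a : cint2 (trig s a).
Proof. by apply: cint2_sum => k; apply: cint2Z; exact: cint2_expiX. Qed.

Lemma cmean_trigM s a u : cint2 u ->
  cmean (fun t => trig s a t * u t) = \sum_(k <- s) a k * cmean (fun t => expi t ^+ k * u t).
Proof.
move=> Iu; have E k : cint1 (fun t => expi t ^+ k * u t) by apply: cint2M => //; exact: cint2_expiX.
transitivity (cmean (fun t => \sum_(k <- s) a k * (expi t ^+ k * u t))).
  by apply: eq_cmean => t; rewrite mulr_suml; apply: eq_bigr => k _; rewrite mulrA.
rewrite cmean_sum; last by move=> k; exact: cint1Z.
by apply: eq_bigr => k _; rewrite cmeanZ.
Qed.

Lemma cmean_sqn u : cint2 u -> cmean (fun t => u t * conjc (u t)) = (fine (m2 u))%:C.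
Proof.
move=> Iu; apply: complexP => /=.
  rewrite /m2 -rmean_mE; last by move=> t; exact: sqn_ge0.
  by congr (_ * _); apply: eq_Rintegral => t _; rewrite mulJc.
transitivity ((2 * pi)^-1 * Rintegral mu D (fun=> 0 : R)).
  by congr (_ * _); apply: eq_Rintegral => t _; rewrite mulJc.
by rewrite Rintegral_cst ?mul0r ?mulr0//; exact: mD.
Qed.

Lemma m2_trig s a : uniq s -> m2 (trig s a) = (\sum_(k <- s) sqn (a k))%:E.
Proof.
move=> us; have It := cint2_trig s a.
have : (fine (m2 (trig s a)))%:C = (\sum_(k <- s) sqn (a k))%:C :> R[i].
  rewrite -cmean_sqn// cmean_trigM; last exact: cint2J.
  rewrite rmorph_sum; apply: eq_big_seq => k ks /=.
  rewrite -mulJc; congr (_ * _).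
  have Ie : cint1 (fun t => trig s a t * conjc (expi t ^+ k)).
    by apply: cint2M => //; apply: cint2J; exact: cint2_expiX.
  transitivity (conjc (cmean (fun t => trig s a t * conjc (expi t ^+ k)))).
    by rewrite -cmeanJ//; apply: eq_cmean => t; rewrite conjM conjcK mulrC.
  rewrite cmean_trigM; last by apply: cint2J; exact: cint2_expiX.
  rewrite (bigD1_seq k)//= cmean_expiXJ eqxx mulr1 big1 ?addr0// => j jk.
  by rewrite cmean_expiXJ (negbTE jk) mulr0.
by move=> /complexI; case: It => _ h <-; rewrite fineK// ge0_fin_numE// m2_ge0.
Qed.

(** * Boundary functions with prescribed Fourier coefficients *)

(** Membership in H^2 of the circle, with [a] as Fourier coefficients. Mean-square convergence is
    taken as the definition because it makes the mean against any square-integrable factor a limit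
    of finite sums. *)
Definition HB a g := cint2 g /\
  forall e : R, 0 < e -> exists N, forall n, (N <= n)%N ->
    (m2 (fun t => (g t - trig (iota 0 n) a t)%R) <= e%:E)%E.

Lemma small_eq (x y : R[i]) : (forall e : R, 0 < e -> normc (x - y) <= e) -> x = y.
Proof.
move=> H; apply/eqP; rewrite -subr_eq0; apply/eqP/Normc.eq0_normc.
apply/eqP; rewrite eq_le normc_ge0 andbT; apply/ler_addgt0Pl => e e0; rewrite addr0; exact: H.
Qed.

Lemma HB_mean a g u : HB a g -> cint2 u -> forall e : R, 0 < e -> exists N, forall n, (N <= n)%N ->
  normc (cmean (fun t => g t * u t) - \sum_(k < n) a k * cmean (fun t => expi t ^+ k * u t)) <= e.
Proof.
move=> [Ig Hg] Iu e e0.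
have [M M0 HM] : exists2 M : R, 0 < M & (m2 u <= M%:E)%E.
  exists (fine (m2 u) + 1); first by rewrite ltr_wpDl// fine_ge0// m2_ge0.
  case: Iu => _ fu; rewrite -(@fineK _ (m2 u)) ?ge0_fin_numE ?m2_ge0// lee_fin.
  by rewrite lerDl.
(* This weight balances the two terms of [m1M]: each becomes e / 4, and the factor 2 of [cmean_norm]
   brings the total to [e]. *)
pose k := 2 * M / e.
have k0 : 0 < k by rewrite divr_gt0// mulr_gt0.
have [N HN] := Hg (e / 2 / k) (divr_gt0 (divr_gt0 e0 (ltr0Sn R 1)) k0).
exists N => n Nn; have It := cint2_trig (iota 0 n) a.
rewrite (sum_iota (fun k => a k * cmean (fun t => expi t ^+ k * u t))) -cmean_trigM//.
rewrite -cmeanB; [|exact: cint2M..].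
have Id : cint2 (fun t => g t - trig (iota 0 n) a t) by exact: cint2B.
rewrite (eq_cmean (g := fun t => (g t - trig (iota 0 n) a t) * u t)); last first.
  by move=> t; rewrite mulrBl.
apply: le_trans (cmean_norm (cint2M Id Iu)) _.
have /= := m1M k0 Id.1 Iu.1; set X := m1 _ => HX.
have HX2 : (X <= (k / 2)%:E * (e / 2 / k)%:E + (k^-1 / 2)%:E * M%:E)%E.
  apply: le_trans HX _; apply: leeD.
    by apply: lee_wpmul2l; [rewrite lee_fin divr_ge0// ltW|exact: HN].
  by apply: lee_wpmul2l => //; rewrite lee_fin divr_ge0// invr_ge0 ltW.
have : fine X <= k / 2 * (e / 2 / k) + k^-1 / 2 * M.
  rewrite -lee_fin fineK// ge0_fin_numE ?m1_ge0//.
  by apply: le_lt_trans HX2 _; exact: ltry.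
have -> : k / 2 * (e / 2 / k) = e / 4 by field; rewrite gt_eqF.
have -> : k^-1 / 2 * M = e / 4 by rewrite /k; field; rewrite !gt_eqF.
lra.
Qed.

(** For the factors [u] that occur later, the approximating sums are constant from some rank on, so
    no limit has to be computed. *)
Lemma HB_const a g u (c : R[i]) N0 : HB a g -> cint2 u ->
  (forall n, (N0 <= n)%N -> \sum_(k < n) a k * cmean (fun t => expi t ^+ k * u t) = c) ->
  cmean (fun t => g t * u t) = c.
Proof.
move=> Hg Iu Hc; apply: small_eq => e e0; have [N HN] := HB_mean Hg Iu e0.
by rewrite -(Hc (maxn N0 N)) ?leq_maxl//; apply: HN; exact: leq_maxr.
Qed.

Lemma HB_coef a g n : HB a g -> cmean (fun t => g t * conjc (expi t ^+ n)) = a n.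
Proof.
move=> Hg; apply: (HB_const (N0 := n.+1) Hg); first by apply: cint2J; exact: cint2_expiX.
move=> m nm; rewrite (bigD1 (Ordinal nm))//= cmean_expiXJ eqxx mulr1 big1 ?addr0// => j jn.
by rewrite cmean_expiXJ (_ : _ == _ = false) ?mulr0//; apply: negbTE.
Qed.

(** The mean against [expi t ^+ n.+1] is the Fourier coefficient of index -(n + 1); the successor
    leaves index 0 to [HB_coef]. *)
Lemma HB_coefN a g n : HB a g -> cmean (fun t => g t * expi t ^+ n.+1) = 0.
Proof.
move=> Hg; apply: (HB_const (N0 := 0) Hg); first exact: cint2_expiX.
move=> m _; apply: big1 => k _.
rewrite (eq_cmean (g := fun t => expi t ^+ (k + n.+1))); last by move=> t; rewrite exprD.
by rewrite cmean_expiX addnS mulr0.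
Qed.

Lemma m2_fin g : cint2 g -> m2 g = (fine (m2 g))%:E.
Proof. by case=> _ fg; rewrite fineK// ge0_fin_numE// m2_ge0. Qed.

(** Pythagoras for the projection onto the first n frequencies: both cross terms equal the sum of
    the |c_k|^2. *)
Lemma bessel g n (c := fun n => cmean (fun t => g t * conjc (expi t ^+ n))) : cint2 g ->
  m2 (fun t => (g t - trig (iota 0 n) c t)%R) = (fine (m2 g) - \sum_(k < n) sqn (c k))%:E.
Proof.
move=> Ig; have It := cint2_trig (iota 0 n) c; have Id := cint2B Ig It.
rewrite (m2_fin Id); congr EFin; apply: complexI; rewrite -cmean_sqn//.
have gc : cmean (fun t => trig (iota 0 n) c t * conjc (g t)) = (\sum_(k < n) sqn (c k))%:C.
  rewrite cmean_trigM; last exact: cint2J.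
  rewrite (sum_iota (fun k => sqn (c k))) rmorph_sum.
  apply: eq_bigr => k _ /=; rewrite -mulJc; congr (_ * _).
  rewrite -cmeanJ; last by apply: cint2M => //; apply: cint2J; exact: cint2_expiX.
  by apply: eq_cmean => t; rewrite conjM conjcK mulrC.
have gt2 := cint2M (cint2J Ig) It; have tg := cint2M (cint2J It) Ig.
rewrite (eq_cmean (g := fun t => g t * conjc (g t) + trig (iota 0 n) c t * conjc (trig (iota 0 n) c t)
  - trig (iota 0 n) c t * conjc (g t) - conjc (trig (iota 0 n) c t * conjc (g t)))); last first.
  by move=> t; rewrite !conjM conjB conjcK; ring.
have I1 := cint2M Ig (cint2J Ig); have I2 := cint2M It (cint2J It).
have I3 := cint2M It (cint2J Ig).
rewrite !cmeanB; [|exact: cint1D|exact: I3|by apply: cint1B => //; exact: cint1D|exact: cint1J].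
rewrite cmeanD// cmeanJ// gc !cmean_sqn// m2_trig ?iota_uniq//.
rewrite [fine _%:E]/= conjc_real.
rewrite (sum_iota (fun k => sqn (c k))).
by rewrite -!rmorphD -!rmorphB /=; congr (_%:C); ring.
Qed.

Lemma HB_parseval a g : HB a g -> m2 g = essum (fun n => sqn (a n)).
Proof.
move=> Hg; have [Ig Hg'] := Hg.
have ac : (fun n => cmean (fun t => g t * conjc (expi t ^+ n))) = a.
  by apply/funext => n; exact: HB_coef.
have E n : m2 (fun t => (g t - trig (iota 0 n) a t)%R) = (fine (m2 g) - \sum_(k < n) sqn (a k))%:E.
  by rewrite -ac; exact: bessel.
have s0 n : 0 <= sqn (a n) by exact: sqn_ge0.
apply/eqP; rewrite eq_le; apply/andP; split; last first.
  apply: essum_nat_ub => // n; rewrite (m2_fin Ig) lee_fin -subr_ge0.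
  by have := m2_ge0 (fun t => g t - trig (iota 0 n) a t); rewrite E lee_fin.
apply/lee_addgt0Pr => e e0; have [N HN] := Hg' _ e0.
have := HN N (leqnn _); rewrite E lee_fin lerBlDl => h.
apply: le_trans (_ : (\sum_(k < N) sqn (a k) + e)%:E <= _)%E.
  by rewrite (m2_fin Ig) lee_fin.
by rewrite EFinD leeD2r// sum_nat_essum.
Qed.

Lemma HB_l2 a g : HB a g -> l2 a.
Proof. by move=> Hg; rewrite /l2 /sqs -(HB_parseval Hg); case: Hg => -[]. Qed.

Lemma coef_l2 g : cint2 g -> l2 (fun n => cmean (fun t => g t * conjc (expi t ^+ n))).
Proof.
move=> Ig; rewrite /l2 /sqs; apply: le_lt_trans (ltry (fine (m2 g))).
apply: essum_nat_ub => [n|n]; first exact: sqn_ge0.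
rewrite lee_fin -subr_ge0 -lee_fin -bessel//; exact: m2_ge0.
Qed.

Lemma ae_eq_HB a f g : cmeas g -> aeD (fun t => f t = g t) -> HB a f -> HB a g.
Proof.
move=> mg fg [[mf ff] Hf]; split; first by split => //; rewrite -(ae_eq_m2 mf mg fg).
move=> e /Hf [N HN]; exists N => n /HN.
have mt : cmeas (trig (iota 0 n) a) by case: (cint2_trig (iota 0 n) a).
rewrite (@ae_eq_m2 _ (fun t => f t - trig (iota 0 n) a t) (fun t => g t - trig (iota 0 n) a t))//.
- exact: cmeasB.
- exact: cmeasB.
- by apply: aeD_imp fg => t _ ->.
Qed.

End Trig.

(** * The Riesz-Fischer theorem *)

Section RieszFischer.
Context {R : realType}.
Local Notation mu := (@lebesgue_measure R).
Local Notation D := (@angles R).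

Definition tailc (n : nat) (x : nat -> R[i]) k := if (n <= k)%N then x k else 0.

Lemma asum_tailc n (x : nat -> R[i]) : asum x -> asum (tailc n x).
Proof.
by apply: asum_le => k; rewrite /tailc; case: ifP; rewrite ?Normc.normc0 ?normc_ge0.
Qed.

Lemma csum_split (x : nat -> R[i]) n : asum x -> csum x = \sum_(k < n) x k + csum (tailc n x).
Proof.
move=> ax; pose h k := if k \in iota 0 n then x k else 0.
have hs k : k \notin iota 0 n -> h k = 0 by rewrite /h => /negbTE ->.
rewrite (eq_csum (y := fun k => h k + tailc n x k)).
  rewrite csumD; [|exact: (asum_seq (iota_uniq 0 n))|exact: asum_tailc].
  rewrite (csum_seq (iota_uniq 0 n))// sum_iota; congr (_ + _).
  by apply: eq_big_seq => k kn; rewrite /h kn.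
by move=> k; rewrite /h /tailc mem_iota /= add0n ltnNge; case: leqP => _ /=; rewrite ?addr0 ?add0r.
Qed.

Lemma fine_mono (x y : \bar R) : (0 <= x)%E -> (x <= y)%E -> y \is a fin_num -> fine x <= fine y.
Proof.
move=> x0 xy fy; apply: fine_le => //; rewrite ge0_fin_numE//.
by apply: (le_lt_trans xy); rewrite -ge0_fin_numE// (le_trans x0 xy).
Qed.

Lemma Cinv (x : R) : x != 0 -> x%:C * (x^-1)%:C = 1 :> R[i].
Proof. by move=> x0; apply: complexP; rewrite /= ?mulr0 ?mul0r ?subr0 ?addr0 ?divff. Qed.

(** The partial sums are Cauchy in mean square, but a limit function has to be produced. The series
    is cut into blocks of geometrically decreasing norm; their sum converges absolutely almost
    everywhere, which defines [g], and a weighted Cauchy-Schwarz inequality bounds the remainder. *)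
Lemma riesz_fischer (a : nat -> R[i]) : l2 a -> exists g, HB a g.
Proof.
rewrite l2_fsum => fa; have s0 n : 0 <= sqn (a n) by exact: sqn_ge0.
have q0 : 0 <= 4^-1 :> R by rewrite invr_ge0.
have q1 : 4^-1 < 1 :> R by rewrite invf_lt1// ltr1n.
have fq := geometric_fsum q0 q1.
(* The j-th block will satisfy m2 <= q_j^2, so that dividing by q_j still leaves the summable
   q_j. *)
pose q j : R := 4^-1 ^+ j; have qg j : 0 < q j by rewrite exprn_gt0// invr_gt0.
have qge j : 0 <= q j by exact: ltW.
have /choice[phi0 Hphi0] : forall j, exists N, forall n, (N <= n)%N ->
    (essum (tailn n (fun n => sqn (a n))) <= (q j * q j)%:E)%E.
  by move=> j; apply: essum_tail => //; exact: mulr_gt0.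
(* Summing the thresholds [phi0] makes the cut points nondecreasing and keeps each above its own
   threshold. *)
pose phi j := (\sum_(i < j.+1) phi0 i)%N.
have phiS j : (phi j <= phi j.+1)%N by rewrite /phi [leqRHS]big_ord_recr /= leq_addr.
have phi_ge j : (phi0 j <= phi j)%N by rewrite /phi big_ord_recr /= leq_addl.
have tl j n m : (phi j <= n)%N -> \sum_(k <- iota n m) sqn (a k) <= q j * q j.
  move=> jn; rewrite -lee_fin; apply: le_trans (Hphi0 j n (leq_trans (phi_ge j) jn)).
  rewrite (_ : \sum_(k <- iota n m) sqn (a k) =
    \sum_(k <- iota n m) tailn n (fun n => sqn (a n)) k).
    by apply: sum_le_essum; [exact: iota_uniq|exact: tailn_ge0].
  by apply: eq_big_seq => k; rewrite mem_iota => /andP[nk _]; rewrite /tailn nk.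
pose d j := trig (iota (phi j) (phi j.+1 - phi j)) a.
have m2d j : (m2 (d j) <= (q j * q j)%:E)%E.
  by rewrite m2_trig ?iota_uniq// lee_fin; exact: tl.
have md j : cmeas (d j) by case: (cint2_trig (iota (phi j) (phi j.+1 - phi j)) a).
have tele J t : trig (iota 0 (phi J)) a t = trig (iota 0 (phi 0)) a t + \sum_(j < J) d j t.
  elim: J => [|J IH]; first by rewrite big_ord0 addr0.
  rewrite big_ord_recr /= addrA -IH /d /trig -big_cat /=; congr bigop.
  by rewrite -{3}(add0n (phi J)) -iotaD subnKC.
pose g t := trig (iota 0 (phi 0)) a t + csum (fun j => d j t).
have mg : cmeas g.
  apply: cmeasD; first by case: (cint2_trig (iota 0 (phi 0)) a).
  exact: cmeas_csum.
(* The weighted sum of the squared blocks from rank J on; its mean is at most the tail of the q_j,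
   so it is finite almost everywhere. *)
pose P J t := essum (tailn J (fun j => (q j)^-1 * sqn (d j t))).
have w0 j t : 0 <= (q j)^-1 * sqn (d j t) by rewrite mulr_ge0 ?sqn_ge0// invr_ge0.
have mw j : measurable_fun D (fun t => (q j)^-1 * sqn (d j t)).
  by apply: measurable_funM; [exact: measurable_cst|exact: measurable_sqn].
have P0 J t : (0 <= P J t)%E by apply: essum_ge0; exact: tailn_ge0.
have t0 J j t : 0 <= tailn J (fun j => (q j)^-1 * sqn (d j t)) j by exact: tailn_ge0.
have mt J j : measurable_fun D (fun t => tailn J (fun j => (q j)^-1 * sqn (d j t)) j).
  by rewrite /tailn; case: (J <= j)%N => //; exact: measurable_cst.
have mP J : measurable_fun D (P J).
  exact: (@measurable_essum _ _ (fun j t => tailn J (fun j => (q j)^-1 * sqn (d j t)) j)).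
have EP J : (mE (P J) <= essum (tailn J q))%E.
  rewrite (@mE_essum _ _ (fun j t => tailn J (fun j => (q j)^-1 * sqn (d j t)) j))//.
  apply: le_esum => j _; rewrite /tailn; case: (J <= j)%N; last by rewrite mE_cst.
  rewrite (eq_mE (q := fun t => ((q j)^-1)%:E * (sqn (d j t))%:E)%E)//.
  rewrite mEZ ?invr_ge0//; last 2 first.
  - by move=> t; rewrite lee_fin sqn_ge0.
  - exact: Emeasurable_sqn.
  have qi : (0 <= ((q j)^-1)%:E)%E by rewrite lee_fin invr_ge0.
  apply: le_trans (lee_wpmul2l qi (m2d j)) _.
  by rewrite -EFinM lee_fin mulrA mulVf ?mul1r// gt_eqF.
have good : aeD (fun t => P 0%N t < +oo)%E.
  apply: mE_ae_fin => //; apply: (le_lt_trans (EP 0)).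
  by rewrite -(fsum_pos (tailn_ge0 0 qge)); exact: fsum_tail.
(* r_j is the square root of q_j: writing d_j = r_j (d_j / r_j), Cauchy-Schwarz bounds the squared
   modulus of the block remainder from rank J by C P J. *)
pose r j : R := 2^-1 ^+ j.
have rr j : r j * r j = q j by rewrite /r /q -exprMn -invfM -natrM.
have rg j : 0 < r j by rewrite exprn_gt0// invr_gt0.
pose C := fine (essum q); have C0 : 0 <= C by rewrite fine_ge0// essum_ge0.
have key J t : (P 0%N t < +oo)%E -> asum (fun j => d j t) /\
    ((sqn (g t - trig (iota 0 (phi J)) a t))%:E <= C%:E * P J t)%E.
  move=> Pt.
  have l2r : l2 (fun j => (r j)%:C : R[i]).
    rewrite l2_fsum; apply: fsum_le fq => j.
    by rewrite /sqn /= expr0n addr0 expr2 rr.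
  have yl K : l2 (tailc K (fun j => ((r j)^-1)%:C * d j t)) /\
      sqs (tailc K (fun j => ((r j)^-1)%:C * d j t)) = P K t.
    have E : sqs (tailc K (fun j => ((r j)^-1)%:C * d j t)) = P K t.
      apply: eq_essum => j; rewrite /tailc /tailn; case: ifP => _; last by rewrite sqn0.
      by rewrite sqnM {1}/sqn /= expr0n addr0 expr2 -invfM rr.
    split => //; rewrite /l2 E; apply: le_lt_trans Pt; apply: le_essum => j.
    by rewrite /tailn leq0n; case: ifP.
  have dE K j : tailc K (fun j => d j t) j =
      (r j)%:C * tailc K (fun j => ((r j)^-1)%:C * d j t) j.
    rewrite /tailc; case: ifP => _; last by rewrite mulr0.
    by rewrite mulrA Cinv ?gt_eqF// mul1r.
  have ad : asum (fun j => d j t).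
    have -> : (fun j => d j t) = tailc 0 (fun j => d j t) by apply/funext => j.
    have -> : tailc 0 (fun j => d j t) = (fun j => (r j)%:C * tailc 0 (fun j => ((r j)^-1)%:C * d j t) j).
      by apply/funext => j; rewrite dE.
    by apply: l2M => //; case: (yl 0).
  split=> //; rewrite tele /g (csum_split J ad) opprD addrACA subrr add0r addrAC subrr add0r.
  rewrite (eq_csum (dE J)); have [lJ EJ] := yl J.
  have := cauchy_schwarz l2r lJ; rewrite EJ.
  have -> : fine (sqs (fun j => (r j)%:C : R[i])) = C.
    by congr fine; apply: eq_essum => j; rewrite /sqn /= expr0n addr0 expr2 rr.
  have fP : P J t \is a fin_num by rewrite -EJ; exact: (l2_fin lJ).
  by rewrite -lee_fin EFinM (fineK fP).
have mtr n : cmeas (trig (iota 0 n) a) by case: (cint2_trig (iota 0 n) a).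
have bound J : (m2 (fun t => (g t - trig (iota 0 (phi J)) a t)%R) <= C%:E * essum (tailn J q))%E.
  apply: le_trans (_ : mE (fun t => C%:E * P J t)%E <= _)%E.
    apply: ae_le_mE.
    - by move=> t; rewrite lee_fin sqn_ge0.
    - by move=> t; rewrite mule_ge0.
    - by apply: Emeasurable_sqn; exact: cmeasB.
    - exact: measurable_funeM.
    - by apply: aeD_imp good => t _ /(key J)[].
  by rewrite mEZ//; apply: lee_wpmul2l.
(* With e' = e / (2 C + 2), a remainder of squared norm C e' and an incomplete block of squared norm
   e' add up through [m2D] to 2 C e' + 2 e' = e. *)
have c2 : 0 < 2 * C + 2 by rewrite ltr_wpDl// mulr_ge0.
have Hsmall e : 0 < e -> exists N, forall n, (N <= n)%N ->
    (m2 (fun t => (g t - trig (iota 0 n) a t)%R) <= e%:E)%E.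
  move=> e0; have [J HJ] := essum_tail qge fq (divr_gt0 e0 c2).
  have {}HJ := HJ J (leqnn _).
  exists (phi J) => n Jn.
  have e1 : (m2 (fun t => (g t - trig (iota 0 (phi J)) a t)%R) <= (C * (e / (2 * C + 2)))%:E)%E.
    by apply: le_trans (bound J) _; rewrite EFinM; apply: lee_wpmul2l.
  pose h t := trig (iota (phi J) (n - phi J)) a t.
  have qJ : q J <= e / (2 * C + 2).
    rewrite -lee_fin; apply: le_trans HJ.
    have := @sum_le_essum R _ [:: J] (tailn J q) isT (tailn_ge0 J qge).
    by rewrite big_seq1 /tailn leqnn.
  have e2 : (m2 (fun t => (- h t)%R) <= (e / (2 * C + 2))%:E)%E.
    rewrite (_ : m2 _ = m2 h); last by apply: eq_mE => t; rewrite sqnN.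
    rewrite m2_trig ?iota_uniq// lee_fin; apply: le_trans (tl J _ _ (leqnn _)) _.
    apply: le_trans qJ; rewrite -[leRHS]mulr1 ler_wpM2l// exprn_ile1//.
    exact: ltW.
  have mh : cmeas (fun t => - h t).
    by apply: cmeasN; case: (cint2_trig (iota (phi J) (n - phi J)) a).
  have -> : (fun t => g t - trig (iota 0 n) a t) =
      (fun t => (g t - trig (iota 0 (phi J)) a t) + - h t).
    apply/funext => t; rewrite -[RHS]addrA -opprD /h /trig -big_cat /=.
    by rewrite -{3}(add0n (phi J)) -iotaD subnKC.
  apply: le_trans (m2D (cmeasB mg (mtr _)) mh) _.
  have h2 : (0 <= 2%:E :> \bar R)%E by rewrite lee_fin.
  apply: le_trans (leeD (lee_wpmul2l h2 e1) (lee_wpmul2l h2 e2)) _.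
  rewrite -!EFinM -EFinD lee_fin.
  have -> : 2 * (C * (e / (2 * C + 2))) + 2 * (e / (2 * C + 2)) = e.
    by field; rewrite gt_eqF.
  by [].
exists g; split => //; split => //.
have [N HN] := Hsmall 1 ltr01; have [mN fN] := cint2_trig (iota 0 N) a.
have -> : g = (fun t => (g t - trig (iota 0 N) a t) + trig (iota 0 N) a t).
  by apply/funext => t; rewrite subrK.
apply: le_lt_trans (m2D (cmeasB mg mN) mN) _.
apply: lte_add_pinfty; apply: lte_mul_pinfty; rewrite ?lee_fin//.
by apply: le_lt_trans (HN N (leqnn _)) _; exact: ltry.
Qed.

End RieszFischer.

(** * The Poisson kernel and radial limits *)

Section PoissonKernel.
Context {R : realType}.
Local Notation mu := (@lebesgue_measure R).
Local Notation D := (@angles R).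

Definition pk (s x : R) : R := (1 - s ^+ 2) / (1 - 2 * s * cos x + s ^+ 2).

Lemma pk_denE (s x : R) : 1 - 2 * s * cos x + s ^+ 2 = (1 - s) ^+ 2 + 2 * s * (1 - cos x).
Proof. by ring. Qed.

Lemma pk_den_ge (s x : R) : 0 <= s -> (1 - s) ^+ 2 <= 1 - 2 * s * cos x + s ^+ 2.
Proof.
move=> s0; rewrite pk_denE lerDl mulr_ge0 ?mulr_ge0// subr_ge0 cos_le1//.
Qed.

Lemma pk_den_gt0 (s x : R) : 0 <= s -> s < 1 -> 0 < 1 - 2 * s * cos x + s ^+ 2.
Proof.
move=> s0 s1; apply: lt_le_trans (pk_den_ge x s0).
by rewrite exprn_gt0// subr_gt0.
Qed.

Lemma pk_ge0 (s x : R) : 0 <= s -> s < 1 -> 0 <= pk s x.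
Proof.
move=> s0 s1; apply: divr_ge0; last exact/ltW/pk_den_gt0.
by rewrite subr_ge0 expr_le1// ltW.
Qed.

Lemma pk_le1 (s x : R) : 0 <= s -> s < 1 -> pk s x <= 2 / (1 - s).
Proof.
move=> s0 s1; have s1' : 0 < 1 - s by rewrite subr_gt0.
rewrite /pk ler_pdivrMr ?pk_den_gt0//.
apply: le_trans (_ : 2 / (1 - s) * (1 - s) ^+ 2 <= _); last first.
  by rewrite ler_wpM2l ?pk_den_ge// divr_ge0// ltW.
rewrite expr2 mulrA divfK ?gt_eqF// -subr_ge0.
have -> : 2 * (1 - s) - (1 - s ^+ 2) = (1 - s) ^+ 2 by ring.
exact: sqr_ge0.
Qed.

Lemma pk_le2 (s x c : R) : 2^-1 <= s -> s < 1 -> 0 < c -> c <= 1 - cos x ->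
  pk s x <= 2 * (1 - s) / c.
Proof.
move=> s2 s1 c0 hc; have s0 : 0 <= s by apply: le_trans s2; rewrite invr_ge0.
rewrite /pk ler_pdivrMr ?pk_den_gt0//.
have h : c <= 1 - 2 * s * cos x + s ^+ 2.
  rewrite pk_denE; apply: le_trans hc _; rewrite -[leLHS]add0r lerD ?sqr_ge0//.
  by rewrite ler_peMl ?subr_ge0 ?cos_le1//; lra.
apply: le_trans (_ : 2 * (1 - s) <= _).
  have := sqr_ge0 (1 - s); lra.
by rewrite mulrAC ler_pdivlMr// ler_wpM2l// mulr_ge0// subr_ge0 ltW.
Qed.

Lemma pk_cont (s : R) : 0 <= s -> s < 1 -> continuous (pk s).
Proof.
move=> s0 s1 x; apply: cvgM; first exact: cvg_cst.
apply: cvgV; first by rewrite gt_eqF// pk_den_gt0.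
apply: cvgD; last exact: cvg_cst.
apply: cvgB; first exact: cvg_cst.
by apply: cvgM; [exact: cvg_cst|exact: continuous_cos].
Qed.

Lemma pk_measurable (s t : R) : 0 <= s -> s < 1 -> measurable_fun D (fun u => pk s (t - u)).
Proof.
move=> s0 s1; apply: measurable_funTS; apply: continuous_measurable_fun => x.
apply: (@continuous_comp _ _ _ (fun u : R => t - u) (pk s)); last exact: pk_cont.
by apply: cvgB; [exact: cvg_cst|exact: cvg_id].
Qed.

(** Near 0 the cosine exceeds 1/2, so sin y >= y / 2 by the mean value theorem, and 1 - cos x = 2
    sin^2 (x / 2) is at least x^2 / 8. *)
Lemma cos_quad : exists2 h : R, 0 < h & forall x, `|x| < h -> x ^+ 2 / 8 <= 1 - cos x.
Proof.
have [h /= h0 H] : \forall x \near (0 : R), 2^-1 < cos x.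
  have /cvgr_gt : cos x @[x --> (0 : R)] --> cos 0 by exact: continuous_cos.
  by apply; rewrite cos0 invf_lt1// ltr1n.
exists h => // x xh.
have key y : 0 <= y -> y < h -> y / 2 <= sin y.
  rewrite le_eqVlt => /orP[/eqP <-|y0 yh]; first by rewrite sin0 mul0r.
  have [z] := @MVT _ sin cos 0 y y0 (fun x _ => is_derive_sin x)
    (continuous_subspaceT (@continuous_sin R)).
  rewrite in_itv /= => /andP[z0 zy]; rewrite sin0 !subr0 => ->.
  rewrite mulrC ler_wpM2r ?(ltW y0)//; apply/ltW/H => /=.
  by rewrite sub0r normrN gtr0_norm// (lt_trans zy yh).
pose y := `|x| / 2; have y0 : 0 <= y by rewrite divr_ge0.
have yh : y < h by apply: le_lt_trans xh; rewrite ler_pdivrMr// ler_peMr// ler1n.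
have -> : cos x = 1 - 2 * sin y ^+ 2.
  transitivity (cos (y *+ 2)).
    rewrite /y -mulr_natr divfK//; by case: (ger0P x) => _ //; rewrite cosN.
  by rewrite cos_mulr2n cos2sin2; ring.
have -> : x ^+ 2 / 8 = 2 * (y / 2) ^+ 2.
  by rewrite -[x ^+ 2](real_normK (num_real x)) /y; field.
rewrite opprB addrCA subrr addr0 ler_wpM2l// ler_pXn2r ?nnegrE ?key ?divr_ge0//.
by apply: le_trans (key y y0 yh); rewrite divr_ge0.
Qed.

(** The function 1 - cos also vanishes at 2 pi and -2 pi. As [t] is interior to [0, 2 pi], |t - u|
    stays at distance at least min(t, 2 pi - t) from 2 pi, which is why this minimum enters [r]. *)
Lemma cos_far (t rho : R) : 0 < t -> t < 2 * pi -> 0 < rho ->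
  exists2 c : R, 0 < c & forall u, D u -> rho <= `|t - u| -> c <= 1 - cos (t - u).
Proof.
move=> t0 t2 r0.
pose r := Num.min rho (Num.min pi (Num.min t (2 * pi - t))).
have pi0 := pi_gt0 R.
have rg : 0 < r by rewrite !lt_min r0 pi0 t0 subr_gt0 t2.
have [r1 r2 r3 r4] : [/\ r <= rho, r <= pi, r <= t & r <= 2 * pi - t].
  by split; rewrite !ge_min lexx ?orbT.
have rI : r \in `[0, pi] by rewrite in_itv /= (ltW rg) r2.
exists (1 - cos r).
  by rewrite subr_gt0 -(cos0 R) ltr_cos// in_itv /= lexx ltW.
move=> u; rewrite /angles /= in_itv /= => /andP[u0 u2] hr.
rewrite lerD2l lerN2.
have h1 : r <= `|t - u| by exact: le_trans hr.
have h2 : `|t - u| <= 2 * pi - r by rewrite ler_norml; apply/andP; split; lra.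
have -> : cos (t - u) = cos `|t - u| by case: (ger0P (t - u)) => _ //; rewrite cosN.
move: (`|t - u|) h1 h2 => x h1 h2.
have le_cos (a b : R) : 0 <= a -> a <= b -> b <= pi -> cos b <= cos a.
  move=> a0; rewrite le_eqVlt => /orP[/eqP ->//|ab bp].
  by apply: ltW; rewrite ltr_cos// in_itv /=; apply/andP; split; lra.
case: (leP x pi) => xp; first by apply: le_cos => //; exact: ltW.
have -> : cos x = cos (2 * pi - x).
  by rewrite -[RHS]cosN opprB -[RHS]cosD2pi mulr_natl subrK.
by apply: le_cos; lra.
Qed.

(** The index k = 0 is the innermost ball, where no lower bound on |x| is available; the other
    shells have 2^(k-1) e <= |x| < 2^k e. *)
Lemma shell (e x : R) K : `|x| < 2 ^+ K * e ->
  exists k, [/\ (k <= K)%N, `|x| < 2 ^+ k * e & k = 0%N \/ 2 ^+ k * e <= 2 * `|x|].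
Proof.
elim: K => [|K IH] h; first by exists 0%N; split => //; left.
case: (ltP `|x| (2 ^+ K * e)) => h'.
  by have [k [kK xk ko]] := IH h'; exists k; split => //; exact: leqW.
by exists K.+1; split => //; right; rewrite exprS -mulrA ler_wpM2l.
Qed.

(* Dyadic shells around [t]: away from [t] the kernel is O(1 - s). *)
Lemma pk_dominate (t h : R) : 0 < t -> t < 2 * pi -> 0 < h ->
  (forall x, `|x| < h -> x ^+ 2 / 8 <= 1 - cos x) ->
  exists2 A : R, 0 < A & forall s, 2^-1 <= s -> s < 1 -> 1 - s < h ->
  exists K : nat, 2 ^+ K * (1 - s) <= h /\ forall u, D u ->
    pk s (t - u) <= A * (1 - s) +
      \sum_(k < K.+1) (64 / (4 ^+ k * (1 - s))) * \1_(ball t (2 ^+ k * (1 - s))) u.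
Proof.
move=> t0 t2 h0 Hq; have [c c0 Hc] := cos_far t0 t2 (divr_gt0 h0 (ltr0Sn R 1)).
exists (2 / c); first by rewrite divr_gt0.
move=> s s2 s1 sh; pose e := 1 - s; have e0 : 0 < e by rewrite subr_gt0.
have s0 : 0 <= s by apply: le_trans s2; rewrite invr_ge0.
have [n Hn] : exists n : nat, h < 2 ^+ n.+1 * e.
  have [n hn] : exists n : nat, h / e < n%:R.
    by exists (Num.truncn (h / e)).+1; have /andP[] := truncn_itv (ltW (divr_gt0 h0 e0)).
  exists n; rewrite -ltr_pdivrMr//; apply: lt_le_trans hn _.
  rewrite -natrX ler_nat; apply: ltnW; apply: leq_trans (ltn_expl n (ltnSn 1)) _.
  by rewrite leq_exp2l.
(* K is the largest index with 2^K e <= h, obtained as the least one with h < 2^(K+1) e. Outside the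
   ball of radius 2^K e one has |t - u| > h / 2, where the bound from [cos_far] applies. *)
pose K := ex_minn (ex_intro (fun n => h < 2 ^+ n.+1 * e) n Hn).
have [KH Km] : h < 2 ^+ K.+1 * e /\ forall m, h < 2 ^+ m.+1 * e -> (K <= m)%N.
  by rewrite /K; case: ex_minnP.
have Kh : 2 ^+ K * e <= h.
  case EK : K => [|k]; first by rewrite expr0 mul1r ltW.
  by rewrite leNgt; apply/negP => /Km; rewrite EK ltnn.
exists K; split => // u Du; rewrite -/e.
have term_ge0 k : 0 <= 64 / (4 ^+ k * e) * \1_(ball t (2 ^+ k * e)) u :> R.
  by rewrite mulr_ge0// divr_ge0// mulr_ge0 ?exprn_ge0// ltW.
case: (ltP `|t - u| (2 ^+ K * e)) => hu; last first.
  apply: le_trans (_ : 2 / c * e <= _).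
    rewrite mulrAC; apply: pk_le2 => //; apply: Hc => //.
    apply: le_trans hu; rewrite ler_pdivrMr//.
    by move: KH; rewrite exprS => /ltW; rewrite -mulrA mulrC.
  by rewrite lerDl sumr_ge0.
have [k [kK uk ko]] := shell hu.
rewrite (bigD1 (Ordinal (kK : (k < K.+1)%N)))//= addrCA.
rewrite -[leLHS]addr0; apply: lerD; last first.
  by rewrite addr_ge0 ?sumr_ge0// mulr_ge0 ?divr_ge0 ?ltW.
rewrite indicE mem_set// mulr1.
case: ko => [->|ko].
  rewrite expr0 mul1r; apply: le_trans (pk_le1 _ s0 s1) _.
  by apply: ler_wpM2r; [rewrite invr_ge0 ltW|lra].
have x0 : 0 < `|t - u|.
  by rewrite -(@pmulr_rgt0 _ 2)//; apply: lt_le_trans ko; rewrite mulr_gt0 ?exprn_gt0.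
have xh : `|t - u| < h by apply: lt_le_trans Kh.
(* The quadratic bound gives 16 e / |t - u|^2, and |t - u| >= 2^(k-1) e in this shell, so the kernel
   is at most 64 / (4^k e): the constant of the statement. *)
apply: le_trans (pk_le2 s2 s1 _ (Hq _ xh)) _.
  by rewrite divr_gt0// -real_normK ?num_real// exprn_gt0.
rewrite -/e -[(t - u) ^+ 2](real_normK (num_real (t - u))).
have k0 : 0 < 4 ^+ k * e by rewrite mulr_gt0 ?exprn_gt0.
have X0 : 0 < `|t - u| ^+ 2 / 8 by rewrite divr_gt0// exprn_gt0.
rewrite ler_pdivlMr// mulrAC ler_pdivrMr//.
have hsq : (2 ^+ k * e) ^+ 2 <= (2 * `|t - u|) ^+ 2.
  by apply: lerXn2r; rewrite ?nnegrE ?mulr_ge0 ?exprn_ge0 ?(ltW e0).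
have hz : e * (4 ^+ k * e) <= 4 * `|t - u| ^+ 2.
  apply: le_trans (le_trans hsq _); last by rewrite exprMn; lra.
  rewrite exprMn -exprM mulnC exprM le_eqVlt; apply/orP; left; apply/eqP.
  by rewrite [e ^+ 2]expr2 mulrCA; congr (_ ^+ _ * _); lra.
rewrite -mulrA; move: (e * _) (`|t - u| ^+ 2) hz => z y hz; lra.
Qed.

End PoissonKernel.

(** * Poisson integrals at Lebesgue points *)

Section PoissonLimit.
Context {R : realType}.
Local Notation mu := (@lebesgue_measure R).
Local Notation D := (@angles R).

Lemma aeD_neq (a : R) : aeD (fun t => t != a).
Proof.
exists [set a]; split; [exact: measurable_set1|exact: lebesgue_measure_set1|].
by move=> t /= /not_implyP[_ /negP]; rewrite negbK => /eqP.
Qed.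

Lemma aeD_interior : aeD (fun t : R => 0 < t /\ t < 2 * pi).
Proof.
apply: aeD_imp (aeD_and (aeD_neq 0) (aeD_neq (2 * pi))) => t.
rewrite /angles /= in_itv /= => /andP[t0 t2] [n0 n2].
by rewrite lt_neqAle eq_sym n0 t0 lt_neqAle n2 t2.
Qed.

Lemma mE_abs_fin (p : R -> R) : mu.-integrable D (EFin \o p) -> (mE (fun u => `|p u|%:E) < +oo)%E.
Proof.
case/integrableP => _ h; rewrite /mE lte_mul_pinfty// lee_fin invr_ge0 ltW//.
exact: pi2_gt0.
Qed.

Lemma rmean_norm (p : R -> R) : mu.-integrable D (EFin \o p) ->
  `|rmean p| <= fine (mE (fun u => `|p u|%:E)).
Proof.
move=> ip; have mp : measurable_fun D p by case/integrableP: ip => /measurable_EFinP.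
have E : m1 (fun u => (p u)%:C) = mE (fun u => `|p u|%:E).
  by apply: eq_mE => u; rewrite normc_real.
rewrite -E; apply: Rint_le => //; last by move=> u; rewrite normc_real.
by split; [split => //; exact: measurable_cst|rewrite E; exact: mE_abs_fin].
Qed.

Lemma mE_sum (I : Type) (l : seq I) (F : I -> R -> R) : (forall i u, 0 <= F i u) ->
  (forall i, measurable_fun D (F i)) ->
  mE (fun u => (\sum_(i <- l) F i u)%:E) = (\sum_(i <- l) mE (fun u => (F i u)%:E))%E.
Proof.
move=> F0 mF; elim: l => [|i l IH].
  by rewrite big_nil -[RHS](mE_cst 0); apply: eq_mE => u; rewrite big_nil.
rewrite big_cons -IH -mED.
- by apply: eq_mE => u; rewrite big_cons EFinD.
- by move=> u; rewrite lee_fin.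
- by move=> u; rewrite lee_fin sumr_ge0.
- exact/measurable_EFinP.
- by apply/measurable_EFinP; exact: measurable_sum.
Qed.

(** The Lebesgue point property read on balls: [r *+ 2] is the measure of the ball, and the factor 1
    / (2 pi) inside [mE], being at most 1, is dropped. *)
Lemma lebesgue_pt_ball (p : R -> R) (t eta : R) : measurable_fun D p -> D t ->
  lebesgue_pt (p \_ D) t -> 0 < eta ->
  exists2 d : R, 0 < d & forall r, 0 < r -> r < d ->
    (mE (fun u => (`|p u - p t| * \1_(ball t r) u)%:E) <= (eta * (r *+ 2))%:E)%E.
Proof.
move=> mp Dt Lt e0; set f := p \_ D.
have [d /= d0 Hd] : \forall r \near (0 : R)^'+, (davg f t r <= eta%:E)%E.
  move: Lt => /fine_cvgP[ff /cvgr_le] /(_ _ e0) h.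
  near=> r; rewrite -(@fineK _ (davg f t r)); first by rewrite lee_fin; near: r.
  by near: r.
exists d => // r r0 rd.
have : (davg f t r <= eta%:E)%E by apply: Hd => //=; rewrite sub0r normrN gtr0_norm.
rewrite /davg /iavg (lebesgue_measure_ball _ (ltW r0)).
have r2 : 0 < r *+ 2 by rewrite mulrn_wgt0.
rewrite inver gt_eqF// lee_pdivrMl// -EFinM mulrC => H; apply: le_trans H.
have fDt : f t = p t by rewrite /f patchE mem_set.
have mb : measurable (ball t r) by exact: measurable_ball.
have mDD : measurable D := mD.
have c1 : ((2 * pi)^-1%:E <= 1 :> \bar R)%E.
  by rewrite lee_fin invf_le1 ?pi2_gt0//; have := pi_ge2 R; lra.
have I0 : (0 <= \int[mu]_(u in D) (`|p u - p t| * \1_(ball t r) u)%:E)%E.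
  by apply: integral_ge0 => u _; rewrite lee_fin mulr_ge0.
apply: le_trans (lee_wpmul2r I0 c1) _; rewrite mul1e.
rewrite integral_mkcond [leRHS]integral_mkcond.
apply: ge0_le_integral => //.
- by move=> u _; rewrite patchE; case: ifP => // _; rewrite lee_fin mulr_ge0.
- apply/(measurable_restrictT _ mDD); apply/measurable_EFinP; apply: measurable_funM => //.
    by apply: measurableT_comp => //; apply: measurable_funB => //; exact: measurable_cst.
- apply/(measurable_restrictT _ mb); apply: measurableT_comp => //; apply/measurable_EFinP.
  apply: measurable_funTS => /=; apply: measurable_funB; last exact: measurable_cst.
  exact/(measurable_restrictT _ mDD).
- move=> u _; rewrite !patchE; case: ifPn => [uD|_]; last by case: ifP => // _; exact: abse_ge0.
  rewrite indicE; have [ub|ub] := pselect (ball t r u).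
    by rewrite !mem_set// mulr1 /= fDt /f patchE uD.
  by rewrite !memNset// mulr0.
Unshelve. all: by end_near. Qed.

(** At an interior Lebesgue point the dyadic majorant of the kernel splits the error: the shells
    contribute a geometric series of averages of |p - p t| over small balls, and the rest is O(1 -
    s) times the L^1 norm of p - p t. *)
Lemma poisson_lebesgue (p : R -> R) : mu.-integrable D (EFin \o p) ->
  aeD (fun t => forall eta, 0 < eta -> exists2 sigma, sigma < 1 & forall s, sigma < s -> s < 1 ->
    0 <= s /\ `|rmean (fun u => (p u - p t) * pk s (t - u))| <= eta).
Proof.
move=> ip; have mp : measurable_fun D p by case/integrableP: ip => /measurable_EFinP.
have lf : locally_integrable [set: R] (p \_ D).
  exact: (integrable_locally (mD : measurable D) ip).
have leb : aeD (fun t => lebesgue_pt (p \_ D) t).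
  by have := lebesgue_differentiation lf; rewrite /aeD; apply: filterS => t h _.
have [h1 h10 Hcos] := @cos_quad R.
apply: aeD_imp (aeD_and leb aeD_interior) => t Dt [Lt [t0 t2]] eta eta0.
pose q u := `|p u - p t|.
have mq : measurable_fun D q.
  by apply: measurableT_comp => //; apply: measurable_funB => //; exact: measurable_cst.
have q0 u : 0 <= q u by exact: normr_ge0.
have Eq0 u : (0 <= (q u)%:E)%E by rewrite lee_fin.
have Emq : measurable_fun D (fun u => (q u)%:E) by exact/measurable_EFinP.
have fq : (mE (fun u => (q u)%:E) < +oo)%E.
  apply: (@le_lt_trans _ _ (mE (fun u => `|p u|%:E + `|p t|%:E)%E)).
    apply: le_mE => //; last by move=> u; rewrite -EFinD lee_fin ler_normB.
    apply: emeasurable_funD; last exact: measurable_cst.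
    by apply/measurable_EFinP; exact: measurableT_comp.
  rewrite mED ?mE_cst//; last by apply/measurable_EFinP; exact: measurableT_comp.
  by rewrite lte_add_pinfty ?ltry//; exact: mE_abs_fin.
pose M := fine (mE (fun u => (q u)%:E)).
have M0 : 0 <= M by rewrite fine_ge0// mE_ge0.
have ME : mE (fun u => (q u)%:E) = M%:E by rewrite fineK// ge0_fin_numE// mE_ge0.
(* A shell with constant 64 / (4^k e) and measure at most 2^(k+1) e then contributes (128 / 512) eta
   2^-k = (eta / 4) 2^-k, so all shells together contribute at most eta / 2. *)
have e0 : 0 < eta / 512 by rewrite divr_gt0 ?ltr0n.
have [d d0 Hd] := lebesgue_pt_ball mp Dt Lt e0.
have [h h0 [hd hh1]] : exists2 h, 0 < h & h < d /\ h < h1.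
  have m0 : 0 < Num.min d h1 by rewrite lt_min d0.
  exists (Num.min d h1 / 2); first by rewrite divr_gt0.
  by split; (apply: lt_le_trans (_ : Num.min d h1 <= _);
    [rewrite ltr_pdivrMr// ltr_pMr// ltr1n|rewrite ge_min lexx ?orbT]).
have [A A0 HA] := pk_dominate t0 t2 h0 (fun x xh => Hcos x (lt_trans xh hh1)).
(* Once 1 - s < B, the far part A (1 - s) M is at most eta / 2; M + 1 instead of M avoids a division
   by 0. *)
pose B := eta / (2 * A * (M + 1)).
have AM : 0 < 2 * A * (M + 1) by rewrite !mulr_gt0// ltr_wpDl.
have B0 : 0 < B by rewrite divr_gt0.
exists (1 - Num.min 2^-1 (Num.min h B)).
  by rewrite ltrBlDr ltrDl !lt_min invr_gt0 h0 B0 ltr0n.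
move=> s; rewrite ltrBlDr -ltrBlDl !lt_min => /and3P[s2 sh sB] s1.
have s2' : 2^-1 <= s by lra.
have s0 : 0 <= s by lra.
split=> //; have [K [Kh HK]] := HA s s2' s1 sh.
set e := 1 - s in sh sB Kh HK; have e_gt0 : 0 < e by rewrite /e subr_gt0.
have mk : measurable_fun D (fun u => pk s (t - u)) by exact: pk_measurable.
have k0 u : 0 <= pk s (t - u) by exact: pk_ge0.
have mqk : measurable_fun D (fun u => q u * pk s (t - u)) by exact: measurable_funM.
pose c k : R := 64 / (4 ^+ k * e).
have c0 k : 0 <= c k by rewrite divr_ge0// mulr_ge0 ?exprn_ge0// ltW.
have mi k : measurable_fun D (fun u => q u * \1_(ball t (2 ^+ k * e)) u).
  apply: measurable_funM => //; apply: measurable_funTS; apply: measurable_indic.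
  exact: measurable_ball.
have bnd : (mE (fun u => (q u * pk s (t - u))%:E) <= (A * e * M + eta / 2)%:E)%E.
  pose F u := A * e * q u + \sum_(k < K.+1) c k * (q u * \1_(ball t (2 ^+ k * e)) u).
  have Ae : 0 <= A * e by rewrite mulr_ge0 ?ltW.
  have q1 k u : 0 <= c k * (q u * \1_(ball t (2 ^+ k * e)) u).
    by apply: mulr_ge0; [exact: c0|apply: mulr_ge0].
  have mck k : measurable_fun D (fun u => c k * (q u * \1_(ball t (2 ^+ k * e)) u)).
    by apply: measurable_funM => //; exact: measurable_cst.
  have mAq : measurable_fun D (fun u => A * e * q u).
    by apply: measurable_funM => //; exact: measurable_cst.
  have mS : measurable_fun D (fun u => \sum_(k < K.+1) c k * (q u * \1_(ball t (2 ^+ k * e)) u)).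
    by apply: measurable_sum => k; exact: mck.
  apply: (@le_trans _ _ (mE (fun u => (F u)%:E))).
    apply: ae_le_mE.
    - by move=> u; rewrite lee_fin mulr_ge0.
    - by move=> u; rewrite lee_fin; apply: addr_ge0; [exact: mulr_ge0|exact: sumr_ge0].
    - exact/measurable_EFinP.
    - by apply/measurable_EFinP; exact: measurable_funD.
    - apply: aeW => u Du; rewrite lee_fin /F.
      apply: le_trans (ler_wpM2l (q0 u) (HK u Du)) _.
      rewrite mulrDr mulr_sumr mulrC lerD2l; apply: ler_sum => k _.
      by rewrite -/e -/(c k) mulrCA.
  rewrite (eq_mE (q := fun u => ((A * e)%:E * (q u)%:E +
    (\sum_(k < K.+1) c k * (q u * \1_(ball t (2 ^+ k * e)) u))%:E)%E))//.
  rewrite mED//; last 4 first.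
  - by move=> u; rewrite -EFinM lee_fin mulr_ge0.
  - by move=> u; rewrite lee_fin sumr_ge0.
  - exact: measurable_funeM.
  - exact/measurable_EFinP.
  rewrite mEZ// ME EFinD -EFinM; apply: leeD => //.
  rewrite (mE_sum _ (F := fun (k : 'I_K.+1) u => c k * (q u * \1_(ball t (2 ^+ k * e)) u)))//.
  apply: (@le_trans _ _ (\sum_(k < K.+1) (eta / 4 * 2^-1 ^+ k)%:E)%E).
    apply: lee_sum => k _.
    rewrite (eq_mE (q := fun u => ((c k)%:E * (q u * \1_(ball t (2 ^+ k * e)) u)%:E)%E))//.
    rewrite mEZ//; last 2 first.
    - by move=> u; rewrite lee_fin mulr_ge0.
    - by apply/measurable_EFinP; exact: mi.
    have r0 : 0 < 2 ^+ k * e by rewrite mulr_gt0 ?exprn_gt0.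
    have rd : 2 ^+ k * e < d.
      apply: le_lt_trans hd; apply: le_trans Kh; rewrite ler_wpM2r ?(ltW e_gt0)//.
      by rewrite ler_eXn2l ?ltr1n// -ltnS.
    apply: le_trans (lee_wpmul2l _ (Hd _ r0 rd)) _; first by rewrite lee_fin.
    rewrite -EFinM lee_fin le_eqVlt; apply/orP; left; apply/eqP.
    rewrite /c exprVn -[2 ^+ k * e *+ 2]mulr_natr.
    have e4 : (4 : R) ^+ k = (2 : R) ^+ k * (2 : R) ^+ k by rewrite -exprMn -natrM.
    rewrite e4.
    have : 2 ^+ k != 0 :> R by rewrite expf_neq0.
    by move: (2 ^+ k : R) => z z0; field; rewrite z0 gt_eqF.
  rewrite sumEFin lee_fin -mulr_sumr.
  have : \sum_(k < K.+1) (2^-1 : R) ^+ k <= 2.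
    have h2 : 0 <= (2^-1 : R) ^+ K.+1 by rewrite exprn_ge0// invr_ge0.
    by have := subrX1 (2^-1 : R) K.+1; move: (\sum_(_ < _) _) => z hz; lra.
  move: (\sum_(_ < _) _) => z hz; nra.
have iq : mu.-integrable D (EFin \o (fun u => (p u - p t) * pk s (t - u))).
  apply: mE_integrable.
    by apply: measurable_funM => //; apply: measurable_funB => //; exact: measurable_cst.
  under eq_mE do rewrite normrM (ger0_norm (k0 _)).
  by apply: le_lt_trans bnd _; exact: ltry.
apply: le_trans (rmean_norm iq) _.
rewrite -lee_fin fineK; last first.
  by rewrite ge0_fin_numE ?mE_abs_fin// mE_ge0// => u; rewrite lee_fin.
under eq_mE do rewrite normrM (ger0_norm (k0 _)).
apply: le_trans bnd _; rewrite lee_fin.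
have : A * e * M <= A * (B * (M + 1)).
  by rewrite -mulrA ler_wpM2l ?(ltW A0)// ler_pM// ?ltW// ltrDl.
have -> : A * (B * (M + 1)) = eta / 2 by rewrite /B; field; rewrite !gt_eqF// ltr_wpDl.
lra.
Qed.

End PoissonLimit.

(** * Poisson integrals as series, uniqueness of Fourier coefficients, Fatou's theorem *)

Section PoissonSeries.
Context {R : realType}.
Local Notation mu := (@lebesgue_measure R).
Local Notation D := (@angles R).
Implicit Types (a : nat -> R[i]) (g : R -> R[i]) (s t : R).

Definition has_psum a (z l : R[i]) := forall e : R, 0 < e -> exists N, forall n, (N <= n)%N ->
  normc (l - \sum_(k < n) a k * z ^+ k) <= e.

Lemma conj_sum (I : Type) (l : seq I) (F : I -> R[i]) :
  conjc (\sum_(i <- l) F i) = \sum_(i <- l) conjc (F i).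
Proof. exact: (rmorph_sum (@conjc R)). Qed.

Let w s t u : R[i] := s%:C * expi t * conjc (expi u).

Lemma expi_diff t u : expi t * conjc (expi u) = expi (t - u).
Proof.
by rewrite /expi; apply: complexP => /=; rewrite ?cosB ?sinB; ring.
Qed.

(** With w = z conj(zeta), the kernel is (1 - |w|^2) / |1 - w|^2, that is, twice the real part of 1
    / (1 - w), minus 1; in this form it expands into two geometric series. *)
Lemma pk_complex s t u : 0 <= s -> s < 1 ->
  [/\ normc (w s t u) = s, 1 - w s t u != 0 &
    (pk s (t - u))%:C = (1 - w s t u)^-1 + conjc (1 - w s t u)^-1 - 1].
Proof.
move=> s0 s1; have nw : normc (w s t u) = s.
  rewrite /w !normcM normcJ normc_real ger0_norm//.
  by rewrite -[expi t]expr1 -[expi u]expr1 !normc_expiX !mulr1.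
have w1 : 1 - w s t u != 0.
  by apply/negP => /eqP/subr0_eq h; move: nw s1; rewrite -h Normc.normc1 => ->; rewrite ltxx.
split=> //.
have E : (1 - 2 * s * cos (t - u) + s ^+ 2)%:C = (1 - w s t u) * conjc (1 - w s t u) :> R[i].
  have -> : w s t u = s%:C * expi (t - u) by rewrite /w -mulrA expi_diff.
  have := cos2Dsin2 (t - u); rewrite /expi.
  move: (cos _) (sin _) => c d h; apply: complexP => /=; last by ring.
  have -> : s ^+ 2 = s ^+ 2 * (c ^+ 2 + d ^+ 2) by rewrite h mulr1.
  by ring.
have N : (1 - s ^+ 2)%:C = 1 - w s t u * conjc (w s t u) :> R[i].
  by rewrite mulJc -sqnE nw rmorphB.
have d0 : (1 - 2 * s * cos (t - u) + s ^+ 2) != 0 by rewrite gt_eqF// pk_den_gt0.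
have dc : (1 - 2 * s * cos (t - u) + s ^+ 2)%:C != 0 :> R[i].
  by apply: contra_neq d0 => /complexI.
have -> : (pk s (t - u))%:C = (1 - s ^+ 2)%:C / (1 - 2 * s * cos (t - u) + s ^+ 2)%:C :> R[i].
  apply: (mulIf dc); rewrite divfK// -(rmorphM (real_complex R)) /pk divfK//.
rewrite N E; rewrite E mulf_eq0 negb_or in dc; case/andP: dc => _.
rewrite conjB conjc1 (_ : conjc (1 - w s t u)^-1 = (1 - conjc (w s t u))^-1); last first.
  by rewrite conjc_inv conjB conjc1.
move: (w s t u) w1 (conjc _) => x x1 y y1.
by field; rewrite x1 y1.
Qed.

Lemma pk_partial s t u N : 0 <= s -> s < 1 ->
  normc ((pk s (t - u))%:C - (\sum_(k < N) w s t u ^+ k + conjc (\sum_(k < N) w s t u ^+ k) - 1))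
    <= 2 * s ^+ N / (1 - s).
Proof.
move=> s0 s1; have [nw w1 ->] := pk_complex t u s0 s1.
have -> : \sum_(k < N) w s t u ^+ k = (1 - w s t u ^+ N) / (1 - w s t u).
  apply: (mulIf w1); rewrite divfK// mulrC -opprB mulNr -subrX1 opprB//.
set x := w s t u in nw w1 *; rewrite mulrBl mul1r conjB.
have -> : (1 - x)^-1 + conjc (1 - x)^-1 - 1 - ((1 - x)^-1 - x ^+ N / (1 - x)
    + (conjc (1 - x)^-1 - conjc (x ^+ N / (1 - x))) - 1) = x ^+ N / (1 - x) + conjc (x ^+ N / (1 - x)).
  by ring.
apply: le_trans (normcD _ _) _; rewrite normcJ.
suff : normc (x ^+ N / (1 - x)) <= s ^+ N / (1 - s) by rewrite -[2 * _ / _]mulrA; lra.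
rewrite normcM normcX nw ler_wpM2l ?exprn_ge0//.
rewrite Normc.normcV lef_pV2 ?posrE ?subr_gt0//.
  have := normcD (1 - x) x; rewrite subrK Normc.normc1 nw; lra.
by rewrite lt_neqAle normc_ge0 andbT eq_sym; apply: contra_neq w1 => /Normc.eq0_normc.
Qed.

Lemma cmeas_pk s t : 0 <= s -> s < 1 -> cmeas (fun u => (pk s (t - u))%:C).
Proof. by move=> s0 s1; split; [exact: pk_measurable|exact: measurable_cst]. Qed.

Lemma cint1_pk g s t : cint1 g -> 0 <= s -> s < 1 -> cint1 (fun u => (pk s (t - u))%:C * g u).
Proof.
move=> Ig s0 s1; apply: (cint1M_bound (M := 2 / (1 - s))) => //; first exact: cmeas_pk.
by move=> u; rewrite normc_real ger0_norm ?pk_ge0 ?pk_le1.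
Qed.

Lemma cint1_expM g n : cint1 g -> cint1 (fun u => g u * expi u ^+ n).
Proof.
move=> Ig; have : cint1 (fun u => expi u ^+ n * g u).
  apply: (cint1M_bound (M := 1)) => //; first exact: cmeas_expiX.
  by move=> u; rewrite normc_expiX.
by congr cint1; apply/funext => u; rewrite mulrC.
Qed.

Lemma cint1_expJM g n : cint1 g -> cint1 (fun u => g u * conjc (expi u ^+ n)).
Proof.
move=> Ig; have : cint1 (fun u => conjc (expi u ^+ n) * g u).
  apply: (cint1M_bound (M := 1)) => //; first by apply: cmeasJ; exact: cmeas_expiX.
  by move=> u; rewrite normcJ normc_expiX.
by congr cint1; apply/funext => u; rewrite mulrC.
Qed.

(** Integrating the truncated geometric expansion of the kernel gives the two-sided Fourier series
    damped by s^k; [cmean g] is subtracted because index 0 occurs in both sums. *)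
Lemma poisson_series g s t N : cint1 g -> 0 <= s -> s < 1 ->
  normc (cmean (fun u => (pk s (t - u))%:C * g u) -
    (\sum_(k < N) cmean (fun u => g u * conjc (expi u ^+ k)) * (s%:C * expi t) ^+ k +
     \sum_(k < N) cmean (fun u => g u * expi u ^+ k) * conjc ((s%:C * expi t) ^+ k) - cmean g))
  <= 2 * (2 * s ^+ N / (1 - s) * fine (m1 g)).
Proof.
move=> Ig s0 s1; set z := s%:C * expi t.
have I1 k : cint1 (fun u => z ^+ k * (g u * conjc (expi u ^+ k))).
  by apply: cint1Z; exact: cint1_expJM.
have I2 k : cint1 (fun u => conjc (z ^+ k) * (g u * expi u ^+ k)).
  by apply: cint1Z; exact: cint1_expM.
have S1 : cint1 (fun u => \sum_(k < N) z ^+ k * (g u * conjc (expi u ^+ k))) by exact: cint1_sum.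
have S2 : cint1 (fun u => \sum_(k < N) conjc (z ^+ k) * (g u * expi u ^+ k)) by exact: cint1_sum.
have -> : \sum_(k < N) cmean (fun u => g u * conjc (expi u ^+ k)) * z ^+ k =
    cmean (fun u => \sum_(k < N) z ^+ k * (g u * conjc (expi u ^+ k))).
  rewrite cmean_sum//; apply: eq_bigr => k _; rewrite cmeanZ 1?mulrC//; exact: cint1_expJM.
have -> : \sum_(k < N) cmean (fun u => g u * expi u ^+ k) * conjc (z ^+ k) =
    cmean (fun u => \sum_(k < N) conjc (z ^+ k) * (g u * expi u ^+ k)).
  rewrite cmean_sum//; apply: eq_bigr => k _; rewrite cmeanZ 1?mulrC//; exact: cint1_expM.
rewrite -cmeanD// -cmeanB//; last exact: cint1D.
have I3 := cint1_pk t Ig s0 s1.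
rewrite -cmeanB//; last by apply: cint1B => //; exact: cint1D.
apply: le_trans (cmean_norm _) _; first by apply: cint1B => //; apply: cint1B => //; exact: cint1D.
rewrite ler_wpM2l//.
pose M := 2 * s ^+ N / (1 - s); have M0 : 0 <= M.
  by rewrite divr_ge0 ?mulr_ge0 ?exprn_ge0// subr_ge0 ltW.
have Eg : (fine (m1 g))%:E = m1 g.
  by rewrite fineK// ge0_fin_numE ?m1_ge0//; case: Ig.
rewrite -lee_fin EFinM Eg.
have -> : (M%:E * m1 g)%E = m1 (fun u => M%:C * g u).
  by rewrite m1Z ?normc_real ?ger0_norm//; case: Ig.
have I4 : cint1 (fun u => M%:C * g u) by exact: cint1Z.
have Ib : cint1 (fun u => (pk s (t - u))%:C * g u -
      (\sum_(k < N) z ^+ k * (g u * conjc (expi u ^+ k)) +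
       \sum_(k < N) conjc (z ^+ k) * (g u * expi u ^+ k) - g u)).
  by apply: cint1B => //; apply: cint1B => //; exact: cint1D.
apply: (@le_trans _ _ (m1 (fun u => M%:C * g u))) => //.
rewrite fineK; last by rewrite ge0_fin_numE ?m1_ge0//; case: Ib.
apply: le_m1; [by case: Ib|by case: I4|] => u.
have -> : (pk s (t - u))%:C * g u - (\sum_(k < N) z ^+ k * (g u * conjc (expi u ^+ k)) +
       \sum_(k < N) conjc (z ^+ k) * (g u * expi u ^+ k) - g u) =
  ((pk s (t - u))%:C - (\sum_(k < N) w s t u ^+ k + conjc (\sum_(k < N) w s t u ^+ k) - 1)) * g u.
  have -> : \sum_(k < N) z ^+ k * (g u * conjc (expi u ^+ k)) = (\sum_(k < N) w s t u ^+ k) * g u.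
    rewrite mulr_suml; apply: eq_bigr => k _; rewrite /w -/z [(z * _) ^+ k]exprMn conjX.
    by rewrite mulrA mulrAC.
  have -> : \sum_(k < N) conjc (z ^+ k) * (g u * expi u ^+ k) =
      conjc (\sum_(k < N) w s t u ^+ k) * g u.
    rewrite conj_sum mulr_suml; apply: eq_bigr => k _.
    rewrite /w -/z [(z * _) ^+ k]exprMn conjM [conjc (conjc _ ^+ k)]conjX conjcK.
    by rewrite mulrA mulrAC.
  by ring.
rewrite !normcM ler_wpM2r ?normc_ge0// normc_real (ger0_norm M0).
exact: pk_partial.
Qed.

Lemma geom_small s (C : R) : 0 <= s -> s < 1 -> 0 <= C -> forall e : R, 0 < e ->
  exists N, forall n, (N <= n)%N -> C * s ^+ n <= e.
Proof.
move=> s0 s1 C0 e e0; have e1 : 0 < e / (C + 1) by rewrite divr_gt0// ltr_wpDl.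
have qs k : 0 <= s ^+ k by exact: exprn_ge0.
have [N HN] := essum_tail qs (geometric_fsum s0 s1) e1.
exists N => n Nn.
have h : s ^+ n <= e / (C + 1).
  rewrite -lee_fin; apply: le_trans (HN n Nn).
  have := @sum_le_essum R _ [:: n] (tailn n (GRing.exp s)) isT (tailn_ge0 n qs).
  by rewrite big_seq1 /tailn leqnn.
apply: le_trans (ler_wpM2l C0 h) _; rewrite mulrA ler_pdivrMr ?ltr_wpDl//.
by rewrite mulrDr mulr1 (mulrC e) lerDl ltW.
Qed.

Lemma poisson_small g s t (c : R[i]) : cint1 g -> 0 <= s -> s < 1 ->
  (forall e : R, 0 < e -> exists N0, forall N, (N0 <= N)%N ->
    normc (c - (\sum_(k < N) cmean (fun u => g u * conjc (expi u ^+ k)) * (s%:C * expi t) ^+ k +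
     \sum_(k < N) cmean (fun u => g u * expi u ^+ k) * conjc ((s%:C * expi t) ^+ k) - cmean g)) <= e) ->
  cmean (fun u => (pk s (t - u))%:C * g u) = c.
Proof.
move=> Ig s0 s1 Hc; apply: small_eq => e e0; have e2 : 0 < e / 2 by rewrite divr_gt0.
have [N0 H0] := Hc _ e2.
have C0 : 0 <= 4 * fine (m1 g) / (1 - s).
  by rewrite divr_ge0 ?mulr_ge0 ?fine_ge0 ?m1_ge0// subr_ge0 ltW.
have [N1 H1] := geom_small s0 s1 C0 e2.
pose N := maxn N0 N1; have := H0 N (leq_maxl _ _); have := H1 N (leq_maxr _ _).
have := poisson_series t N Ig s0 s1; set X := (_ + _ - cmean g); set Y := cmean _.
move=> h1 h2 h3; have -> : Y - c = (Y - X) - (c - X) by move: Y X c {h1 h2 h3 Hc H0} => Y X c; ring.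
apply: le_trans (normcD _ _) _; rewrite normcN.
have E : 2 * (2 * s ^+ N / (1 - s) * fine (m1 g)) = 4 * fine (m1 g) / (1 - s) * s ^+ N.
  by field; rewrite subr_eq0 gt_eqF.
rewrite E in h1; lra.
Qed.

Lemma cmean_pk s t : 0 <= s -> s < 1 -> cmean (fun u => (pk s (t - u))%:C) = 1.
Proof.
move=> s0 s1; have I1 : cint1 (fun=> 1 : R[i]).
  by apply: (cint1_bound (M := 1)) => [|u]; [exact: cmeas_cst|rewrite Normc.normc1].
transitivity (cmean (fun u => (pk s (t - u))%:C * 1)).
  by apply: eq_cmean => u; rewrite mulr1.
apply: (@poisson_small (fun=> 1)) => // e e0; exists 1%N => -[//|N] _.
rewrite !big_ord_recl !big1; last 2 first.
- move=> k _; rewrite (eq_cmean (g := fun u => expi u ^+ k.+1)); last by move=> u; rewrite mul1r.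
  by rewrite cmean_expiX mul0r.
- move=> k _; rewrite (eq_cmean (g := fun u => conjc (expi u ^+ k.+1))); last by move=> u; rewrite mul1r.
  by rewrite cmeanJ ?cmean_expiX ?conjc0 ?mul0r//; exact/cint2_1/cint2_expiX.
have E0 (h : R -> R[i]) : (forall u, h u = 1) -> cmean h = 1.
  by move=> hh; rewrite -[RHS](cmean_cst 1); apply: eq_cmean.
rewrite !E0; try (by move=> u; rewrite ?expr0 ?conjc1 ?mulr1).
by rewrite !expr0 conjc1 !mulr1 !addr0 addrK subrr Normc.normc0 ltW.
Qed.

(** As the kernel has mean 1, subtracting g t amounts to averaging g - g t, and [poisson_lebesgue]
    applies to the real and imaginary parts. *)
Lemma poisson_limit g : cint1 g -> aeD (fun t => forall eta, 0 < eta ->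
  exists2 sigma, sigma < 1 & forall s, sigma < s -> s < 1 ->
    0 <= s /\ normc (cmean (fun u => (pk s (t - u))%:C * g u) - g t) <= eta).
Proof.
move=> Ig; have [mg _] := Ig.
have H1 := poisson_lebesgue (integrable_Re Ig); have H2 := poisson_lebesgue (integrable_Im Ig).
apply: aeD_imp (aeD_and H1 H2) => t Dt [h1 h2] eta eta0.
have e2 : 0 < eta / 2 by rewrite divr_gt0.
have [s1 s11 K1] := h1 _ e2; have [s2 s21 K2] := h2 _ e2.
exists (Num.max s1 s2); first by rewrite gt_max s11 s21.
move=> s; rewrite gt_max => /andP[s1s s2s] s_1.
have [s0 B1] := K1 s s1s s_1; have [_ B2] := K2 s s2s s_1.
split=> //; have Ip := cint1_pk t Ig s0 s_1.
have Ik : cint1 (fun u => (pk s (t - u))%:C).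
  apply: (cint1_bound (M := 2 / (1 - s))); first exact: cmeas_pk.
  by move=> u; rewrite normc_real ger0_norm ?pk_ge0 ?pk_le1.
have -> : cmean (fun u => (pk s (t - u))%:C * g u) - g t =
    cmean (fun u => (pk s (t - u))%:C * g u - g t * (pk s (t - u))%:C).
  by rewrite cmeanB ?cmeanZ ?cmean_pk ?mulr1//; exact: cint1Z.
apply: le_trans (normc_le _) _.
have E1 : complex.Re (cmean (fun u => (pk s (t - u))%:C * g u - g t * (pk s (t - u))%:C)) =
    rmean (fun u => (complex.Re (g u) - complex.Re (g t)) * pk s (t - u)).
  congr (_ * _); apply: eq_Rintegral => u _.
  by rewrite ReD ReN !ReM /= mul0r mulr0 !subr0; ring.
have E2 : complex.Im (cmean (fun u => (pk s (t - u))%:C * g u - g t * (pk s (t - u))%:C)) =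
    rmean (fun u => (complex.Im (g u) - complex.Im (g t)) * pk s (t - u)).
  congr (_ * _); apply: eq_Rintegral => u _.
  by rewrite ImD ImN !ImM /= mul0r mulr0 addr0 add0r; ring.
by rewrite E1 E2; lra.
Qed.

(** All Poisson integrals of [g] vanish, and they converge to [g] almost everywhere. The argument
    works in L^1, as products of two square-integrable functions require. *)
Lemma fourier_unique g : cint1 g ->
  (forall n, cmean (fun u => g u * conjc (expi u ^+ n)) = 0) ->
  (forall n, cmean (fun u => g u * expi u ^+ n) = 0) -> aeD (fun t => g t = 0).
Proof.
move=> Ig H1 H2; apply: aeD_imp (poisson_limit Ig) => t _ H.
apply: small_eq => e e0; have [sigma sg K] := H e e0.
pose s := (sigma + 1) / 2; have [s0 B] := K s ltac:(rewrite /s; lra) ltac:(rewrite /s; lra).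
move: B; rewrite (@poisson_small g s t 0)//; first by rewrite sub0r subr0 normcN.
  by rewrite /s; lra.
move=> d d0; exists 0%N => N _.
rewrite !big1 ?add0r ?subr0; try by move=> k _; rewrite ?H1 ?H2 mul0r.
have <- : cmean (fun u => g u * expi u ^+ 0) = cmean g.
  by apply: eq_cmean => u; rewrite expr0 mulr1.
by rewrite H2 !oppr0 Normc.normc0 ltW.
Qed.

(** Negative coefficients vanish, so the second sum of [poisson_series] reduces to its term of index
    0, which cancels [cmean g]; the power series is left. *)
Lemma poisson_HB a g s t l : HB a g -> 0 <= s -> s < 1 -> has_psum a (s%:C * expi t) l ->
  cmean (fun u => (pk s (t - u))%:C * g u) = l.
Proof.
move=> Hg s0 s1 Hl; have [Ig _] := Hg.
apply: poisson_small => //; first exact: cint2_1.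
move=> e e0; have [N HN] := Hl e e0; exists N.+1 => -[//|n] nN.
have -> : \sum_(k < n.+1) cmean (fun u => g u * expi u ^+ k) * conjc ((s%:C * expi t) ^+ k) = cmean g.
  rewrite big_ord_recl big1 => [|k _]; last by rewrite (HB_coefN _ Hg) mul0r.
  by rewrite expr0 conjc1 mulr1 addr0; apply: eq_cmean => u; rewrite expr0 mulr1.
rewrite addrK; under eq_bigr do rewrite (HB_coef _ Hg).
exact/HN/ltnW.
Qed.

(** The values of [f] along a radius are Poisson integrals of [g], so Fatou's theorem is an instance
    of [poisson_limit]. *)
Lemma fatou_radial a g (f : R[i] -> R[i]) : HB a g ->
  (forall z, normc z < 1 -> has_psum a z (f z)) ->
  aeD (fun t => radial_lim f (expi t) = g t).
Proof.
move=> Hg Hf; have [Ig _] := Hg.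
apply: aeD_imp (poisson_limit (cint2_1 Ig)) => t _ H.
have K (h : R[i] -> R) : (forall x y, h x - h y = h (x - y)) -> (forall x, `|h x| <= normc x) ->
    h (f (s%:C * expi t)) @[s --> (1 : R)^'-] --> h (g t).
  move=> hB hn; apply/cvgrPdist_le => e e0; have [sigma sg Ks] := H e e0.
  near=> s; have s1 : s < 1 by near: s; exact: nbhs_left_lt.
  have sgs : sigma < s by near: s; exact: nbhs_left_gt.
  have [s0 B] := Ks s sgs s1.
  rewrite distrC hB; apply: le_trans (hn _) _; apply: le_trans B.
  rewrite (poisson_HB Hg s0 s1 (Hf _ _))//.
  by rewrite normcM normc_real ger0_norm// -[expi t]expr1 normc_expiX mulr1.
apply: complexP => /=; apply: cvg_lim => //; apply: K => x.
- by move=> y; rewrite ReD ReN.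
- exact: Re_le.
- by move=> y; rewrite ImD ImN.
- exact: Im_le.
Unshelve. all: by end_near. Qed.

End PoissonSeries.

(** * Power series on the disk and measurability of radial limits *)

Section DiskFunctions.
Context {R : realType}.
Local Notation mu := (@lebesgue_measure R).
Local Notation D := (@angles R).
Implicit Types (a : nat -> R[i]) (f : R[i] -> R[i]) (s t : R) (z : R[i]).

Lemma psum_bounded a z l : has_psum a z l -> exists M : R, forall k, normc (a k * z ^+ k) <= M.
Proof.
move=> /(_ 1 ltr01)[N HN]; exists (2 + \sum_(k < N) normc (a k * z ^+ k)) => k.
have S0 : 0 <= \sum_(k < N) normc (a k * z ^+ k) by apply: sumr_ge0 => j _; exact: normc_ge0.
case: (ltnP k N) => kN.
  rewrite (bigD1 (Ordinal kN))//= addrCA lerDl addr_ge0// sumr_ge0// => j _; exact: normc_ge0.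
have := HN k kN; have := HN k.+1 (leqW kN); rewrite big_ord_recr /= => h1 h2.
have -> : a k * z ^+ k = (l - \sum_(i < k) a i * z ^+ i) -
    (l - (\sum_(i < k) a i * z ^+ i + a k * z ^+ k)) by ring.
by apply: le_trans (normcD _ _) _; rewrite normcN; lra.
Qed.

Lemma asum_tail_le (x : nat -> R[i]) n : asum x ->
  normc (csum x - \sum_(k < n) x k) <= fine (essum (tailn n (fun k => normc (x k)))).
Proof.
move=> ax; rewrite (csum_split n ax) addrAC subrr add0r.
apply: le_trans (csum_norm (asum_tailc n ax)) _; rewrite le_eqVlt; apply/orP; left; apply/eqP.
by congr fine; apply: eq_essum => k; rewrite /tailc /tailn; case: ifP; rewrite ?Normc.normc0.
Qed.

Lemma asum_tail_small (x : nat -> R[i]) : asum x -> forall e : R, 0 < e ->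
  exists N, forall n, (N <= n)%N -> fine (essum (tailn n (fun k => normc (x k)))) <= e.
Proof.
move=> ax e e0; have n0 k : 0 <= normc (x k) by exact: normc_ge0.
have [N HN] := essum_tail n0 ax e0; exists N => n /HN h.
rewrite -lee_fin fineK// fsum_fin//; first exact: tailn_ge0.
exact: fsum_tail.
Qed.

Lemma csum_psum a z : asum (fun k => a k * z ^+ k) -> has_psum a z (csum (fun k => a k * z ^+ k)).
Proof.
move=> ax e e0; have [N HN] := asum_tail_small ax e0; exists N => n /HN h.
exact: le_trans (asum_tail_le n ax) h.
Qed.

Lemma psum_unique a z l l' : has_psum a z l -> has_psum a z l' -> l = l'.
Proof.
move=> H H'; apply: small_eq => e e0; have e2 : 0 < e / 2 by rewrite divr_gt0.
have [N HN] := H _ e2; have [N' HN'] := H' _ e2.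
have := HN _ (leq_maxl N N'); have := HN' _ (leq_maxr N N'); set S := \sum_(_ < _) _ => h1 h2.
have -> : l - l' = (l - S) - (l' - S) by ring.
by apply: le_trans (normcD _ _) _; rewrite normcN; lra.
Qed.

Definition danalytic a f := forall z, normc z < 1 -> has_psum a z (f z).

Lemma normc_realM s t : 0 <= s -> normc (s%:C * expi t) = s.
Proof.
by move=> s0; rewrite normcM normc_real ger0_norm// -[expi t]expr1 normc_expiX mulr1.
Qed.

(** Convergence at the larger radius s' = (1 + |z|) / 2 bounds the terms there, and comparison with
    a geometric series of ratio |z| / s' gives absolute convergence at [z]. *)
Lemma da_asum a f z : danalytic a f -> normc z < 1 -> asum (fun k => a k * z ^+ k).
Proof.
move=> Hf z1; pose s' := (1 + normc z) / 2; have nz := normc_ge0 z.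
have s'0 : 0 < s' by rewrite /s'; lra.
have s'1 : s' < 1 by rewrite /s'; lra.
have ns : normc (s'%:C : R[i]) = s' by rewrite normc_real gtr0_norm.
have ns1 : normc (s'%:C : R[i]) < 1 by rewrite ns.
have [M HM] := psum_bounded (Hf _ ns1).
pose q := normc z / s'; have q0 : 0 <= q by rewrite divr_ge0// ltW.
have q1 : q < 1 by rewrite ltr_pdivrMr// mul1r /s'; lra.
apply: asum_le (fsumZ M (geometric_fsum q0 q1)) => k.
have := HM k; rewrite !normcM !normcX ns => h.
have -> : normc z = s' * q by rewrite mulrC divfK// gt_eqF.
by rewrite exprMn mulrA ler_wpM2r// exprn_ge0.
Qed.

Lemma da_csum a f z : danalytic a f -> normc z < 1 -> f z = csum (fun k => a k * z ^+ k).
Proof.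
move=> Hf z1; apply: psum_unique (Hf z z1) _; apply: csum_psum; exact: da_asum Hf z1.
Qed.

Lemma da_unif a f s : danalytic a f -> 0 <= s -> s < 1 -> forall e : R, 0 < e ->
  exists N, forall n, (N <= n)%N -> forall z, normc z <= s ->
    normc (f z - \sum_(k < n) a k * z ^+ k) <= e.
Proof.
move=> Hf s0 s1 e e0.
have ns : normc (s%:C : R[i]) = s by rewrite normc_real ger0_norm.
have As : asum (fun k => a k * s%:C ^+ k) by apply: (da_asum Hf); rewrite ns.
have [N HN] := asum_tail_small As e0; exists N => n /HN h z zs.
have z1 : normc z < 1 by exact: le_lt_trans zs s1.
have Az := da_asum Hf z1; rewrite (da_csum Hf z1).
apply: le_trans (asum_tail_le n Az) _; apply: le_trans h; apply: fine_mono.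
- by apply: essum_ge0; apply: tailn_ge0 => k; exact: normc_ge0.
- apply: le_essum => k; rewrite /tailn; case: ifP => // _.
  rewrite !normcM ler_wpM2l ?normc_ge0// !normcX ns lerXn2r ?nnegrE ?normc_ge0//.
- apply: (fsum_fin _ (fsum_tail n As)).
  by apply: tailn_ge0 => k; exact: normc_ge0.
Qed.

Lemma HB_dilate a f s : danalytic a f -> 0 <= s -> s < 1 ->
  HB (fun k => a k * s%:C ^+ k) (fun t => f (s%:C * expi t)).
Proof.
move=> Hf s0 s1.
have mf : cmeas (fun t => f (s%:C * expi t)).
  apply: (@eq_cmeas _ (fun t => csum (fun k => a k * (s%:C * expi t) ^+ k))).
    by move=> t; rewrite (da_csum Hf)// normc_realM.
  apply: cmeas_csum => k; apply: (@eq_cmeas _ (fun t => a k * s%:C ^+ k * expi t ^+ k)).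
    by move=> t; rewrite exprMn mulrA.
  by apply: cmeasM; [exact: cmeas_cst|exact: cmeas_expiX].
have E n t : trig (iota 0 n) (fun k => a k * s%:C ^+ k) t = \sum_(k < n) a k * (s%:C * expi t) ^+ k.
  rewrite (sum_iota (fun k => a k * (s%:C * expi t) ^+ k)); apply: eq_bigr => k _.
  by rewrite exprMn mulrA.
have small e : 0 < e -> exists N, forall n, (N <= n)%N ->
    (m2 (fun t => (f (s%:C * expi t) - trig (iota 0 n) (fun k => a k * s%:C ^+ k) t)%R) <= e%:E)%E.
  move=> e0; have s0' : 0 < Num.sqrt e by rewrite sqrtr_gt0.
  have [N HN] := da_unif Hf s0 s1 s0'; exists N => n /HN h.
  rewrite -(mE_cst e); apply: le_mE => [t|||t].
  - by rewrite lee_fin sqn_ge0.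
  - by apply: Emeasurable_sqn; apply: cmeasB => //; case: (cint2_trig (iota 0 n) (fun k => a k * s%:C ^+ k)).
  - exact: measurable_cst.
  - rewrite lee_fin -sqnE E -[leRHS](sqr_sqrtr (ltW e0)) lerXn2r ?nnegrE ?normc_ge0 ?sqrtr_ge0//.
    by apply: h; rewrite normc_realM.
split=> //; have [N HN] := small 1 ltr01.
have It := cint2_trig (iota 0 N) (fun k => a k * s%:C ^+ k).
have -> : (fun t => f (s%:C * expi t)) = (fun t => (f (s%:C * expi t) -
    trig (iota 0 N) (fun k => a k * s%:C ^+ k) t) + trig (iota 0 N) (fun k => a k * s%:C ^+ k) t).
  by apply/funext => t; rewrite subrK.
apply: cint2D => //; split; first by apply: cmeasB => //; case: It.
by apply: le_lt_trans (HN N (leqnn _)) _; exact: ltry.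
Qed.

(** [h] stands for the real or the imaginary part, described by its linearity over the reals. *)
Lemma poly_cont n a t (h : R[i] -> R) : (forall x y, h (x + y) = h x + h y) ->
  (forall (c : R) y, h (c%:C * y) = c * h y) ->
  continuous (fun s : R => h (\sum_(k < n) a k * (s%:C * expi t) ^+ k)).
Proof.
move=> hD hZ.
have E : (fun s : R => h (\sum_(k < n) a k * (s%:C * expi t) ^+ k)) =
    (fun s => \sum_(k < n) s ^+ k * h (a k * expi t ^+ k)).
  apply/funext => u; elim: n => [|n IH].
    by rewrite !big_ord0 -[X in h X](mulr0 0%:C) hZ mul0r.
  rewrite !big_ord_recr /= hD IH -hZ; congr (_ + h _).
  by rewrite exprMn (rmorphXn (real_complex R)) /=; ring.
rewrite E {E}; elim: n => [|n IH].
  rewrite [X in continuous X](_ : _ = fun=> 0); first exact: cst_continuous.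
  by apply/funext => s; rewrite big_ord0.
rewrite [X in continuous X](_ : _ = fun s =>
    \sum_(k < n) s ^+ k * h (a k * expi t ^+ k) + s ^+ n * h (a n * expi t ^+ n)).
  move=> s; apply: cvgD; first exact: IH.
  by apply: cvgM; [exact: exprn_continuous|exact: cvg_cst].
by apply/funext => s; rewrite big_ord_recr.
Qed.

Lemma dist3 (x p q y e : R) : `|x - p| <= e / 3 -> `|p - q| <= e / 3 -> `|y - q| <= e / 3 ->
  `|x - y| <= e.
Proof.
rewrite !ler_norml => /andP[? ?] /andP[? ?] /andP[? ?]; apply/andP; split; lra.
Qed.

Lemma da_cont a f t (h : R[i] -> R) s : danalytic a f -> (forall x y, h (x + y) = h x + h y) ->
  (forall (c : R) y, h (c%:C * y) = c * h y) -> (forall x, `|h x| <= normc x) ->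
  0 < s -> s < 1 ->
  h (f (u%:C * expi t)) @[u --> s] --> h (f (s%:C * expi t)).
Proof.
move=> Hf hD hZ hn s0 s1; apply/cvgrPdist_le => e e0.
have e3 : 0 < e / 3 by rewrite divr_gt0.
pose s' := (1 + s) / 2.
have s'0 : 0 <= s' by rewrite /s'; lra.
have s'1 : s' < 1 by rewrite /s'; lra.
have [N /(_ N (leqnn _)) HN] := da_unif Hf s'0 s'1 e3.
have /cvgrPdist_le /(_ _ e3) Hc := @poly_cont N a t h hD hZ s.
have hB x y : h (x - y) = h x - h y.
  rewrite hD; congr (_ + _); have := hZ (-1) y; rewrite mulN1r => <-.
  by congr h; rewrite rmorphN mulN1r.
near=> u.
have u0 : 0 < u by near: u; exact: lt_nbhsr.
have us : u < s' by near: u; apply: lt_nbhsl; rewrite /s'; lra.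
have A1 : normc (f (u%:C * expi t) - \sum_(k < N) a k * (u%:C * expi t) ^+ k) <= e / 3.
  by apply: HN; rewrite normc_realM ltW.
have A2 : normc (f (s%:C * expi t) - \sum_(k < N) a k * (s%:C * expi t) ^+ k) <= e / 3.
  by apply: HN; rewrite normc_realM /s'; lra.
have A3 : `|h (\sum_(k < N) a k * (s%:C * expi t) ^+ k) - h (\sum_(k < N) a k * (u%:C * expi t) ^+ k)| <= e / 3.
  by near: u.
by apply: (dist3 _ A3); rewrite -hB; [exact: le_trans (hn _) A2|exact: le_trans (hn _) A1].
Unshelve. all: by end_near. Qed.

(* The points where a radial limit exists form a Borel set, on whose complement [lim] is [0]. *)
Lemma measurable_radial (phi : R -> R -> R) :
  (forall s, 0 < s -> s < 1 -> measurable_fun D (phi s)) ->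
  (forall t s, 0 < s -> s < 1 -> phi u t @[u --> s] --> phi s t) ->
  measurable_fun D (fun t => lim (phi s t @[s --> (1 : R)^'-])).
Proof.
move=> mphi cphi.
(* Rational radii give countably many conditions, and continuity in the radius makes the Cauchy
   criterion over them equivalent to the existence of the limit. Codes of no rational are sent to 0,
   which [good] rejects. *)
pose rt n : R := oapp (fun q : rat => ratr q) 0 (unpickle n).
pose good N n := ((1 - N.+1%:R^-1 < rt n) && (0 < rt n) && (rt n < 1)).
pose B k N n m : set R := [set t | D t /\ (good N n -> good N m ->
   `|phi (rt n) t - phi (rt m) t| <= k.+1%:R^-1)].
pose E : set R := \bigcap_k \bigcup_N \bigcap_n \bigcap_m B k N n m.
have DE t : E t -> D t.
  move=> /(_ 0%N I)[N _] /(_ 0%N I) /(_ 0%N I) []//.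
have mB k N n m : measurable (B k N n m).
  case: (boolP (good N n && good N m)) => [/andP[g1 g2]|ng].
    have -> : B k N n m = D `&` (fun t => `|phi (rt n) t - phi (rt m) t|) @^-1` [set x | x <= k.+1%:R^-1].
      by apply/seteqP; split => t /= [Dt H]; split => //; exact: H.
    case/andP: (g1) => /andP[_ n0] n1; case/andP: (g2) => /andP[_ m0] m1.
    have : measurable_fun D (fun t => `|phi (rt n) t - phi (rt m) t|).
      by apply: measurableT_comp => //; apply: measurable_funB; exact: mphi.
    apply; first exact: mD.
    have -> : [set x : R | x <= k.+1%:R^-1] = `]-oo, k.+1%:R^-1]%classic.
      by apply/seteqP; split => x; rewrite /= in_itv.
    exact: measurable_itv.
  have -> : B k N n m = D; last exact: mD.
  apply/seteqP; split => t /=; first by case.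
  by move=> Dt; split => // g1 g2; rewrite g1 g2 in ng.
have mE : measurable E.
  apply: bigcapT_measurable => k; apply: bigcupT_measurable => N.
  by apply: bigcapT_measurable => n; apply: bigcapT_measurable => m.
have rtq (q : rat) : exists n, rt n = ratr q by exists (pickle q); rewrite /rt pickleK.
have near_rat t x y e : 0 < x -> x < 1 -> y < x -> 0 < e ->
    exists n, [/\ y < rt n, 0 < rt n, rt n < 1 & `|phi x t - phi (rt n) t| <= e].
  move=> x0 x1 yx e0; have /cvgrPdist_le /(_ _ e0) [d /= d0 Hd] := cphi t x x0 x1.
  have : Num.max y (Num.max 0 (x - d)) < x by rewrite !gt_max yx x0 ltrBlDr ltrDl d0.
  move=> /rat_in_itvoo[q]; rewrite in_itv /= !gt_max => /andP[/andP[yq /andP[q0 dq]] qx].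
  have [n rn] := rtq q; exists n; rewrite rn; split => //; first exact: lt_trans qx x1.
  by apply: Hd; rewrite /= ger0_norm; lra.
have inv_small (d : R) : 0 < d -> exists N : nat, N.+1%:R^-1 < d.
  move=> d0; exists (Num.truncn d^-1).
  have d1 : 0 < d^-1 by rewrite invr_gt0.
  have /andP[_ h] := truncn_itv (ltW d1).
  by rewrite invf_plt ?posrE ?ltr0n.
have Ecvg t : D t -> E t <-> cvg (phi s t @[s --> (1 : R)^'-]).
  move=> Dt; split.
    move=> Et; apply/cauchy_cvgP; apply: cauchy_exP => e e0.
    have e4 : 0 < e / 4 by rewrite divr_gt0.
    have [k ke] := inv_small _ e4.
    have [N _ HN] := Et k I.
    pose y : R := Num.max 0 (1 - N.+1%:R^-1).
    have y1 : y < 1 by rewrite gt_max ltr01 ltrBlDr ltrDl invr_gt0 ltr0n.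
    have y0 : 0 <= y by rewrite le_max lexx.
    pose x0 := (y + 1) / 2; exists (phi x0 t).
    have goodn n : y < rt n -> rt n < 1 -> good N n.
      by rewrite gt_max => /andP[p q] r; rewrite /good p q r.
    have key x : y < x -> x < 1 -> exists n, [/\ good N n, rt n < 1 & `|phi x t - phi (rt n) t| <= e / 4].
      move=> yx x1; have [n [yn n0 n1 hn]] := near_rat t x y _ (le_lt_trans y0 yx) x1 yx e4.
      by exists n; split => //; exact: goodn.
    have [|| n [gn n1 hn]] := key x0; rewrite /x0; try lra.
    change (\forall s \near (1 : R)^'-, ball (phi x0 t) e (phi s t)); near=> s.
    have ys : y < s by near: s; exact: nbhs_left_gt.
    have s1 : s < 1 by near: s; exact: nbhs_left_lt.
    have [m [gm m1 hm]] := key s ys s1.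
    have [_ /(_ gn gm) /le_trans /(_ (ltW ke)) hnm] := HN n I m I.
    rewrite /ball /= -/x0; move: hn hm hnm; rewrite !ler_norml ltr_norml.
    move=> /andP[? ?] /andP[? ?] /andP[? ?]; apply/andP; split; lra.
  move=> /cvg_ex[/= l] Hl k _.
  have k0 : 0 < (k.+1%:R^-1 / 2 : R) by rewrite divr_gt0// invr_gt0 ltr0n.
  have := Hl; move=> /cvgrPdist_le /(_ _ k0) [d /= d0 Hd].
  have [N HN] := inv_small _ d0; exists N => // n _ m _; split => // gn gm.
  have H j : good N j -> `|l - phi (rt j) t| <= k.+1%:R^-1 / 2.
    move=> /andP[/andP[a1 a2] a3]; apply: Hd => //=; rewrite ger0_norm ?subr_ge0 ?ltW//.
    by apply: lt_trans HN; rewrite ltrBlDr -ltrBlDl.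
  move: (H _ gn) (H _ gm); move: (k.+1%:R^-1 : R) => kk; rewrite !ler_norml => /andP[? ?] /andP[? ?]; apply/andP; split; lra.
(* These radii are positive from n = 0 on; multiplied by the indicator of [E], the functions at
   these radii converge to [lim] everywhere on [D]. *)
pose s_ n : R := 1 - n.+2%:R^-1.
have s_0 n : 0 < s_ n by rewrite subr_gt0 invf_lt1 ?ltr1n ?ltr0n.
have s_1 n : s_ n < 1 by rewrite ltrBlDr ltrDl invr_gt0 ltr0n.
apply: (measurable_fun_cvg (h := fun n t => \1_E t * phi (s_ n) t)) => [n|t Dt].
  apply: measurable_funM; last exact: mphi.
  by apply: measurable_funTS; apply: measurable_indic.
have [Et|nEt] := pselect (E t); last first.
  rewrite dvgP; last by move=> /(Ecvg t Dt).
  by under eq_fun do rewrite indicE memNset// mul0r; exact: cvg_cst.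
under eq_fun do rewrite indicE mem_set// mul1r.
have /(Ecvg t Dt) Hl := Et; apply/cvgrPdist_le => e e0.
move: Hl => /cvgrPdist_le /(_ _ e0) [d /= d0 Hd].
have [N HN] := inv_small _ d0; exists N => // n /= Nn.
apply: Hd => //=; rewrite /s_ opprB addrCA subrr addr0 ger0_norm ?invr_ge0//.
apply: le_lt_trans HN; rewrite lef_pV2 ?posrE ?ltr0n// ler_nat ltnS.
exact: leq_trans Nn (leqnSn _).
Unshelve. all: by end_near. Qed.

Lemma cmeas_radial a f : danalytic a f -> cmeas (fun t => radial_lim f (expi t)).
Proof.
move=> Hf.
have K (h : R[i] -> R) : (forall x y, h (x + y) = h x + h y) ->
    (forall (c : R) y, h (c%:C * y) = c * h y) -> (forall x, `|h x| <= normc x) ->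
    (forall g, cmeas g -> measurable_fun D (fun t => h (g t))) ->
    measurable_fun D (fun t => lim (h (f (s%:C * expi t)) @[s --> (1 : R)^'-])).
  move=> hD hZ hn hm; apply: (@measurable_radial (fun s t => h (f (s%:C * expi t)))).
    move=> s s0 s1; apply: hm; by case: (HB_dilate Hf (ltW s0) s1) => -[].
  by move=> t s s0 s1; exact: (@da_cont a f t h s).
split; apply: K.
- exact: ReD.
- by move=> c y; rewrite ReM /= mul0r subr0.
- exact: Re_le.
- by move=> g [].
- exact: ImD.
- by move=> c y; rewrite ImM /= mul0r addr0.
- exact: Im_le.
- by move=> g [].
Qed.

(** [riesz_fischer] supplies a boundary function and [fatou_radial] identifies it with the radial
    limit almost everywhere; measurability of the latter allows the replacement. *)
Lemma HB_radial a f : danalytic a f -> l2 a -> HB a (fun t => radial_lim f (expi t)).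
Proof.
move=> Hf la; have [g Hg] := riesz_fischer la.
apply: (@ae_eq_HB _ _ g) => //; first exact: cmeas_radial Hf.
by apply: aeD_imp (fatou_radial Hg Hf) => t _ ->.
Qed.

End DiskFunctions.

(** * Vector-valued Hardy functions *)

Section Ecvg.
Context {R : realType}.
Implicit Types u : nat -> \bar R.

Lemma ecvg0P u : (forall n, (0 <= u n)%E) ->
  u n @[n --> \oo] --> 0%E <->
  (forall e : R, 0 < e -> exists N, forall n, (N <= n)%N -> (u n <= e%:E)%E).
Proof.
move=> u0; split.
  move=> /fine_cvgP[[N _ fN] /cvgrPdist_le H] e e0.
  have [M _ HM] := H e e0; exists (maxn N M) => n; rewrite geq_max => /andP[Nn Mn].
  have un : u n \is a fin_num by apply: fN.
  have := HM n Mn; rewrite sub0r normrN ger0_norm ?fine_ge0//=.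
  by rewrite -{2}(fineK un) lee_fin.
move=> H; have fin e n : (u n <= e%:E)%E -> u n \is a fin_num.
  by move=> h; rewrite ge0_fin_numE//; apply: le_lt_trans h (ltry _).
apply/fine_cvgP; split.
  by have [N HN] := H 1 ltr01; exists N => // n /= /HN; exact: fin.
apply/cvgrPdist_le => e e0; have [N HN] := H e e0; exists N => // n /= /HN h.
rewrite sub0r normrN ger0_norm ?fine_ge0// -lee_fin fineK//; exact: fin h.
Qed.

Lemma l2norm_le (I : choiceType) (x : I -> R[i]) (e : R) : 0 <= e ->
  (l2norm x <= e%:E)%E = (sqs x <= (e ^+ 2)%:E)%E.
Proof.
move=> e0; rewrite l2norm_sqs.
have -> : e%:E = sqrte (e ^+ 2)%:E by rewrite /= sqrtr_sqr ger0_norm.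
by rewrite lee_sqrt// lee_fin sqr_ge0.
Qed.

Lemma l2norm_le1 (I : choiceType) (x : I -> R[i]) : (l2norm x <= 1)%E = (sqs x <= 1)%E.
Proof.
rewrite l2norm_sqs.
have E : sqrte 1%E = 1%E :> \bar R by rewrite -[1%E]/(1%:E) /= sqrtr1.
by rewrite -{1}E lee_sqrt// lee_fin.
Qed.

End Ecvg.

Section H2.
Context {R : realType} {I : countType}.
Local Notation mu := (@lebesgue_measure R).
Local Notation D := (@angles R).
Implicit Types (a : nat -> I -> R[i]) (f : R[i] -> I -> R[i]).

Lemma sqn_le_sqs (x : I -> R[i]) i : ((sqn (x i))%:E <= sqs x)%E.
Proof.
have := @sum_le_essum R I [:: i] (fun i => sqn (x i)) isT (fun i => sqn_ge0 _).
by rewrite big_seq1.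
Qed.

Lemma essum_pair (J K : choiceType) (p : J -> K -> R) : (forall j k, 0 <= p j k) ->
  essum (fun x : J * K => p x.1 x.2) = \esum_(j in [set: J]) essum (p j).
Proof.
move=> p0; rewrite /essum (@esum_esum R J K setT (fun=> setT)); last first.
  by move=> i j _ _; rewrite lee_fin.
by congr esum; apply/seteqP; split => -[].
Qed.

(** The square of the H^2 norm, by [h2normE], written as a single l^2 sum over pairs (power,
    coordinate) so that density in H^2 becomes density in l^2 of a product index set. *)
Definition h2sq a : \bar R := sqs (fun x : nat * I => a x.1 x.2).

Lemma h2sq_coef a : h2sq a = \esum_(k in [set: nat]) sqs (a k).
Proof. by rewrite /h2sq /sqs (essum_pair (p := fun k i => sqn (a k i)))// => *; exact: sqn_ge0. Qed.

Lemma h2sq_row a : h2sq a = \esum_(i in [set: I]) essum (fun k => sqn (a k i)).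
Proof.
by rewrite h2sq_coef /sqs /essum essum_exchange// => *; exact: sqn_ge0.
Qed.

Lemma h2sq_ge0 a : (0 <= h2sq a)%E.
Proof. exact: sqs_ge0. Qed.

Lemma esum_term_lt (J : choiceType) (q : J -> \bar R) j : (forall j, (0 <= q j)%E) ->
  (\esum_(j in [set: J]) q j < +oo)%E -> (q j < +oo)%E.
Proof.
move=> q0; apply: le_lt_trans; rewrite -(@esum_set1 _ _ j q)//.
by rewrite esum_mkcond; apply: le_esum => k _; case: ifP.
Qed.

Lemma h2sq_l2_coef a k : (h2sq a < +oo)%E -> l2 (a k).
Proof. by rewrite h2sq_coef => /(@esum_term_lt _ _ k); apply => j; exact: sqs_ge0. Qed.

Lemma h2sq_l2_row a i : (h2sq a < +oo)%E -> l2 (fun k => a k i).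
Proof.
by rewrite h2sq_row => /(@esum_term_lt _ _ i); apply => j; apply: essum_ge0 => k; exact: sqn_ge0.
Qed.

(** Only coordinatewise convergence is asked, less than in [analyticv]; together with a finite
    [h2sq] it characterises [in_H2], by [in_H2_coef] and [in_H2_intro]. *)
Definition vanalytic a f := forall i, danalytic (fun k => a k i) (fun z => f z i).

Lemma analyticv_coef f : analyticv f -> exists a, vanalytic a f.
Proof.
move=> [a [_ H]]; exists a => i z z1 e e0.
have := H z z1 => /ecvg0P K.
have [|N HN] := K _ e e0; first by move=> n; exact: sqrte_ge0.
exists N => n /HN; rewrite l2norm_le ?(ltW e0)// => h.
rewrite -(@ler_pXn2r _ 2)// ?nnegrE ?normc_ge0 ?(ltW e0)// sqnE -lee_fin.
apply: le_trans h; have := @sqn_le_sqs (fun i => f z i - \sum_(k < n) z ^+ k * a k i) i.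
by congr ((sqn (_ - _))%:E <= _)%E; apply: eq_bigr => k _; rewrite mulrC.
Qed.

Lemma circle_sqs a f s : vanalytic a f -> 0 <= s -> s < 1 ->
  circle_eint (fun zeta => (l2norm (f (s%:C * zeta)%R) ^+ 2)%E) =
  h2sq (fun k i => (a k i * s%:C ^+ k)%R).
Proof.
move=> Hf s0 s1; rewrite h2sq_row.
transitivity (mE (fun t => essum (fun i => sqn (f (s%:C * expi t) i)))).
  by apply: eq_mE => t; rewrite sqr_l2norm.
have HBi i := HB_dilate (Hf i) s0 s1.
rewrite (@mE_essum R I (fun i t => sqn (f (s%:C * expi t) i))).
- by apply: eq_esum => i _; exact: HB_parseval (HBi i).
- by move=> i t; exact: sqn_ge0.
- by move=> i; apply: measurable_sqn; case: (HBi i) => -[].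
Qed.

Lemma expr_bernoulli (s : R) n : 0 <= s -> s <= 1 -> 1 - n%:R * (1 - s) <= s ^+ n.
Proof.
move=> s0 s1; elim: n => [|n IH]; first by rewrite mul0r subr0 expr0.
rewrite exprS -natr1; apply: le_trans (ler_wpM2l s0 IH).
rewrite -subr_ge0.
have -> : s * (1 - n%:R * (1 - s)) - (1 - (n%:R + 1) * (1 - s)) = n%:R * (1 - s) ^+ 2 by ring.
by rewrite mulr_ge0// sqr_ge0.
Qed.

(** On the circle of radius s, Parseval gives the coefficients damped by s^k. One inequality is
    termwise; for the other, a finite partial sum is compared with its damped version as s tends to
    1. *)
Lemma h2normE a f : vanalytic a f -> h2norm f = sqrte (h2sq a).
Proof.
move=> Hf; rewrite /h2norm.
have -> : [set sqrte (circle_eint (fun zeta => (l2norm (f (s%:C * zeta)%R) ^+ 2)%E))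
            | s in [set s : R | 0 <= s < 1]] =
   [set sqrte (h2sq (fun k i => (a k i * s%:C ^+ k)%R)) | s in [set s : R | 0 <= s < 1]].
  by apply/seteqP; split => _ /= [s /andP[s0 s1] <-]; exists s; rewrite ?s0//;
    rewrite (circle_sqs Hf).
apply/eqP; rewrite eq_le; apply/andP; split.
  apply: ge_ereal_sup => _ [s /andP[s0 s1] <-]; rewrite lee_sqrt ?h2sq_ge0//.
  apply: le_essum => x; rewrite sqnM ler_piMr ?sqn_ge0// -sqnE normcX normc_real ger0_norm//.
  by rewrite -exprM exprn_ile1// ltW.
set S := ereal_sup _.
have SH s : 0 <= s -> s < 1 -> (sqrte (h2sq (fun k i => (a k i * s%:C ^+ k)%R)) <= S)%E.
  by move=> s0 s1; apply: ereal_sup_ubound; exists s => //; rewrite /= s0.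
have S0 : (0 <= S)%E by apply: le_trans (SH 0 (lexx _) ltr01); exact: sqrte_ge0.
case: S S0 SH => [M| |]// M0 SH; last by rewrite leey.
rewrite lee_fin in M0.
have -> : M%:E = sqrte (M ^+ 2)%:E by rewrite /= sqrtr_sqr ger0_norm.
rewrite lee_sqrt ?lee_fin ?sqr_ge0//.
have {}SH s : 0 <= s -> s < 1 -> (h2sq (fun k i => (a k i * s%:C ^+ k)%R) <= (M ^+ 2)%:E)%E.
  move=> s0 s1; have := SH s s0 s1.
  have -> : M%:E = sqrte (M ^+ 2)%:E by rewrite /= sqrtr_sqr ger0_norm.
  by rewrite lee_sqrt// lee_fin sqr_ge0.
apply: essum_le_ub => [x|l ul]; first exact: sqn_ge0.
have [n Hn] := seq_nat_bound [seq x.1 | x <- l].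
set X := \sum_(x <- l) _; rewrite lee_fin.
have X0 : 0 <= X by apply: sumr_ge0 => x _; exact: sqn_ge0.
have key s : 0 <= s -> s < 1 -> s ^+ (n * 2) * X <= M ^+ 2.
  move=> s0 s1; rewrite -lee_fin; apply: le_trans (SH s s0 s1).
  apply: (@le_trans _ _ (\sum_(x <- l) sqn (a x.1 x.2 * s%:C ^+ x.1))%R%:E).
    rewrite lee_fin mulr_sumr big_seq [leRHS]big_seq; apply: ler_sum => x xl.
    rewrite sqnM mulrC ler_wpM2l ?sqn_ge0// -sqnE normcX normc_real ger0_norm// -exprM.
    rewrite ler_wiXn2l ?(ltW s1)// leq_mul2r /=; apply/ltnW/Hn.
    by apply/mapP; exists x.
  by apply: (sum_le_essum (p := fun x : nat * I => sqn (a x.1 x.2 * s%:C ^+ x.1))) => // x;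
    exact: sqn_ge0.
apply/ler_addgt0Pr => e e0.
pose N : R := (n * 2)%:R; have N0 : 0 <= N by rewrite ler0n.
(* At radius 1 - d, Bernoulli's inequality bounds the loss from damping by d N X, which this choice
   keeps below [e]; the cap at 1 keeps the radius nonnegative. *)
pose d := Num.min 1 (e / (N * X + 1)).
have NX : 0 < N * X + 1 by rewrite ltr_wpDl// mulr_ge0.
have d0 : 0 < d by rewrite lt_min ltr01 divr_gt0.
have d1 : d <= 1 by rewrite ge_min lexx.
have d2 : d * (N * X + 1) <= e by rewrite -ler_pdivlMr// ge_min lexx orbT.
have s0 : 0 <= 1 - d by rewrite subr_ge0.
have s1 : 1 - d < 1 by rewrite ltrBlDr ltrDl.
have := key _ s0 s1; have := expr_bernoulli (n * 2) s0 (ltW s1); rewrite -/N.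
move=> /(ler_wpM2r X0) h1 h2.
have h3 : (1 - N * (1 - (1 - d))) * X <= M ^+ 2 := le_trans h1 h2.
have E : (1 - N * (1 - (1 - d))) * X = X - d * (N * X) by ring.
rewrite E in h3.
have : d * (N * X) <= d * (N * X + 1) by rewrite ler_wpM2l ?(ltW d0)// lerDl.
lra.
Qed.

Lemma in_H2_coef f : in_H2 f -> exists2 a, vanalytic a f & (h2sq a < +oo)%E.
Proof.
move=> [/analyticv_coef[a Ha] hf]; exists a => //.
move: hf; rewrite (h2normE Ha); have := h2sq_ge0 a.
by case: (h2sq a) => //= r _ _; rewrite ltry.
Qed.

(** Coordinatewise convergence is upgraded to convergence in norm: by Cauchy-Schwarz the squared
    remainder in each coordinate is at most C times a tail of coefficients, where C is the sum of
    the |z|^(2k), and these tails are summable over the coordinates. *)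
Lemma in_H2_intro a f : vanalytic a f -> (h2sq a < +oo)%E -> in_H2 f.
Proof.
move=> Hf ha; split; last first.
  rewrite (h2normE Hf); have := h2sq_ge0 a; move: ha.
  by case: (h2sq a) => //= r _ _; rewrite ltry.
exists a; split; first by move=> n; apply/in_l2P; exact: h2sq_l2_coef.
move=> z z1; apply/ecvg0P => [n|]; first exact: sqrte_ge0.
pose T k := fine (sqs (a k)).
have T0 k : 0 <= T k by rewrite fine_ge0// sqs_ge0.
have TE k : (T k)%:E = sqs (a k) by rewrite fineK// l2_fin//; exact: h2sq_l2_coef.
have fT : fsum T.
  rewrite fsum_pos// /essum; under eq_esum do rewrite TE.
  by rewrite -h2sq_coef.
have z2 : normc z ^+ 2 < 1 by rewrite expr_lt1// normc_ge0.
have lz : l2 (fun k => z ^+ k).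
  rewrite l2_fsum; apply: fsum_le (geometric_fsum (sqr_ge0 (normc z)) z2) => k.
  by rewrite -sqnE normcX -!exprM mulnC.
pose C := fine (sqs (fun k => z ^+ k)); have C0 : 0 <= C by rewrite fine_ge0// sqs_ge0.
move=> e e0; have e1 : 0 < e ^+ 2 / (C + 1) by rewrite divr_gt0 ?exprn_gt0// ltr_wpDl.
have [N HN] := essum_tail T0 fT e1; exists N => n /HN Hn.
rewrite l2norm_le ?(ltW e0)//.
have row i : l2 (tailc n (fun k => a k i)).
  have := h2sq_l2_row i ha; rewrite !l2_fsum; apply: fsum_le => k.
  by rewrite /tailc; case: ifP; rewrite // sqn0 normr0.
have bound i : sqn (f z i - \sum_(k < n) z ^+ k * a k i) <= C * fine (sqs (tailc n (fun k => a k i))).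
  have Az := da_asum (Hf i) z1; rewrite (da_csum (Hf i) z1) (csum_split n Az).
  have -> : \sum_(k < n) z ^+ k * a k i = \sum_(k < n) a k i * z ^+ k.
    by apply: eq_bigr => k _; rewrite mulrC.
  rewrite addrAC subrr add0r; apply: le_trans (cauchy_schwarz lz (row i)).
  rewrite le_eqVlt; apply/orP; left; apply/eqP; congr sqn; apply: eq_csum => k.
  by rewrite /tailc; case: ifP; rewrite ?mulr0// mulrC.
apply: (@le_trans _ _ (essum (fun i => C * fine (sqs (tailc n (fun k => a k i)))))).
  exact: le_essum.
rewrite essumZ//; last by move=> i; rewrite fine_ge0// sqs_ge0.
have -> : essum (fun i => fine (sqs (tailc n (fun k => a k i)))) = essum (tailn n T).
  transitivity (\esum_(i in [set: I]) \esum_(k in [set: nat]) (sqn (tailc n (fun k => a k i) k))%:E).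
    by apply: eq_esum => i _; rewrite fineK//; exact: l2_fin.
  rewrite essum_exchange; last by move=> i k; exact: sqn_ge0.
  apply: eq_esum => k _; rewrite /tailc /tailn; case: ifP => _; first by rewrite TE.
  by rewrite esum1// => i _; rewrite sqn0.
apply: le_trans (lee_wpmul2l _ Hn) _; first by rewrite lee_fin.
rewrite -EFinM lee_fin mulrA ler_pdivrMr ?ltr_wpDl// mulrC ler_wpM2l ?sqr_ge0//.
by rewrite lerDl.
Qed.

Lemma HB_bdv a f i : vanalytic a f -> (h2sq a < +oo)%E ->
  HB (fun k => a k i) (fun t => bdv f (expi t) i).
Proof. by move=> Hf ha; apply: HB_radial (Hf i) _; exact: h2sq_l2_row. Qed.

Lemma mE_sqs a (g : R -> I -> R[i]) : (forall i, HB (fun k => a k i) (fun t => g t i)) ->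
  mE (fun t => sqs (g t)) = h2sq a.
Proof.
move=> H; rewrite h2sq_row /sqs (@mE_essum R I (fun i t => sqn (g t i))).
- by apply: eq_esum => i _; exact: HB_parseval (H i).
- by move=> i t; exact: sqn_ge0.
- by move=> i; apply: measurable_sqn; case: (H i) => -[].
Qed.

Lemma measurable_sqs (g : R -> I -> R[i]) : (forall i, cmeas (fun t => g t i)) ->
  measurable_fun D (fun t => sqs (g t)).
Proof.
move=> mg; apply: (@measurable_essum R I (fun i t => sqn (g t i))) => [i t|i].
  exact: sqn_ge0.
exact: measurable_sqn.
Qed.

Lemma aeD_l2 a (g : R -> I -> R[i]) : (forall i, HB (fun k => a k i) (fun t => g t i)) ->
  (h2sq a < +oo)%E -> aeD (fun t => l2 (g t)).
Proof.
move=> H ha; apply: mE_ae_fin; first by move=> t; exact: sqs_ge0.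
  by apply: measurable_sqs => i; case: (H i) => -[].
by rewrite (mE_sqs H).
Qed.

Lemma danalytic_csum (b : nat -> R[i]) : l2 b -> danalytic b (fun z => csum (fun k => b k * z ^+ k)).
Proof.
move=> lb z z1; apply: csum_psum; apply: l2M => //.
have z2 : normc z ^+ 2 < 1 by rewrite expr_lt1// normc_ge0.
rewrite l2_fsum; apply: fsum_le (geometric_fsum (sqr_ge0 (normc z)) z2) => k.
by rewrite -sqnE normcX -!exprM mulnC.
Qed.

End H2.

(** * Products of boundary functions, and the return from the circle to the disk *)

Section BoundaryProducts.
Context {R : realType}.
Local Notation mu := (@lebesgue_measure R).
Local Notation D := (@angles R).
Implicit Types (a b : nat -> R[i]) (g h : R -> R[i]).

Lemma fourier_eq g h : cint1 g -> cint1 h ->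
  (forall n, cmean (fun u => g u * conjc (expi u ^+ n)) = cmean (fun u => h u * conjc (expi u ^+ n))) ->
  (forall n, cmean (fun u => g u * expi u ^+ n.+1) = cmean (fun u => h u * expi u ^+ n.+1)) ->
  aeD (fun t => g t = h t).
Proof.
move=> Ig Ih H1 H2.
have H0 n : cmean (fun u => g u * expi u ^+ n) = cmean (fun u => h u * expi u ^+ n).
  case: n => [|n]; last exact: H2.
  have E (k : R -> R[i]) : cmean (fun u => k u * expi u ^+ 0) = cmean (fun u => k u * conjc (expi u ^+ 0)).
    by apply: eq_cmean => u; rewrite expr0 conjc1.
  by rewrite !E.
suff : aeD (fun t => g t - h t = 0) by apply: aeD_imp => t _ /subr0_eq.
apply: (@fourier_unique R (fun t => g t - h t)); first exact: cint1B.
- move=> n; rewrite (eq_cmean (g := fun u => g u * conjc (expi u ^+ n) - h u * conjc (expi u ^+ n))).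
    by rewrite cmeanB ?H1 ?subrr//; exact: cint1_expJM.
  by move=> u; rewrite mulrBl.
- move=> n; rewrite (eq_cmean (g := fun u => g u * expi u ^+ n - h u * expi u ^+ n)).
    by rewrite cmeanB ?H0 ?subrr//; exact: cint1_expM.
  by move=> u; rewrite mulrBl.
Qed.

Lemma HB_ae_unique a g h : HB a g -> HB a h -> aeD (fun t => g t = h t).
Proof.
move=> Hg Hh; apply: fourier_eq.
- by apply: cint2_1; case: Hg.
- by apply: cint2_1; case: Hh.
- by move=> n; rewrite (HB_coef _ Hg) (HB_coef _ Hh).
- by move=> n; rewrite (HB_coefN _ Hg) (HB_coefN _ Hh).
Qed.

(** The Riesz-Fischer function with the same coefficients of index >= 0 has all its Fourier
    coefficients in common with [g], so the two agree almost everywhere. *)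
Lemma HB_of_coef g : cint2 g -> (forall n, cmean (fun t => g t * expi t ^+ n.+1) = 0) ->
  HB (fun n => cmean (fun t => g t * conjc (expi t ^+ n))) g.
Proof.
move=> Ig H; have [g' Hg'] := riesz_fischer (coef_l2 Ig).
apply: (ae_eq_HB (f := g')) => //; first by case: Ig.
apply: fourier_eq; [by apply: cint2_1; case: Hg'|exact: cint2_1| |].
- by move=> n; rewrite (HB_coef _ Hg').
- by move=> n; rewrite (HB_coefN _ Hg') H.
Qed.

Lemma cmean_expiM a g n m : HB a g ->
  cmean (fun t => expi t ^+ m * (g t * conjc (expi t ^+ n))) = if (m <= n)%N then a (n - m)%N else 0.
Proof.
move=> Hg; case: leqP => mn.
  rewrite -(HB_coef (n - m) Hg); apply: eq_cmean => t.
  by rewrite -{1}(subnK mn) exprD conjM [conjc _ * conjc _]mulrC mulrCA !mulrA -[_ * expi t ^+ m * _]mulrA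
    expiXJ mulr1.
rewrite -(HB_coefN (m - n).-1 Hg); apply: eq_cmean => t.
rewrite prednK ?subn_gt0// -{1}(subnK (ltnW mn)) exprD mulrCA -!mulrA expiXJ mulr1//.
Qed.

(** Cauchy product: against h conj(zeta^n), the partial sums of [g] stop contributing after index n,
    because [h] has no negative frequencies. *)
Lemma HB_mul_coef a b g h n : HB a g -> HB b h ->
  cmean (fun t => g t * h t * conjc (expi t ^+ n)) = \sum_(m < n.+1) a m * b (n - m)%N.
Proof.
move=> Hg Hh; have [Ih _] := Hh.
have Ihe : cint2 (fun t => h t * conjc (expi t ^+ n)).
  case: Ih => mh fh; split.
    by apply: cmeasM => //; apply: cmeasJ; exact: cmeas_expiX.
  by rewrite /m2; under eq_mE do rewrite sqnM sqnJ sqn_expiX mulr1.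
rewrite (eq_cmean (g := fun t => g t * (h t * conjc (expi t ^+ n)))); last by move=> t; rewrite mulrA.
apply: (HB_const (N0 := n.+1) Hg Ihe) => N nN.
rewrite (sum_iota (fun k => a k * cmean (fun t => expi t ^+ k * (h t * conjc (expi t ^+ n))))) (sum_iota (fun m => a m * b (n - m)%N)).
rewrite -[N in LHS](subnKC nN) iotaD big_cat add0n -[RHS]addr0; congr (_ + _).
  by apply: eq_big_seq => k; rewrite mem_iota add0n ltnS => /andP[_ kn]; rewrite (cmean_expiM _ _ Hh) kn.
by apply: big1_seq => k /andP[_]; rewrite mem_iota => /andP[nk _];
  rewrite (cmean_expiM _ _ Hh) leqNgt nk mulr0.
Qed.

Lemma HB_mul_coefN a b g h n : HB a g -> HB b h ->
  cmean (fun t => g t * h t * expi t ^+ n.+1) = 0.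
Proof.
move=> Hg Hh; have [Ih _] := Hh.
have Ihe : cint2 (fun t => h t * expi t ^+ n.+1).
  case: Ih => mh fh; split; first by apply: cmeasM => //; exact: cmeas_expiX.
  by rewrite /m2; under eq_mE do rewrite sqnM sqn_expiX mulr1.
rewrite (eq_cmean (g := fun t => g t * (h t * expi t ^+ n.+1))); last by move=> t; rewrite mulrA.
apply: (HB_const (N0 := 0%N) Hg Ihe) => N _; apply: big1 => k _.
rewrite (eq_cmean (g := fun t => h t * expi t ^+ (k + n).+1)) ?(HB_coefN _ Hh) ?mulr0//.
by move=> t; rewrite mulrCA -exprD addnS.
Qed.

Section Vector.
Context {I : countType}.
Implicit Types (x y : nat -> I -> R[i]) (u v : R -> I -> R[i]).

Definition conv x y n i := \sum_(m < n.+1) x m i * y (n - m)%N i.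

Lemma h2sq_m2 x u : (forall i, HB (fun k => x k i) (fun t => u t i)) ->
  h2sq x = \esum_(i in [set: I]) m2 (fun t => u t i).
Proof. by move=> H; rewrite h2sq_row; apply: eq_esum => i _; rewrite (HB_parseval (H i)). Qed.

(** [psi] stands for a monomial or its conjugate; being unimodular it leaves L^1 bounds unchanged,
    and the mean inequality for |u_i v_i| justifies termwise integration. *)
Lemma dot_mul u v (psi : R -> R[i]) : (forall i, cmeas (fun t => u t i)) ->
  (forall i, cmeas (fun t => v t i)) ->
  (\esum_(i in [set: I]) m2 (fun t => u t i) < +oo)%E ->
  (\esum_(i in [set: I]) m2 (fun t => v t i) < +oo)%E ->
  cmeas psi -> (forall t, normc (psi t) = 1) ->
  cint1 (fun t => csum (fun i => u t i * v t i)) /\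
  cmean (fun t => csum (fun i => u t i * v t i) * psi t) =
    csum (fun i => cmean (fun t => u t i * v t i * psi t)).
Proof.
move=> mu' mv fu fv mpsi npsi.
have K (phi : R -> R[i]) : cmeas phi -> (forall t, normc (phi t) = 1) ->
    (\esum_(i in [set: I]) m1 (fun t => (u t i * v t i * phi t)%R) < +oo)%E.
  move=> mphi nphi; apply: (@le_lt_trans _ _
    (\esum_(i in [set: I]) (m2 (fun t => u t i) + m2 (fun t => v t i)))%E).
    apply: le_esum => i _.
    have -> : m1 (fun t => u t i * v t i * phi t) = m1 (fun t => u t i * v t i).
      by apply: eq_mE => t; rewrite normcM nphi mulr1.
    apply: le_trans (m1M ltr01 (mu' i) (mv i)) _; rewrite invr1 mul1r.
    have h : (2^-1 <= 1 :> R) by rewrite invf_le1// ler1n.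
    by apply: leeD; rewrite -[leRHS]mul1e; apply: lee_wpmul2r; rewrite ?m2_ge0.
  rewrite esumD; last 2 first.
  - by move=> i _; exact: m2_ge0.
  - by move=> i _; exact: m2_ge0.
  by rewrite lte_add_pinfty.
have m1c : cmeas (fun=> 1 : R[i]) by exact: cmeas_cst.
have muv i : cmeas (fun t => u t i * v t i) by exact: cmeasM.
have [a1 I1 _] : [/\ aeD (fun t => asum (fun i => u t i * v t i)),
    cint1 (fun t => csum (fun i => u t i * v t i)) & True].
  have := @cint1_csum R I (fun i t => u t i * v t i) muv.
  case=> //; have := K _ m1c (fun=> Normc.normc1 R); congr (_ < _)%E.
  by apply: eq_esum => i _; apply: eq_mE => t; rewrite mulr1.
split=> //.
have mpi i : cmeas (fun t => u t i * v t i * psi t) by exact: cmeasM.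
have [_ I2 <-] := @cint1_csum R I (fun i t => u t i * v t i * psi t) mpi (K _ mpsi npsi).
apply: ae_eq_cmean.
- by apply: cmeasM => //; case: I1.
- by case: I2.
- apply: aeD_imp a1 => t _ h; rewrite mulrC -csumZ//.
  by apply: eq_csum => i; rewrite mulrC.
Qed.

(** Here analyticity of both factors excludes negative frequencies: the pairing has the summed
    Cauchy products as coefficients. It is bilinear, which is why a transpose of the symbol, and not
    an adjoint, preserves analyticity. *)
Lemma dot_coef x y u v n : (forall i, HB (fun k => x k i) (fun t => u t i)) ->
  (forall i, HB (fun k => y k i) (fun t => v t i)) -> (h2sq x < +oo)%E -> (h2sq y < +oo)%E ->
  [/\ cint1 (fun t => csum (fun i => u t i * v t i)),
    cmean (fun t => csum (fun i => u t i * v t i) * conjc (expi t ^+ n)) = csum (conv x y n) &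
    cmean (fun t => csum (fun i => u t i * v t i) * expi t ^+ n.+1) = 0].
Proof.
move=> Hu Hv; rewrite (h2sq_m2 Hu) (h2sq_m2 Hv) => fx fy.
have mu' i : cmeas (fun t => u t i) by case: (Hu i) => -[].
have mv i : cmeas (fun t => v t i) by case: (Hv i) => -[].
have [I1 E1] := dot_mul mu' mv fx fy (cmeasJ (cmeas_expiX n)) (fun t => etrans (normcJ _) (normc_expiX t n)).
have [_ E2] := dot_mul mu' mv fx fy (cmeas_expiX n.+1) (fun t => normc_expiX t n.+1).
split=> //.
- by rewrite E1; apply: eq_csum => i; exact: (HB_mul_coef n (Hu i) (Hv i)).
- rewrite E2 (eq_csum (y := fun=> 0)); last by move=> i; exact: (HB_mul_coefN n (Hu i) (Hv i)).
  by rewrite (csum_seq (s := [::]))// big_nil.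
Qed.

(** The Fourier coefficients serve as Taylor coefficients, and the radial limits of the resulting
    H^2 function give back [u]. *)
Lemma vec_boundary u : (forall i, cmeas (fun t => u t i)) -> (mE (fun t => sqs (u t)) < +oo)%E ->
  (forall i n, cmean (fun t => u t i * expi t ^+ n.+1) = 0) ->
  exists x f, [/\ vanalytic x f, (h2sq x < +oo)%E, in_H2 f,
    (forall i, HB (fun k => x k i) (fun t => u t i)) &
    aeD (fun t => bdv f (expi t) = u t)].
Proof.
move=> mu' fu H.
pose x n i := cmean (fun t => u t i * conjc (expi t ^+ n)).
have Eu : mE (fun t => sqs (u t)) = \esum_(i in [set: I]) m2 (fun t => u t i).
  rewrite /sqs (@mE_essum R I (fun i t => sqn (u t i)))// => [i t|i]; first exact: sqn_ge0.
  exact: measurable_sqn.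
have Iu i : cint2 (fun t => u t i).
  split=> //; rewrite Eu in fu; apply: (esum_term_lt (q := fun i => m2 (fun t => u t i))) fu => j.
  exact: m2_ge0.
have Hx i : HB (fun k => x k i) (fun t => u t i) by exact: HB_of_coef.
have hx : (h2sq x < +oo)%E by rewrite (h2sq_m2 Hx) -Eu.
pose f z i := csum (fun k => x k i * z ^+ k).
have Hf : vanalytic x f by move=> i; apply: danalytic_csum; exact: h2sq_l2_row.
exists x, f; split => //; first exact: in_H2_intro Hf hx.
have : aeD (fun t => forall i, bdv f (expi t) i = u t i).
  by apply: aeD_forall => i; apply: HB_ae_unique (HB_bdv i Hf hx) (Hx i).
by apply: aeD_imp => t _ h; apply/funext.
Qed.

End Vector.

End BoundaryProducts.

(** * Operators on l^2 *)

Section SumTails.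
Context {R : realType} {I : choiceType}.

Definition offs (s : seq I) (x : I -> R[i]) i := if i \in s then 0 else x i.
Definition ons (s : seq I) (x : I -> R[i]) i := if i \in s then x i else 0.

Lemma ons_off s (x : I -> R[i]) i : i \notin s -> ons s x i = 0.
Proof. by rewrite /ons => /negbTE ->. Qed.

Lemma onsD s (x : I -> R[i]) i : x i = ons s x i + offs s x i.
Proof. by rewrite /ons /offs; case: ifP; rewrite ?addr0 ?add0r. Qed.

Lemma l2_ons s (x : I -> R[i]) : uniq s -> l2 (ons s x).
Proof. by move=> us; apply: (l2_seq us) => i; exact: ons_off. Qed.

Lemma sqs_ons s (x : I -> R[i]) : uniq s -> sqs (ons s x) = (\sum_(i <- s) sqn (x i))%:E.
Proof.
move=> us; rewrite /sqs (essum_seq us).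
- by congr EFin; apply: eq_big_seq => i is'; rewrite /ons is'.
- by move=> i; exact: sqn_ge0.
- by move=> i /ons_off ->; rewrite sqn0.
Qed.

Lemma sqs_split s (x : I -> R[i]) : sqs x = (sqs (ons s x) + sqs (offs s x))%E.
Proof.
rewrite /sqs -essumD; try by move=> i; exact: sqn_ge0.
by apply: eq_essum => i; rewrite /ons /offs; case: ifP; rewrite sqn0 ?addr0 ?add0r.
Qed.

Lemma l2_tail (x : I -> R[i]) : l2 x -> forall e : R, 0 < e ->
  exists2 s, uniq s & (sqs (offs s x) <= e%:E)%E.
Proof.
move=> lx e e0; have fin := l2_fin lx.
suff [s us Hs] : exists2 s, uniq s & (sqs x - e%:E <= (\sum_(i <- s) sqn (x i))%:E)%E.
  exists s => //; move: Hs fin; rewrite (sqs_split s x) sqs_ons// fin_numD => + /andP[_ t].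
  by rewrite -(fineK t) -EFinD !lee_fin; lra.
apply: contrapT => H.
have : (sqs x <= sqs x - e%:E)%E.
  apply: essum_le_ub => [i|s us]; first exact: sqn_ge0.
  case: (leP (\sum_(i <- s) sqn (x i))%:E (sqs x - e%:E)%E) => // h.
  by exfalso; apply: H; exists s => //; exact: ltW.
by rewrite -(fineK fin) -EFinB lee_fin; lra.
Qed.

Lemma eq_sqs (x y : I -> R[i]) : (forall i, x i = y i) -> sqs x = sqs y.
Proof. by move=> h; congr sqs; apply/funext. Qed.

Lemma sqsZ c (x : I -> R[i]) : sqs (fun i => c * x i) = ((sqn c)%:E * sqs x)%E.
Proof.
rewrite /sqs -essumZ ?sqn_ge0//; last by move=> i; exact: sqn_ge0.
by apply: eq_essum => i; rewrite sqnM.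
Qed.

Lemma sqs_eq0 (x : I -> R[i]) : sqs x = 0%E -> forall i, x i = 0.
Proof.
move=> h i; apply: sqn_eq0; apply/eqP; rewrite eq_le sqn_ge0 andbT -lee_fin.
have := @sum_le_essum R I [:: i] (fun i => sqn (x i)) isT (fun i => sqn_ge0 _).
by rewrite big_seq1 -/(sqs x) h.
Qed.

Lemma csum_sum (T : Type) (l : seq T) (F : T -> I -> R[i]) : (forall k, asum (F k)) ->
  csum (fun i => \sum_(k <- l) F k i) = \sum_(k <- l) csum (F k) /\
  asum (fun i => \sum_(k <- l) F k i).
Proof.
move=> aF; elim: l => [|k l [IH1 IH2]].
  have -> : (fun i => \sum_(k <- [::]) F k i) = (fun=> 0) by apply/funext => i; rewrite big_nil.
  by split; [rewrite (csum_seq (s := [::]))// !big_nil|exact: (asum_seq (s := [::]))].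
have -> : (fun i => \sum_(k0 <- k :: l) F k0 i) = (fun i => F k i + \sum_(k <- l) F k i).
  by apply/funext => i; rewrite big_cons.
by rewrite csumD// big_cons IH1; split => //; exact: asumD.
Qed.

Lemma l2_sum (T : Type) (l : seq T) (F : T -> I -> R[i]) : (forall k, l2 (F k)) ->
  l2 (fun i => \sum_(k <- l) F k i).
Proof.
move=> aF; elim: l => [|k l IH].
  by apply: (l2_seq (s := [::])) => // i _; rewrite big_nil.
have -> : (fun i => \sum_(k0 <- k :: l) F k0 i) = (fun i => F k i + \sum_(k <- l) F k i).
  by apply/funext => i; rewrite big_cons.
exact: l2D.
Qed.

End SumTails.

Section Operators.
Context {R : realType}.

(** The bound is asked on finitely supported vectors only, for which [csum] is a finite sum whatever
    the rows of [A]; [opb_le] extends it to all of l^2. *)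
Definition opb (J I : choiceType) (A : mx R J I) (C : R) :=
  forall s x, uniq s -> (forall i, i \notin s -> x i = 0) ->
    (sqs (mulmv A x) <= (C ^+ 2)%:E * sqs x)%E.

Lemma mulmv_fin (J I : choiceType) (A : mx R J I) s x j : uniq s ->
  (forall i, i \notin s -> x i = 0) -> mulmv A x j = \sum_(i <- s) A j i * x i.
Proof. by move=> us xs; rewrite /mulmv (csum_seq us)// => i /xs ->; rewrite mulr0. Qed.

Section Transpose.
Context {J I : choiceType} (A : mx R J I) (C : R).
Hypothesis HA : opb A C.

Lemma opb_col i : l2 (fun j => A j i).
Proof.
pose x k : R[i] := (k == i)%:R.
have xs k : k \notin [:: i] -> x k = 0 by rewrite inE /x => /negbTE ->.
have := HA (s := [:: i]) isT xs.
have -> : sqs (mulmv A x) = sqs (fun j => A j i).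
  by apply: eq_sqs => j; rewrite (@mulmv_fin J I A [:: i])// big_seq1 /x eqxx mulr1.
move=> h; apply: le_lt_trans h _; rewrite lte_mul_pinfty ?lee_fin ?sqr_ge0//.
exact: (l2_seq (s := [:: i])).
Qed.

(** Duality: [A] is applied to the conjugate of A^t y truncated to a finite list. If X is the
    squared norm of the truncation, then X^2 <= C^2 X |y|^2, hence X <= C^2 |y|^2. *)
Lemma opb_tr_le y : l2 y -> (sqs (mulmv (trm A) y) <= (C ^+ 2)%:E * sqs y)%E.
Proof.
move=> ly; apply: essum_le_ub => [i|s us]; first exact: sqn_ge0.
pose w := mulmv (trm A) y; set X := \sum_(i <- s) _.
have X0 : 0 <= X by apply: sumr_ge0 => i _; exact: sqn_ge0.
pose x := ons s (fun i => conjc (w i)).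
have sx : sqs x = X%:E by rewrite sqs_ons//; congr EFin; apply: eq_bigr => i _; rewrite sqnJ.
have lAx : l2 (mulmv A x).
  apply: le_lt_trans (HA us (fun i => @ons_off _ _ s _ i)) _.
  by rewrite -/x sx ltry.
have E : csum (fun j => mulmv A x j * y j) = X%:C.
  rewrite (eq_csum (y := fun j => \sum_(i <- s) x i * (A j i * y j))); last first.
    move=> j; rewrite (mulmv_fin _ _ us) => [|i]; last exact: ons_off.
    by rewrite mulr_suml; apply: eq_bigr => i _; ring.
  have aA i : asum (fun j => A j i * y j) by apply: l2M => //; exact: opb_col.
  have [-> _] := @csum_sum R J I s (fun i j => x i * (A j i * y j)) (fun i => asumZ _ (aA i)).
  rewrite /X rmorph_sum; apply: eq_big_seq => i is' /=.
  rewrite csumZ// /x /ons is' mulrC -mulJc; congr (_ * _).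
have := cauchy_schwarz lAx ly; rewrite E.
have -> : sqn (X%:C : R[i]) = X ^+ 2 by rewrite /sqn /= expr0n addr0.
have fy := l2_fin ly.
have hA : fine (sqs (mulmv A x)) <= C ^+ 2 * X.
  rewrite -lee_fin fineK ?l2_fin//; apply: le_trans (HA us (fun i => @ons_off _ _ s _ i)) _.
  by rewrite -/x sx.
move=> h; rewrite -(fineK fy) lee_fin.
have Y0 : 0 <= fine (sqs y) by rewrite fine_ge0// sqs_ge0.
move: h => /le_trans /(_ (ler_wpM2r Y0 hA)); move: (fine (sqs y)) Y0 => Y Y0.
have [->|Xn] := eqVneq X 0; first by rewrite mulr_ge0 ?sqr_ge0.
have Xp : 0 < X by rewrite lt_neqAle eq_sym Xn.
by rewrite mulrAC expr2 ler_pM2r.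
Qed.

Lemma opb_tr : opb (trm A) C.
Proof. by move=> s y us ys; apply: opb_tr_le; exact: (l2_seq us). Qed.

End Transpose.

(** The transpose estimate holds on all of l^2 and [trm (trm A)] is convertible with [A], so
    applying it twice removes the restriction to finite support. *)
Lemma opb_le (J I : choiceType) (A : mx R J I) (C : R) : opb A C ->
  forall x, l2 x -> (sqs (mulmv A x) <= (C ^+ 2)%:E * sqs x)%E.
Proof. by move=> HA x lx; have := opb_tr_le (opb_tr HA) lx. Qed.

Lemma opb_l2 (J I : choiceType) (A : mx R J I) (C : R) : opb A C ->
  forall x, l2 x -> l2 (mulmv A x).
Proof.
move=> HA x lx; apply: le_lt_trans (opb_le HA lx) _.
by rewrite lte_mul_pinfty ?lee_fin ?sqr_ge0.
Qed.

Lemma opb_row (J I : choiceType) (A : mx R J I) (C : R) : opb A C ->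
  forall j, l2 (A j).
Proof. by move=> HA j; exact: (opb_col (opb_tr HA)). Qed.

Lemma mulmvD (J I : choiceType) (A : mx R J I) x y j : l2 (A j) -> l2 x -> l2 y ->
  mulmv A (fun i => x i + y i) j = mulmv A x j + mulmv A y j.
Proof.
move=> lA lx ly; rewrite /mulmv -csumD; [|exact: l2M..].
by apply: eq_csum => i; rewrite mulrDr.
Qed.

Lemma mulmvZ (J I : choiceType) (A : mx R J I) c x j : l2 (A j) -> l2 x ->
  mulmv A (fun i => c * x i) j = c * mulmv A x j.
Proof.
move=> lA lx; rewrite /mulmv -csumZ; last exact: l2M.
by apply: eq_csum => i; rewrite mulrCA.
Qed.

(* [u A x] computed in both orders; the double series need not converge absolutely, so
   [x] is approximated by finitely supported vectors. *)
Lemma mulmv_assoc (J I : choiceType) (A : mx R J I) (C : R) u x : opb A C ->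
  l2 u -> l2 x ->
  csum (fun j => u j * mulmv A x j) = csum (fun i => mulmv (trm A) u i * x i).
Proof.
move=> HA lu lx; have HtA := opb_tr HA.
have lAr := opb_row HA; have lAc i := opb_col HA i.
have ltu := opb_l2 HtA lu.
apply: small_eq => e e0.
pose K := C ^+ 2 * fine (sqs u).
have K0 : 0 <= K by rewrite mulr_ge0 ?sqr_ge0// fine_ge0// sqs_ge0.
(* A squared tail of x below [d] makes each of the two error terms at most e / 2 by Cauchy-Schwarz;
   K + 1 avoids a division by 0. *)
pose d := (e / 2) ^+ 2 / (K + 1).
have d0 : 0 < d by rewrite divr_gt0 ?ltr_wpDl// exprn_gt0// divr_gt0.
have [s us Hs] := l2_tail lx d0.
have lon : l2 (ons s x) by exact: l2_ons.
have loff : l2 (offs s x) by apply: le_lt_trans Hs (ltry _).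
have E1 : csum (fun j => u j * mulmv A x j) =
    csum (fun j => u j * mulmv A (ons s x) j) + csum (fun j => u j * mulmv A (offs s x) j).
  rewrite -csumD; [|apply: l2M => //; exact: opb_l2 HA _ _..].
  apply: eq_csum => j; rewrite -mulrDr -mulmvD//; congr (_ * mulmv A _ j).
  by apply/funext => i; exact: onsD.
have E2 : csum (fun i => mulmv (trm A) u i * x i) =
    csum (fun i => mulmv (trm A) u i * ons s x i) + csum (fun i => mulmv (trm A) u i * offs s x i).
  rewrite -csumD; [|exact: l2M..].
  by apply: eq_csum => i; rewrite -mulrDr -onsD.
have E3 : csum (fun j => u j * mulmv A (ons s x) j) = csum (fun i => mulmv (trm A) u i * ons s x i).
  rewrite [RHS](csum_seq us); last by move=> i /ons_off ->; rewrite mulr0.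
  rewrite (eq_csum (y := fun j => \sum_(i <- s) ons s x i * (A j i * u j))); last first.
    move=> j; rewrite (mulmv_fin _ _ us) => [|i]; last exact: ons_off.
    by rewrite mulr_sumr; apply: eq_bigr => i _; ring.
  have aA i : asum (fun j => A j i * u j) by exact: l2M.
  have [-> _] := @csum_sum R J I s (fun i j => ons s x i * (A j i * u j)) (fun i => asumZ _ (aA i)).
  by apply: eq_bigr => i _; rewrite csumZ// mulrC.
rewrite E1 E2 E3 opprD addrACA subrr add0r.
have K1 : 0 < K + 1 by rewrite ltr_wpDl.
have fd : fine (sqs (offs s x)) <= d by rewrite -lee_fin fineK// l2_fin.
have sq_le (p : R[i]) : sqn p <= K * d -> normc p <= e / 2.
  move=> h; rewrite -(@ler_pXn2r _ 2)// ?nnegrE ?normc_ge0 ?divr_ge0 ?(ltW e0)// sqnE.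
  apply: le_trans h _; rewrite /d mulrA ler_pdivrMr// mulrC ler_wpM2l ?sqr_ge0//.
  by rewrite lerDl.
apply: le_trans (normcD _ _) _; rewrite normcN.
suff [h1 h2] : normc (csum (fun j => u j * mulmv A (offs s x) j)) <= e / 2 /\
   normc (csum (fun i => mulmv (trm A) u i * offs s x i)) <= e / 2 by lra.
have fC (T : choiceType) (y : T -> R[i]) : l2 y -> ((C ^+ 2)%:E * sqs y)%E \is a fin_num.
  by move=> ly; rewrite fin_numM// l2_fin.
have u0 : 0 <= fine (sqs u) by rewrite fine_ge0// sqs_ge0.
have o0 : 0 <= fine (sqs (offs s x)) by rewrite fine_ge0// sqs_ge0.
split; apply: sq_le.
  apply: le_trans (cauchy_schwarz lu (opb_l2 HA loff)) _.
  apply: (@le_trans _ _ (fine (sqs u) * (C ^+ 2 * fine (sqs (offs s x))))).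
    apply: ler_wpM2l => //.
    have := fine_mono (sqs_ge0 _) (opb_le HA loff) (fC _ _ loff).
    by rewrite fineM// l2_fin.
  by rewrite mulrCA mulrA ler_wpM2l.
apply: le_trans (cauchy_schwarz ltu loff) _.
apply: ler_pM => //; first by rewrite fine_ge0// sqs_ge0.
have := fine_mono (sqs_ge0 _) (opb_le HtA lu) (fC _ _ lu).
by rewrite fineM// l2_fin.
Qed.

Lemma opnorm_ge0 (J I : choiceType) (A : mx R J I) : (0 <= opnorm A)%E.
Proof.
have h : (l2norm (mulmv A (fun=> 0%R)) <= opnorm A)%E.
  apply: ereal_sup_ubound; exists (fun=> 0) => //=; rewrite l2norm_le1.
  by rewrite (_ : sqs _ = 0%E) ?lee_fin// /sqs /essum esum1// => i _; rewrite sqn0.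
by apply: le_trans h; exact: sqrte_ge0.
Qed.

Lemma opnorm_opb (J I : choiceType) (A : mx R J I) : bounded_op A -> opb A (fine (opnorm A)).
Proof.
move=> bA s x us xs.
have fA : opnorm A \is a fin_num by rewrite ge0_fin_numE ?opnorm_ge0.
have lx : l2 x by exact: (l2_seq us).
pose N := fine (sqs x); have N0 : 0 <= N by rewrite fine_ge0// sqs_ge0.
have EN : sqs x = N%:E by rewrite fineK// l2_fin.
have [Nz|Nn] := eqVneq N 0.
  have x0 := sqs_eq0 (etrans EN (congr1 EFin Nz)).
  rewrite EN Nz mule0 (_ : sqs _ = 0%E)// /sqs /essum esum1// => j _.
  by rewrite (mulmv_fin _ _ us xs) big1 ?sqn0// => i _; rewrite x0 mulr0.
have Np : 0 < N by rewrite lt_neqAle eq_sym Nn.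
pose c : R := (Num.sqrt N)^-1.
have c2 : c ^+ 2 = N^-1 by rewrite exprVn sqr_sqrtr.
have sc : sqn (c%:C : R[i]) = N^-1 by rewrite /sqn /= expr0n addr0.
have : (l2norm (mulmv A (fun i => (c%:C * x i)%R)) <= opnorm A)%E.
  apply: ereal_sup_ubound; exists (fun i => c%:C * x i) => //=.
  by rewrite l2norm_le1 sqsZ sc EN -EFinM mulVf.
rewrite -(fineK fA) l2norm_le ?fine_ge0 ?opnorm_ge0//.
have -> : sqs (mulmv A (fun i => c%:C * x i)) = (N^-1%:E * sqs (mulmv A x))%E.
  rewrite -sc -sqsZ; apply: eq_sqs => j.
  rewrite (mulmv_fin _ _ us); last by move=> i /xs ->; rewrite mulr0.
  by rewrite (mulmv_fin _ _ us xs) mulr_sumr; apply: eq_bigr => i _; rewrite mulrCA.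
by rewrite lee_pdivrMl// EN muleC.
Qed.

Lemma opb_opnorm (J I : choiceType) (A : mx R J I) (C : R) : 0 <= C -> opb A C ->
  (opnorm A <= C%:E)%E.
Proof.
move=> C0 HA; apply: ge_ereal_sup => _ [x /= x1 <-].
rewrite l2norm_le//; move: x1; rewrite l2norm_le1 => x1.
have lx : l2 x by apply: le_lt_trans x1 (ltry _).
apply: le_trans (opb_le HA lx) _; rewrite -[leRHS]mule1.
by apply: lee_wpmul2l => //; rewrite lee_fin sqr_ge0.
Qed.

Lemma opnorm_trm_le (J I : choiceType) (A : mx R J I) : (opnorm (trm A) <= opnorm A)%E.
Proof.
have [bA|] := boolP (opnorm A < +oo)%E; last by rewrite -leNgt => /(le_trans (leey _)).
have C0 : 0 <= fine (opnorm A) by rewrite fine_ge0// opnorm_ge0.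
rewrite -[leRHS]fineK ?ge0_fin_numE ?opnorm_ge0//.
apply: opb_opnorm => //; apply: opb_tr => //; exact: opnorm_opb.
Qed.

Lemma opnorm_trm (J I : choiceType) (A : mx R J I) : opnorm (trm A) = opnorm A.
Proof. by apply/eqP; rewrite eq_le opnorm_trm_le (opnorm_trm_le (trm A)). Qed.

Lemma analyticm_trm (J I : choiceType) (F : R[i] -> mx R J I) :
  analyticm F -> analyticm (fun z => trm (F z)).
Proof.
move=> [A [bA H]]; exists (fun n => trm (A n)); split.
  by move=> n; rewrite /bounded_op opnorm_trm; exact: bA.
by move=> z z1; under eq_fun do rewrite -opnorm_trm; exact: H.
Qed.

(** For finitely supported x the squared norm of A x is a finite combination of pairings of columns,
    so orthonormality makes it equal to the squared norm of x. *)
Lemma isometry_opb (J I : choiceType) (A : mx R J I) : (forall i, l2 (fun j => A j i)) ->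
  mulmm (adjm A) A = @idm R I -> opb A 1.
Proof.
move=> lA HA s x us xs.
have E i i' : csum (fun j => A j i * conjc (A j i')) = (i == i')%:R.
  have := congr1 (fun M : mx R I I => M i' i) HA; rewrite /mulmm /adjm /conjm /trm /idm eq_sym => <-.
  by apply: eq_csum => j; rewrite mulrC.
rewrite expr1n mul1e.
have Ax j : mulmv A x j = \sum_(i <- s) x i * A j i.
  by rewrite (mulmv_fin _ _ us xs); apply: eq_bigr => i _; rewrite mulrC.
have lAx : l2 (mulmv A x).
  rewrite (_ : mulmv A x = fun j => \sum_(i <- s) x i * A j i); last by apply/funext.
  by apply: l2_sum => i; exact: l2Z.
have lx : l2 x by exact: (l2_seq us).
have key : csum (fun j => mulmv A x j * conjc (mulmv A x j)) = csum (fun i => x i * conjc (x i)).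
  rewrite (eq_csum (y := fun j => \sum_(i <- s) x i * (A j i * conjc (mulmv A x j)))); last first.
    by move=> j; rewrite {1}Ax mulr_suml; apply: eq_bigr => i _; rewrite mulrA.
  have aA i : asum (fun j => A j i * conjc (mulmv A x j)) by apply: l2M => //; rewrite l2J.
  have [-> _] := @csum_sum R J I s (fun i j => x i * (A j i * conjc (mulmv A x j))) (fun i => asumZ _ (aA i)).
  rewrite [RHS](csum_seq us); last by move=> i /xs ->; rewrite mul0r.
  apply: eq_big_seq => i is'; rewrite csumZ//; congr (_ * _).
  rewrite (eq_csum (y := fun j => \sum_(k <- s) conjc (x k) * (A j i * conjc (A j k)))); last first.
    move=> j; rewrite Ax conj_sum mulr_sumr; apply: eq_bigr => k _; rewrite conjM; ring.
  have aB k : asum (fun j => A j i * conjc (A j k)) by apply: l2M => //; rewrite l2J.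
  have [-> _] := @csum_sum R J I s (fun k j => conjc (x k) * (A j i * conjc (A j k))) (fun k => asumZ _ (aB k)).
  rewrite (bigD1_seq i)//= csumZ// E eqxx mulr1 big1 ?addr0// => k ki.
  by rewrite csumZ// E eq_sym (negbTE ki) mulr0.
move: key; rewrite !csum_sqn// => /complexI h.
by rewrite -(fineK (l2_fin lAx)) -(fineK (l2_fin lx)) h.
Qed.

(** The matrix identity acts on infinite vectors only after an exchange of summations, which
    [mulmv_assoc] permits once [A] is known to be bounded. *)
Lemma isometry_adj (J I : choiceType) (A : mx R J I) : (forall i, l2 (fun j => A j i)) ->
  mulmm (adjm A) A = @idm R I -> forall x, l2 x -> mulmv (adjm A) (mulmv A x) = x.
Proof.
move=> lA HA x lx; have B := isometry_opb lA HA; apply/funext => k.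
rewrite /mulmv /adjm /conjm /trm.
rewrite (mulmv_assoc B (u := fun j => conjc (A j k)))//; last by rewrite l2J.
rewrite (eq_csum (y := fun i => (i == k)%:R * x i)).
  rewrite (csum_seq (s := [:: k]))// => [|i]; first by rewrite big_seq1 eqxx mul1r.
  by rewrite inE => /negbTE ->; rewrite mul0r.
move=> i; congr (_ * _).
have := congr1 (fun M : mx R I I => M k i) HA; rewrite /mulmm /adjm /conjm /trm /idm eq_sym => <-.
by apply: eq_csum => j; rewrite mulrC.
Qed.

End Operators.

(** * Minors and Cramer's rule *)

Section Minors.
Context {R : realType} {r : nat}.
Implicit Types (U : mx R nat 'I_r).

Definition orthonormal_cols (J I : choiceType) (A : mx R J I) :=
  (forall i, l2 (fun j => A j i)) /\ mulmm (adjm A) A = @idm R I.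

Lemma orthonormal_colsE (J I : choiceType) (A : mx R J I) i i' : orthonormal_cols A ->
  csum (fun j => conjc (A j i) * A j i') = (i == i')%:R.
Proof. by move=> [_ HA]; rewrite -[RHS]/(@idm R I i i') -HA. Qed.

Definition minor U (s : 'I_r -> nat) : 'M[R[i]]_r := \matrix_(i, l) U (s l) i.

(** Cramer's rule as a vector: det S times e_{j0}, minus the combination of the e_{s l} that has the
    same pairings with the columns of [U]. It is finitely supported and polynomial in the entries of
    [U], so bounded analytic entries give a bounded analytic vector. *)
Definition minor_vec U (s : 'I_r -> nat) (j0 : nat) (j : nat) : R[i] :=
  \det (minor U s) * (j == j0)%:R -
  \sum_(l < r) (\sum_(i < r) (\adj (minor U s)) l i * U j0 i) * (j == s l)%:R.

Lemma minor_vec_supp U s j0 j : j \notin undup (j0 :: codom s) -> minor_vec U s j0 j = 0.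
Proof.
rewrite mem_undup inE negb_or => /andP[/negbTE jj0 js].
rewrite /minor_vec jj0 mulr0 big1 ?subrr// => l _.
have -> : (j == s l) = false by apply: contraNF js => /eqP ->; exact: codom_f.
by rewrite mulr0.
Qed.

Lemma csum_minor_vec U s j0 (y : nat -> R[i]) :
  csum (fun j => minor_vec U s j0 j * y j) = \det (minor U s) * y j0 -
    \sum_(l < r) (\sum_(i < r) (\adj (minor U s)) l i * U j0 i) * y (s l).
Proof.
have D k : csum (fun j => (j == k)%:R * y j) = y k /\ asum (fun j => (j == k)%:R * y j).
  have H j : j \notin [:: k] -> (j == k)%:R * y j = 0.
    by rewrite inE => /negbTE ->; rewrite mul0r.
  split; last exact: (asum_seq (s := [:: k])).
  by rewrite (csum_seq (s := [:: k]))// big_seq1 eqxx mul1r.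
pose c l := \sum_(i < r) (\adj (minor U s)) l i * U j0 i.
have [E A] := @csum_sum R nat 'I_r (index_enum 'I_r) (fun l j => c l * ((j == s l)%:R * y j))
  (fun l => asumZ (c l) (D (s l)).2).
rewrite (eq_csum (y := fun j => \det (minor U s) * ((j == j0)%:R * y j) -
    \sum_(l < r) c l * ((j == s l)%:R * y j))); last first.
  move=> j; rewrite /minor_vec mulrBl mulrA; congr (_ - _).
  by rewrite mulr_suml; apply: eq_bigr => l _; rewrite mulrA.
rewrite csumB//; last exact: asumZ (D j0).2.
rewrite csumZ ?(D j0).2// (D j0).1 E; congr (_ - _).
by apply: eq_bigr => l _; rewrite csumZ ?(D (s l)).2// (D (s l)).1.
Qed.

Lemma minor_vec_orth U s j0 i : csum (fun j => U j i * minor_vec U s j0 j) = 0.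
Proof.
rewrite (eq_csum (y := fun j => minor_vec U s j0 j * U j i)); last by move=> j; rewrite mulrC.
rewrite (csum_minor_vec U s j0 (fun j => U j i)).
have /matrixP/(_ i 0) := mulmxA (minor U s) (\adj (minor U s)) (\col_i U j0 i).
rewrite mul_mx_adj mul_scalar_mx !mxE => <-; apply/eqP; rewrite subr_eq0; apply/eqP.
apply: eq_bigr => l _; rewrite !mxE mulrC; congr (_ * _).
by apply: eq_bigr => k _; rewrite !mxE.
Qed.

(** By induction on k, the first N rows reach rank k for some N: if the rank is stuck at k < r, a
    nonzero v killed by these rows is not killed by all of [U], by orthonormality, and a row that
    does not kill v raises the rank. *)
Lemma minor_neq0 U : orthonormal_cols U -> exists s, \det (minor U s) != 0.
Proof.
move=> HU; pose UN N : 'M[R[i]]_(N, r) := \matrix_(j, i) U j i.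
have key k : (k <= r)%N -> exists N, (k <= \rank (UN N))%N.
  elim: k => [|k IH] kr; first by exists 0%N.
  have [N kN] := IH (ltnW kr).
  have [|rk] := ltnP k (\rank (UN N)); first by exists N.
  have Ek : \rank (UN N) = k by apply/eqP; rewrite eqn_leq rk kN.
  have K0 : kermx (UN N)^T != 0.
    by rewrite -mxrank_eq0 mxrank_ker mxrank_tr Ek -lt0n subn_gt0.
  have /rowV0Pn[v /sub_kermxP vN v0] := K0.
  have [j Hj] : exists j, \sum_(i < r) U j i * v 0 i != 0.
    apply: contrapT => H; move/eqP: v0; apply; apply/rowP => i; rewrite mxE.
    have z j : \sum_(i < r) U j i * v 0 i = 0.
      by apply/eqP; apply: contra_notT H => h; exists j.
    have [lU _] := HU.
    have a l : asum (fun j => conjc (U j i) * U j l) by apply: l2M => //; rewrite l2J.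
    have [E _] := @csum_sum R nat 'I_r (index_enum 'I_r)
      (fun l j => v 0 l * (conjc (U j i) * U j l)) (fun l => asumZ _ (a l)).
    transitivity (csum (fun j => conjc (U j i) * (\sum_(i < r) U j i * v 0 i))).
      rewrite (eq_csum (y := fun j => \sum_(l < r) v 0 l * (conjc (U j i) * U j l))); last first.
        by move=> j; rewrite mulr_sumr; apply: eq_bigr => l _; ring.
      rewrite E (bigD1 i)//= csumZ// (orthonormal_colsE _ _ HU) eqxx mulr1 big1 ?addr0// => l li.
      by rewrite csumZ// (orthonormal_colsE _ _ HU) eq_sym (negbTE li) mulr0.
    rewrite (eq_csum (y := fun=> 0)); last by move=> j; rewrite z mulr0.
    by rewrite (csum_seq (s := [::]))// big_nil.
  pose N' := maxn N j.+1; exists N'.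
  have sub : (UN N <= UN N')%MS.
    apply/row_subP => i; have iN : (i < N')%N by rewrite (leq_trans (ltn_ord i))// leq_maxl.
    have -> : row i (UN N) = row (Ordinal iN) (UN N') by apply/rowP => l; rewrite !mxE.
    exact: row_sub.
  rewrite ltnNge; apply/negP => h.
  have : (UN N' <= UN N)%MS.
    have := mxrank_leqif_sup sub; case=> _ <-; rewrite eqn_leq (mxrankS sub) /=.
    by rewrite Ek.
  have jN : (j < N')%N by rewrite leq_max ltnSn orbT.
  move=> /(submx_trans (row_sub (Ordinal jN) _))/submxP[W HW].
  move/eqP: Hj; apply.
  have -> : \sum_(i < r) U j i * v 0 i = (row (Ordinal jN) (UN N') *m v^T) 0 0.
    by rewrite mxE; apply: eq_bigr => i _; rewrite !mxE.
  rewrite HW -mulmxA (_ : UN N *m v^T = 0) ?mulmx0 ?mxE//.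
  by apply: trmx_inj; rewrite trmx_mul trmxK trmx0.
have [N HN] := key r (leqnn r).
have rf : row_full (UN N) by rewrite /row_full eqn_leq rank_leq_col HN.
pose s (l : 'I_r) : nat := fullrankfun rf l.
exists s; rewrite -det_tr -unitfE -unitmxE.
have -> : (minor U s)^T = rowsub (fullrankfun rf) (UN N).
  by apply/matrixP => l i; rewrite !mxE.
by rewrite -row_full_unit fullrowsub_full.
Qed.

End Minors.

(** * Unitarity at a single boundary point *)

Section PointwiseUnitary.
Context {R : realType} {r : nat} {I : choiceType}.
Variables (U : mx R nat 'I_r) (T : mx R nat I).
Hypotheses (HU : orthonormal_cols U) (HT : orthonormal_cols T).
Hypothesis UT : forall i k, csum (fun j => U j i * T j k) = 0.
Hypothesis ranT : forall s j0, exists2 y, l2 y & minor_vec U s j0 = mulmv T y.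

Let BT : opb T 1. Proof. by case: HT => lT e; exact: isometry_opb. Qed.

Lemma orth_range i y : l2 y -> csum (fun j => U j i * mulmv T y j) = 0.
Proof.
move=> ly; rewrite (mulmv_assoc BT (u := fun j => U j i))//; last by case: HU.
rewrite (eq_csum (y := fun=> 0)); first by rewrite (csum_seq (s := [::]))// big_nil.
move=> k; rewrite /mulmv /trm (eq_csum (y := fun j => U j i * T j k)) ?UT ?mul0r//.
by move=> j; rewrite mulrC.
Qed.

(* With [d = e_q - T T^* e_q], orthogonality to the minor vectors forces [d] into the span of the
   conjugate columns of [U], and the coefficients are then those of [e_q]. *)
Lemma complete_rows p q :
  \sum_(i < r) U p i * conjc (U q i) + csum (fun k => conjc (T p k) * T q k) = (p == q)%:R.
Proof.
pose y' k := conjc (T q k).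
have ly' : l2 y' by rewrite l2J; exact: (opb_row BT).
have lTy' : l2 (mulmv T y') by exact: (opb_l2 BT).
pose e j : R[i] := (j == q)%:R.
have es j : j \notin [:: q] -> e j = 0 by rewrite inE /e => /negbTE ->.
have le : l2 e by exact: (l2_seq (s := [:: q])).
pose d j := e j - mulmv T y' j.
have ld : l2 d by apply: l2D => //; rewrite l2N.
have csum_e (x : nat -> R[i]) : l2 x -> csum (fun j => x j * e j) = x q.
  move=> lx; rewrite (csum_seq (s := [:: q]))// => [|j /es ->]; last by rewrite mulr0.
  by rewrite big_seq1 /e eqxx mulr1.
have eJ j : conjc (e j) = e j by rewrite /e; case: eqP => _; rewrite ?conjc1 ?conjc0.
(* [d] is the residue of e_q after projection onto the range of [T], hence orthogonal to that range
   since [T] is an isometry. *)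
have orth y : l2 y -> csum (fun j => mulmv T y j * conjc (d j)) = 0.
  move=> ly; have lTy := opb_l2 BT ly.
  rewrite (eq_csum (y := fun j => mulmv T y j * e j - conjc (mulmv T y' j) * mulmv T y j)); last first.
    by move=> j; rewrite /d conjB eJ; ring.
  rewrite csumB; last 2 first.
  - exact: l2M.
  - by apply: l2M => //; rewrite l2J.
  rewrite csum_e// (mulmv_assoc BT (u := fun j => conjc (mulmv T y' j)))//; last by rewrite l2J.
  apply/eqP; rewrite subr_eq0; apply/eqP; apply: eq_csum => k; congr (_ * _).
  have [lT eT] := HT.
  have := congr1 (fun x : I -> R[i] => conjc (x k)) (isometry_adj lT eT ly').
  rewrite /y' conjcK => <-; rewrite -csumJ; apply: eq_csum => j.
  by rewrite /adjm /conjm /trm conjM conjcK.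
have [s ds] := minor_neq0 HU; set S := minor U s in ds.
(* Orthogonality to [minor_vec U s j] can be solved for conj(d j), as the minor is nonzero: the
   result is row j of [U] applied to a vector [w] that does not depend on j. *)
pose w i := (\det S)^-1 * \sum_(l < r) (\adj S) l i * conjc (d (s l)).
have dE j : conjc (d j) = \sum_(i < r) U j i * w i.
  have [y ly Ey] := ranT s j; have := orth y ly; rewrite -Ey csum_minor_vec -/S => /eqP.
  rewrite subr_eq0 => /eqP h; apply: (mulfI ds); rewrite h mulr_sumr.
  transitivity (\sum_(l < r) \sum_(i < r) (\adj S) l i * U j i * conjc (d (s l))).
    by apply: eq_bigr => l _; rewrite mulr_suml.
  rewrite exchange_big; apply: eq_bigr => i _ /=.
  rewrite /w mulrCA (mulrA (\det S)) mulfV// mul1r mulr_sumr.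
  by apply: eq_bigr => l _; ring.
have [lU eU] := HU.
have wE i : w i = conjc (U q i).
  have a l : asum (fun j => conjc (U j i) * U j l) by apply: l2M => //; rewrite l2J.
  have [E _] := @csum_sum R nat 'I_r (index_enum 'I_r)
    (fun l j => w l * (conjc (U j i) * U j l)) (fun l => asumZ _ (a l)).
  transitivity (csum (fun j => conjc (U j i) * conjc (d j))).
    rewrite (eq_csum (y := fun j => \sum_(l < r) w l * (conjc (U j i) * U j l))); last first.
      by move=> j; rewrite dE mulr_sumr; apply: eq_bigr => l _; ring.
    rewrite E (bigD1 i)//= csumZ// (orthonormal_colsE _ _ HU) eqxx mulr1 big1 ?addr0// => l li.
    by rewrite csumZ// (orthonormal_colsE _ _ HU) eq_sym (negbTE li) mulr0.
  rewrite (eq_csum (y := fun j => conjc (U j i * d j))); last by move=> j; rewrite conjM.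
  rewrite csumJ; congr conjc.
  rewrite (eq_csum (y := fun j => U j i * e j - U j i * mulmv T y' j)); last by move=> j; rewrite -mulrBr.
  rewrite csumB; [|exact: l2M..].
  by rewrite csum_e// orth_range// subr0.
have -> : \sum_(i < r) U p i * conjc (U q i) = conjc (d p).
  by rewrite dE; apply: eq_bigr => i _; rewrite wE.
rewrite /d conjB eJ -csumJ -[RHS]addr0 -addrA; congr (_ + _).
rewrite addrC; apply/eqP; rewrite subr_eq0; apply/eqP; apply: eq_csum => k.
by rewrite conjM /y' conjcK.
Qed.

(** Orthonormality of the columns of [U] and of conj T, with [UT] for the mixed products, makes the
    block matrix an isometry; [complete_rows] is the entrywise form of the other identity. *)
Lemma pointwise_unitary : unitary_op (rowm U (conjm T)).
Proof.
have [lU eU] := HU; have [lT eT] := HT.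
set A := rowm U (conjm T).
have lA x : l2 (fun j => A j x) by case: x => [i|k]; rewrite /A /= ?l2J.
have AA : mulmm (adjm A) A = @idm R _.
  apply/funext => x; apply/funext => x'; rewrite /mulmm /adjm /conjm /trm /A /idm.
  have oU i k : csum (fun j => conjc (U j i) * conjc (T j k)) = 0.
    by rewrite (eq_csum (y := fun j => conjc (U j i * T j k))) ?csumJ ?UT ?conjc0// => j; rewrite conjM.
  case: x x' => [i|k] [i'|k'] /=.
  - exact: (orthonormal_colsE i i' HU).
  - by rewrite oU.
  - rewrite (eq_csum (y := fun j => U j i' * T j k)) ?UT// => j.
    by rewrite /conjm conjcK mulrC.
  - rewrite (eq_csum (y := fun j => conjc (conjc (T j k) * T j k'))).
      by rewrite csumJ (orthonormal_colsE _ _ HT) -[LHS]/(conjc (_%:R)) conjc_nat.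
    by move=> j; rewrite conjM.
have BA := isometry_opb lA AA.
split=> //; first by apply: le_lt_trans (opb_opnorm ler01 BA) (ltry _).
apply/funext => p; apply/funext => q; rewrite /mulmm /adjm /conjm /trm /idm.
have lrow j : l2 (A j) := opb_row BA j.
have aA : asum (fun x => A p x * conjc (A q x)) by apply: l2M => //; rewrite l2J.
have [aU aT] : asum (fun i => U p i * conjc (U q i)) /\ asum (fun k => conjc (T p k) * conjc (conjc (T q k))).
  split; first by apply: (asum_seq (enum_uniq 'I_r)) => i; rewrite mem_enum.
  by apply: l2M; rewrite !l2J; exact: (opb_row BT).
rewrite (csum_sumtype (x := fun x => A p x * conjc (A q x)))//.
rewrite csum_ord -[RHS](complete_rows p q); congr (_ + _).
by apply: eq_csum => k; rewrite /A /= /conjm conjcK.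
Qed.

End PointwiseUnitary.

(** * The kernel of the Toeplitz operator *)

Section HardyOperators.
Context {R : realType}.
Local Notation mu := (@lebesgue_measure R).
Local Notation D := (@angles R).

Definition deltav (I : choiceType) (i : I) : I -> R[i] := fun k => (k == i)%:R.

Lemma deltav_supp (I : choiceType) (i k : I) : k \notin [:: i] -> deltav i k = 0.
Proof. by rewrite inE /deltav => /negbTE ->. Qed.

Lemma l2_deltav (I : choiceType) (i : I) : l2 (deltav i).
Proof. exact: (l2_seq (s := [:: i]) isT (@deltav_supp I i)). Qed.

Lemma mulmv_deltav (J I : choiceType) (A : mx R J I) i : mulmv A (deltav i) = fun j => A j i.
Proof.
apply/funext => j; rewrite (mulmv_fin A j (s := [:: i]) isT (@deltav_supp I i)).
by rewrite big_seq1 /deltav eqxx mulr1.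
Qed.

Lemma HB_cst (c : R[i]) : HB (fun k => if k == 0%N then c else 0) (fun=> c).
Proof.
split; first by apply: (cint2_bound (M := sqn c)) => //; exact: cmeas_cst.
move=> e e0; exists 1%N => -[//|n] _.
have -> : m2 (fun t => (c - trig (iota 0 n.+1) (fun k => if k == 0%N then c else 0) t)%R) = mE (fun=> 0%:E).
  apply: eq_mE => t; rewrite /trig /= big_cons big1_seq /=.
    by rewrite expr0 mulr1 addr0 subrr sqn0.
  by move=> k; rewrite mem_iota => /andP[k0 _]; rewrite gtn_eqF// mul0r.
by rewrite mE_cst lee_fin ltW.
Qed.

Lemma h2sq_cst (I : countType) (x : I -> R[i]) :
  h2sq (fun k i => if k == 0%N then x i else 0) = sqs x.
Proof.
rewrite h2sq_row /sqs; apply: eq_esum => i _.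
rewrite (essum_seq (s := [:: 0%N]))// ?big_seq1// => [k|k]; first exact: sqn_ge0.
by rewrite inE => /negbTE ->; rewrite sqn0.
Qed.

Lemma in_H2_cst (I : countType) (x : I -> R[i]) : l2 x -> in_H2 (fun=> x).
Proof.
move=> lx; apply: (in_H2_intro (a := fun k i => if k == 0%N then x i else 0)); last by rewrite h2sq_cst.
move=> i z z1 e e0; exists 1%N => -[//|n] _.
rewrite big_ord_recl big1 => [|k _]; last by rewrite mul0r.
by rewrite expr0 mulr1 addr0 subrr Normc.normc0 ltW.
Qed.

Section Columns.
Context {J I : countType}.
Implicit Types (F : R[i] -> mx R J I).

Lemma H2s_col F i : in_H2s F -> in_H2 (fun z j => F z j i).
Proof.
move=> [_ H]; have := H (deltav i) ((in_l2P _).2 (l2_deltav i)).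
by under eq_fun do rewrite mulmv_deltav.
Qed.

Lemma H2s_coef F : in_H2s F -> exists A : I -> nat -> J -> R[i], forall i,
  vanalytic (A i) (fun z j => F z j i) /\ (h2sq (A i) < +oo)%E.
Proof.
move=> HF; have H i : exists a, vanalytic a (fun z j => F z j i) /\ (h2sq a < +oo)%E.
  by have [a Ha fa] := in_H2_coef (H2s_col i HF); exists a.
by have [A HA] := choice H; exists A.
Qed.

Lemma HB_bdm F a i j : vanalytic a (fun z j => F z j i) -> (h2sq a < +oo)%E ->
  HB (fun k => a k j) (fun t => bdm F (expi t) j i).
Proof. exact: (HB_bdv j). Qed.

Lemma cmeas_bdm F i j : in_H2s F -> cmeas (fun t => bdm F (expi t) j i).
Proof. by move=> /H2s_coef[A HA]; have [H1 H2] := HA i; case: (HB_bdm j H1 H2) => -[]. Qed.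

Lemma H2s_l2_col F : in_H2s F -> aeD (fun t => forall i, l2 (fun j => bdm F (expi t) j i)).
Proof.
move=> /H2s_coef[A HA]; apply: aeD_forall => i; have [H1 H2] := HA i.
by apply: (aeD_l2 (a := A i)) => // j; exact: HB_bdm.
Qed.

Lemma inner_orthonormal F : inner F -> aeD (fun t => orthonormal_cols (bdm F (expi t))).
Proof.
move=> [HF H]; have H' : aeD (fun t => mulmm (adjm (bdm F (expi t))) (bdm F (expi t)) = @idm R I) := H.
by apply: aeD_imp (aeD_and (H2s_l2_col HF) H') => t _ [].
Qed.

Lemma cmeas_bdv (f : R[i] -> J -> R[i]) j : in_H2 f -> cmeas (fun t => bdv f (expi t) j).
Proof. by move=> /in_H2_coef[a Ha fa]; case: (HB_bdv j Ha fa) => -[]. Qed.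

Lemma bdv_l2 (f : R[i] -> J -> R[i]) : in_H2 f -> aeD (fun t => l2 (bdv f (expi t))).
Proof. by move=> /in_H2_coef[a Ha fa]; apply: (aeD_l2 (a := a)) => // j; exact: HB_bdv. Qed.

(* [F^t x] has the boundary values [F^t(zeta) x]; Bessel's inequality for the orthonormal columns of
   [F(zeta)] bounds its norm. *)
Lemma inner_tr_H2 F x : inner F -> l2 x -> exists c : nat -> I -> R[i],
  [/\ vanalytic c (fun z => mulmv (trm (F z)) x), (h2sq c < +oo)%E &
    forall i, HB (fun k => c k i) (fun t => mulmv (trm (bdm F (expi t))) x i)].
Proof.
move=> HF lx; have [HFs _] := HF; have [A HA] := H2s_coef HFs.
pose y k j := if k == 0%N then x j else 0 : R[i].
have Hy j : HB (fun k => y k j) (fun=> x j) by exact: HB_cst.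
have fy : (h2sq y < +oo)%E by rewrite h2sq_cst.
have Hu i j := HB_bdm j (HA i).1 (HA i).2.
have dot i n := dot_coef n (Hu i) Hy (HA i).2 fy.
have mu' i : cmeas (fun t => mulmv (trm (bdm F (expi t))) x i).
  by apply: cmeas_csum => j; apply: cmeasM; [exact: cmeas_bdm|exact: cmeas_cst].
have [|i n|c [f [_ fc _ Hc _]]] := @vec_boundary R I (fun t => mulmv (trm (bdm F (expi t))) x) mu'.
- apply: (@le_lt_trans _ _ (mE (fun=> sqs x))).
    apply: ae_le_mE.
    + by move=> t; exact: sqs_ge0.
    + by move=> t; exact: sqs_ge0.
    + exact: measurable_sqs.
    + exact: measurable_cst.
    + apply: aeD_imp (inner_orthonormal HF) => t _ [lF eF].
      by have := opb_tr_le (isometry_opb lF eF) lx; rewrite expr1n mul1e.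
  by rewrite -(fineK (l2_fin lx)) mE_cst ltry.
- by have [_ _ H] := dot i n.
exists c; split => //.
(* A constant function has a coefficient at index 0 only, so just the last term of each Cauchy
   product survives. *)
have cE n i : c n i = csum (fun j => A i n j * x j).
  rewrite -(HB_coef n (Hc i)); have [_ -> _] := dot i n; apply: eq_csum => j.
  rewrite /conv big_ord_recr /= subnn /y eqxx big1 ?add0r// => m _.
  by rewrite subn_eq0 leqNgt ltn_ord mulr0.
move=> i z z1; suff -> : mulmv (trm (F z)) x i = csum (fun k => c k i * z ^+ k).
  by apply: danalytic_csum => //; exact: h2sq_l2_row.
have z2 : normc z ^+ 2 < 1 by rewrite expr_lt1// normc_ge0.
have lz : l2 (fun k => z ^+ k).
  rewrite l2_fsum; apply: fsum_le (geometric_fsum (sqr_ge0 (normc z)) z2) => k.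
  by rewrite -sqnE normcX -!exprM mulnC.
have lA k : l2 (A i k) by apply: h2sq_l2_coef; case: (HA i).
transitivity (csum (fun j => csum (fun k => A i k j * (z ^+ k * x j)))).
  apply: eq_csum => j; rewrite /trm (da_csum ((HA i).1 j) z1) mulrC -csumZ.
    by apply: eq_csum => k; ring.
  exact: da_asum ((HA i).1 j) z1.
(* The exchange is justified because the double family is the product of two square-summable
   families over pairs (j, k). *)
rewrite (csum_exchange (x := fun j k => A i k j * (z ^+ k * x j))).
  apply: eq_csum => k; rewrite cE mulrC -csumZ; last exact: l2M.
  by apply: eq_csum => j; ring.
rewrite -(essum_pair (p := fun j k => normc (A i k j * (z ^+ k * x j)))); last first.
  by move=> *; exact: normc_ge0.
have : asum (fun p : J * nat => A i p.2 p.1 * (z ^+ p.2 * x p.1)).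
  apply: l2M.
    rewrite /l2 /sqs (essum_pair (p := fun j k => sqn (A i k j))); last by move=> *; exact: sqn_ge0.
    by rewrite -h2sq_row; case: (HA i).
  rewrite /l2 /sqs (essum_pair (p := fun j k => sqn (z ^+ k * x j))); last by move=> *; exact: sqn_ge0.
  pose Z := fine (sqs (fun k => z ^+ k)); have Z0 : 0 <= Z by rewrite fine_ge0// sqs_ge0.
  rewrite [X in (X < _)%E](_ : _ = essum (fun j => Z * sqn (x j))).
    by rewrite essumZ// ?lte_mul_pinfty// => j; exact: sqn_ge0.
  apply: eq_esum => j _; rewrite (eq_essum (n := fun k => sqn (x j) * sqn (z ^+ k))).
    rewrite essumZ ?sqn_ge0//; last by move=> k; exact: sqn_ge0.
    by rewrite EFinM muleC /Z fineK//; exact: l2_fin.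
  by move=> k; rewrite sqnM mulrC.
by rewrite /asum fsum_pos// => p; exact: normc_ge0.
Qed.

Lemma h2sq_dilate (K : countType) (a : nat -> K -> R[i]) (s : R) : 0 <= s -> s < 1 ->
  (h2sq a < +oo)%E -> (h2sq (fun k i => (a k i * s%:C ^+ k)%R) < +oo)%E.
Proof.
move=> s0 s1; apply: le_lt_trans; apply: le_essum => x.
rewrite sqnM ler_piMr ?sqn_ge0// -sqnE normcX normc_real ger0_norm// -exprM.
by rewrite exprn_ile1// ltW.
Qed.

(* The Taylor coefficients of [F h] are found on the circle of radius 1/2. *)
Lemma range_boundary F h f : inner F -> in_H2 h -> in_H2 f ->
  (forall z, disk z -> f z = mulmv (F z) (h z)) ->
  aeD (fun t => bdv f (expi t) = mulmv (bdm F (expi t)) (bdv h (expi t))).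
Proof.
move=> HF Hh Hf E; have [b Hb fb] := in_H2_coef Hh; have [d Hd fd] := in_H2_coef Hf.
suff : aeD (fun t => forall j, bdv f (expi t) j = mulmv (bdm F (expi t)) (bdv h (expi t)) j).
  by apply: aeD_imp => t _ H; apply/funext.
apply: aeD_forall => j; have [c [Hc fc Hcb]] := inner_tr_H2 HF (l2_deltav j).
have Hc' i : danalytic (fun k => c k i) (fun z => F z j i).
  by move=> z z1; have := Hc i z z1; rewrite mulmv_deltav.
have Hcb' i : HB (fun k => c k i) (fun t => bdm F (expi t) j i).
  have := Hcb i; congr HB; apply/funext => t; by rewrite mulmv_deltav.
pose s : R := 2^-1; have s0 : 0 <= s by rewrite invr_ge0.
have s1 : s < 1 by rewrite invf_lt1// ltr1n.
have sc0 : s%:C != 0 :> R[i] by apply: contra_neq (lt0r_neq0 (_ : 0 < s)) => [/complexI|]; rewrite ?invr_gt0.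
(* On the smaller circle both sides carry the factor s^n, which cancels since s is not 0; the same
   numbers [conv c b n] are the Fourier coefficients of the product of boundary values on the unit
   circle. *)
have dE n : d n j = csum (conv c b n).
  have [_ H _] := dot_coef n (fun i => HB_dilate (Hc' i) s0 s1) (fun i => HB_dilate (Hb i) s0 s1)
    (h2sq_dilate s0 s1 fc) (h2sq_dilate s0 s1 fb).
  have H2 := HB_coef n (HB_dilate (Hd j) s0 s1).
  apply: (mulIf (expf_neq0 n sc0)); rewrite -H2.
  rewrite (eq_cmean (g := fun t => csum (fun i => F (s%:C * expi t) j i * h (s%:C * expi t) i) *
      conjc (expi t ^+ n))); last first.
    by move=> t; rewrite E// /disk normc_realM.
  rewrite H mulrC -csumZ.
    apply: eq_csum => i; rewrite /conv mulr_sumr; apply: eq_bigr => m _.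
    have -> : s%:C ^+ n = s%:C ^+ m * s%:C ^+ (n - m) by rewrite -exprD subnKC// -ltnS.
    by ring.
  suff H3 : forall m : 'I_n.+1, asum (fun i => c m i * b (n - m)%N i).
    by have [] := csum_sum (index_enum 'I_n.+1) H3.
  by move=> m; apply: l2M; exact: h2sq_l2_coef.
have Hfj := HB_bdv j Hd fd.
have dot n := dot_coef n Hcb' (fun i => HB_bdv i Hb fb) fc fb.
apply: fourier_eq.
- by apply: cint2_1; case: Hfj.
- by case: (dot 0%N).
- by move=> n; rewrite (HB_coef n Hfj) dE; case: (dot n) => _ ->.
- by move=> n; rewrite (HB_coefN n Hfj); case: (dot n) => _ _ ->.
Qed.

End Columns.

Section Kernel.
Context {J I : countType} (Y : R[i] -> mx R J I).
Hypothesis HY : in_H2s Y.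

Let g f t i := csum (fun j => bdm Y (expi t) j i * bdv f (expi t) j).

Lemma bdv0 (K : choiceType) zeta : bdv (fun=> (fun=> 0) : K -> R[i]) zeta = fun=> 0.
Proof.
apply/funext => i; rewrite /bdv /radial_lim; apply: complexP => /=; apply: lim_cst => //.
Qed.

Lemma ker_toeplitz_intro f : in_H2 f ->
  aeD (fun t => forall i, g f t i = 0) -> ker_toeplitz (bdm (fun z => trm (Y z))) f.
Proof.
move=> Hf H0; have mg i : cmeas (fun t => g f t i).
  by apply: cmeas_csum => j; apply: cmeasM; [exact: cmeas_bdm|exact: cmeas_bdv].
split; [exact: Hf|split].
- split; [by move=> i; case: (mg i)|by move=> i; case: (mg i)|].
  apply: (@le_lt_trans _ _ (mE (fun=> 0%E))); last by rewrite (mE_cst 0) ltry.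
  rewrite le_eqVlt; apply/orP; left; apply/eqP.
  transitivity (mE (fun t => sqs (g f t))); first by apply: eq_mE => t; rewrite sqr_l2norm.
  apply: ae_eq_mE => //; first by move=> t; exact: sqs_ge0.
    exact: measurable_sqs.
  apply: aeD_imp H0 => t _ h; rewrite /sqs /essum esum1// => i _.
  by rewrite h sqn0.
- by apply: in_H2_cst; apply: (l2_seq (s := [::])).
- move=> k Hk.
  transitivity (cmean (fun t => csum (fun i => (g f t i - bdv (fun=> (fun=> 0) : I -> R[i]) (expi t) i)
    * conjc (bdv k (expi t) i)))); first by [].
  rewrite -[RHS](cmean0 (R := R)); apply: ae_eq_cmean.
  + apply: cmeas_csum => i; apply: cmeasM; last by apply: cmeasJ; exact: cmeas_bdv.
    by apply: cmeasB => //; under eq_fun do rewrite bdv0; exact: cmeas_cst.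
  + exact: cmeas_cst.
  + apply: aeD_imp H0 => t _ h.
    rewrite (csum_seq (s := [::])) ?big_nil// => i _.
    by rewrite h bdv0 subr0 mul0r.
Qed.

Lemma in_H2_monomial n (i : I) : exists k : R[i] -> I -> R[i], in_H2 k /\
  aeD (fun t => forall i', bdv k (expi t) i' = deltav i i' * expi t ^+ n).
Proof.
pose u t i' : R[i] := deltav i i' * expi t ^+ n.
have mu' i' : cmeas (fun t => u t i') by apply: cmeasM; [exact: cmeas_cst|exact: cmeas_expiX].
have [||x [k [_ _ Hk _ Ek]]] := @vec_boundary R I u mu'.
- rewrite (eq_mE (q := fun=> sqs (deltav i))).
    by rewrite -(fineK (l2_fin (l2_deltav i))) mE_cst ltry.
  by move=> t; apply: eq_essum => i'; rewrite sqnM sqn_expiX mulr1.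
- move=> i' m; rewrite (eq_cmean (g := fun t => deltav i i' * expi t ^+ (n + m).+1)).
    by rewrite cmeanZ ?cmean_expiX ?mulr0//; exact/cint2_1/cint2_expiX.
  by move=> t; rewrite /u -mulrA -exprD addnS.
exists k; split => //; by apply: aeD_imp Ek => t _ ->.
Qed.

(** Testing against z^n e_i annihilates the coefficients of index >= 0 of each coordinate of Y^t f,
    and [dot_coef] those of index < 0. *)
Lemma ker_toeplitz_elim f : ker_toeplitz (bdm (fun z => trm (Y z))) f ->
  in_H2 f /\ aeD (fun t => forall i, g f t i = 0).
Proof.
move=> [Hf [_ _ Ho]]; split=> //; apply: aeD_forall => i.
have [A HA] := H2s_coef HY; have [b Hb fb] := in_H2_coef Hf.
have dot n := dot_coef n (fun j => HB_bdm j (HA i).1 (HA i).2) (fun j => HB_bdv j Hb fb) (HA i).2 fb.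
have Ig : cint1 (fun t => g f t i) by case: (dot 0%N).
have mg i' : cmeas (fun t => g f t i').
  by apply: cmeas_csum => j; apply: cmeasM; [exact: cmeas_bdm|exact: cmeas_bdv].
have H0 n : cmean (fun t => g f t i * conjc (expi t ^+ n)) = 0.
  have [k [Hk Ek]] := in_H2_monomial n i; have := Ho k Hk => <-.
  transitivity (cmean (fun t => csum (fun i' => (g f t i' - bdv (fun=> (fun=> 0) : I -> R[i]) (expi t) i')
    * conjc (bdv k (expi t) i')))); last by [].
  apply: ae_eq_cmean.
  + by apply: cmeasM => //; apply: cmeasJ; exact: cmeas_expiX.
  + apply: cmeas_csum => i'; apply: cmeasM; last by apply: cmeasJ; exact: cmeas_bdv.
    by apply: cmeasB => //; under eq_fun do rewrite bdv0; exact: cmeas_cst.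
  + apply: aeD_imp Ek => t _ h.
    rewrite (csum_seq (s := [:: i])) => [|//|i' /deltav_supp d0].
      by rewrite big_seq1 bdv0 subr0 h /deltav eqxx mul1r.
    by rewrite h d0 mul0r conjc0 mulr0.
apply: fourier_unique => // -[|n].
  by rewrite -(H0 0%N); apply: eq_cmean => t; rewrite expr0 conjc1.
by case: (dot n).
Qed.

End Kernel.

End HardyOperators.

(** * The algebra of bounded boundary functions *)

Section BoundedAnalytic.
Context {R : realType}.
Implicit Types (g h : R -> R[i]).

(** The boundary functions of bounded analytic functions. Unlike [HB] alone, this class is closed
    under products, so it contains determinants and entries of adjugates. *)
Definition hb g := (exists a, HB a g) /\ exists M, aeD (fun t => normc (g t) <= M).

Lemma cint2_ae_bound g M : cmeas g -> aeD (fun t => normc (g t) <= M) -> cint2 g.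
Proof.
move=> mg H; split=> //; apply: (@le_lt_trans _ _ (mE (fun=> (M ^+ 2)%:E))).
  apply: ae_le_mE.
  - by move=> t; rewrite lee_fin sqn_ge0.
  - by move=> t; rewrite lee_fin sqr_ge0.
  - by apply/measurable_EFinP; exact: measurable_sqn.
  - exact: measurable_cst.
  - apply: aeD_imp H => t _ h.
    by rewrite lee_fin -sqnE lerXn2r ?nnegrE ?normc_ge0// (le_trans (normc_ge0 _) h).
by rewrite mE_cst ltry.
Qed.

Lemma hb_intro g M : cmeas g -> aeD (fun t => normc (g t) <= M) ->
  (forall n, cmean (fun t => g t * expi t ^+ n.+1) = 0) -> hb g.
Proof.
move=> mg H H0; split; last by exists M.
by eexists; apply: HB_of_coef H0; exact: cint2_ae_bound H.
Qed.

Lemma hb_cst c : hb (fun=> c).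
Proof. by split; [eexists; exact: HB_cst|exists (normc c); apply: aeDW]. Qed.

Lemma hbM g h : hb g -> hb h -> hb (fun t => g t * h t).
Proof.
move=> [[a Ha] [M HM]] [[b Hb] [N HN]].
apply: (@hb_intro _ (M * N)).
- by case: Ha Hb => -[mg _] _ [[mh _] _]; exact: cmeasM.
- apply: aeD_imp (aeD_and HM HN) => t _ [h1 h2].
  by rewrite normcM ler_pM ?normc_ge0.
- by move=> n; exact: HB_mul_coefN Ha Hb.
Qed.

Lemma hbD g h : hb g -> hb h -> hb (fun t => g t + h t).
Proof.
move=> [[a Ha] [M HM]] [[b Hb] [N HN]]; have [Ig _] := Ha; have [Ih _] := Hb.
have I2 k n : cint2 k -> cint1 (fun t => k t * expi t ^+ n.+1 : R[i]).
  by move=> Ik; exact: cint2M Ik (cint2_expiX _).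
apply: (@hb_intro _ (M + N)).
- by case: Ig Ih => mg _ [mh _]; exact: cmeasD.
- apply: aeD_imp (aeD_and HM HN) => t _ [h1 h2].
  by apply: le_trans (normcD _ _) _; rewrite lerD.
- move=> n; rewrite (eq_cmean (g := fun t => g t * expi t ^+ n.+1 + h t * expi t ^+ n.+1)).
    by rewrite cmeanD ?(HB_coefN _ Ha) ?(HB_coefN _ Hb) ?addr0//; exact: I2.
  by move=> t; rewrite mulrDl.
Qed.

Lemma hb_sum (T : Type) (s : seq T) (P : pred T) (F : T -> R -> R[i]) : (forall k, hb (F k)) ->
  hb (fun t => \sum_(k <- s | P k) F k t).
Proof.
move=> H; elim: s => [|k s IH].
  by under eq_fun do rewrite big_nil; exact: hb_cst.
under eq_fun do rewrite big_cons; case: (P k) => //; exact: hbD.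
Qed.

Lemma hb_prod (T : Type) (s : seq T) (P : pred T) (F : T -> R -> R[i]) : (forall k, hb (F k)) ->
  hb (fun t => \prod_(k <- s | P k) F k t).
Proof.
move=> H; elim: s => [|k s IH].
  by under eq_fun do rewrite big_nil; exact: hb_cst.
under eq_fun do rewrite big_cons; case: (P k) => //; exact: hbM.
Qed.

Lemma hb_det n (M : R -> 'M[R[i]]_n) : (forall i j, hb (fun t => M t i j)) -> hb (fun t => \det (M t)).
Proof.
move=> H; rewrite /determinant; apply: hb_sum => s.
by apply: hbM; [exact: hb_cst|apply: hb_prod].
Qed.

Lemma hb_adj n (M : R -> 'M[R[i]]_n) i j : (forall i j, hb (fun t => M t i j)) ->
  hb (fun t => (\adj (M t)) i j).
Proof.
move=> H; under eq_fun do rewrite mxE /cofactor.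
apply: hbM; [exact: hb_cst|apply: hb_det => k l].
by under eq_fun do rewrite !mxE; exact: H.
Qed.

Context {r : nat}.
Implicit Types (F : R[i] -> mx R nat 'I_r).

(** Each column of the boundary matrix has unit norm almost everywhere, so every entry has modulus
    at most 1. *)
Lemma hb_bdm F j i : inner F -> hb (fun t => bdm F (expi t) j i).
Proof.
move=> HF; have [HFs _] := HF; have [A HA] := H2s_coef HFs; have [H1 H2] := HA i.
split; first by eexists; exact: HB_bdm H1 H2.
exists 1; apply: aeD_imp (inner_orthonormal HF) => t _ HO.
have [lO eO] := HO; have := orthonormal_colsE i i HO; rewrite eqxx.
rewrite (eq_csum (y := fun j => bdm F (expi t) j i * conjc (bdm F (expi t) j i))); last by move=> k; rewrite mulrC.
rewrite csum_sqn// => /complexI E.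
have := @sqn_le_sqs R nat (fun j => bdm F (expi t) j i) j.
rewrite -(fineK (l2_fin (lO i))) lee_fin E => h.
by rewrite -(@ler_pXn2r _ 2)// ?nnegrE ?normc_ge0// sqnE expr1n.
Qed.

Lemma minor_vec_H2 F s j0 : inner F -> exists f : R[i] -> nat -> R[i], in_H2 f /\
  aeD (fun t => bdv f (expi t) = minor_vec (bdm F (expi t)) s j0).
Proof.
move=> HF; pose u t := minor_vec (bdm F (expi t)) s j0.
have Hm (i j : 'I_r) : hb (fun t => minor (bdm F (expi t)) s i j).
  by under eq_fun do rewrite mxE; exact: hb_bdm.
have Hu j : hb (fun t => u t j).
  rewrite /u /minor_vec; under eq_fun do rewrite -mulN1r.
  apply: hbD; first by apply: hbM; [exact: hb_det|exact: hb_cst].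
  apply: hbM; first exact: hb_cst.
  apply: hb_sum => l; apply: hbM; last exact: hb_cst.
  by apply: hb_sum => i; apply: hbM; [exact: hb_adj|exact: hb_bdm].
have mu' j : cmeas (fun t => u t j) by have [[a [[m _] _]] _] := Hu j.
have [||x [f [_ _ Hf _ E]]] := vec_boundary mu'; last by exists f.
- have [M HM] := choice (fun j => (Hu j).2); pose s' := undup (j0 :: codom s).
  apply: (@le_lt_trans _ _ (mE (fun=> (\sum_(j <- s') M j ^+ 2)%:E))); last by rewrite mE_cst ltry.
  apply: ae_le_mE.
  + by move=> t; exact: sqs_ge0.
  + by move=> t; rewrite lee_fin sumr_ge0// => j _; exact: sqr_ge0.
  + exact: measurable_sqs.
  + exact: measurable_cst.
  + apply: aeD_imp (aeD_forall HM) => t _ h.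
    rewrite /sqs (essum_seq (s := s')) => [|||j js]; last by rewrite /u minor_vec_supp ?sqn0.
    * rewrite lee_fin ler_sum// => j _.
      by rewrite -sqnE lerXn2r ?nnegrE ?normc_ge0// (le_trans (normc_ge0 _) (h j)).
    * exact: undup_uniq.
    * by move=> j; exact: sqn_ge0.
- by move=> j n; have [[a Ha] _] := Hu j; rewrite (HB_coefN _ Ha).
Qed.

End BoundedAnalytic.

(** * From the kernel to unitarity almost everywhere *)

Section KernelRange.
Context {R : realType} {r : nat} {I : countType}.
Variables (Y : R[i] -> mx R nat 'I_r) (T : R[i] -> mx R nat I).
Hypotheses (HY : inner Y) (HT : inner T).
Hypothesis kerY : ker_toeplitz (bdm (fun z => trm (Y z))) = range_H2 T.

Let HY2 : in_H2s Y. Proof. by case: HY. Qed.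
Let HT2 : in_H2s T. Proof. by case: HT. Qed.

(** The column T e_k is the image of a constant function, hence lies in the range of [T] and
    therefore in the kernel. *)
Lemma symbol_orth :
  aeD (fun t => forall i k, csum (fun j => bdm Y (expi t) j i * bdm T (expi t) j k) = 0).
Proof.
suff H k : aeD (fun t => forall i, csum (fun j => bdm Y (expi t) j i * bdm T (expi t) j k) = 0).
  by apply: aeD_imp (aeD_forall H) => t _ h i k.
have : range_H2 T (fun z j => T z j k).
  exists (fun=> deltav k); first exact/in_H2_cst/l2_deltav.
  by move=> z _; rewrite mulmv_deltav.
by rewrite -kerY => /(ker_toeplitz_elim HY2)[].
Qed.

(** The equality with [range_H2] is an identity on the disk; [range_boundary] carries it to the
    circle. *)
Lemma kernel_range f : in_H2 f ->
  aeD (fun t => forall i, csum (fun j => bdm Y (expi t) j i * bdv f (expi t) j) = 0) ->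
  exists h, in_H2 h /\ aeD (fun t => bdv f (expi t) = mulmv (bdm T (expi t)) (bdv h (expi t))).
Proof.
move=> Hf /(ker_toeplitz_intro HY2 Hf); rewrite kerY => -[h Hh E].
exists h; split; [exact: Hh|exact: range_boundary HT Hh Hf E].
Qed.

(** Row choices are taken as finite functions, which form a countable type, so that one null set
    serves all [s] and [j0]. *)
Lemma minor_vec_range : aeD (fun t => forall (s : {ffun 'I_r -> nat}) j0,
  exists2 y, l2 y & minor_vec (bdm Y (expi t)) s j0 = mulmv (bdm T (expi t)) y).
Proof.
suff H (s : {ffun 'I_r -> nat}) j0 : aeD (fun t =>
    exists2 y, l2 y & minor_vec (bdm Y (expi t)) s j0 = mulmv (bdm T (expi t)) y).
  by apply: aeD_forall => s; exact: aeD_forall.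
have [f [Hf Ef]] := minor_vec_H2 s j0 HY.
have [|h [Hh Eh]] := kernel_range Hf.
  by apply: aeD_imp Ef => t _ -> i; exact: minor_vec_orth.
apply: aeD_imp (aeD_and (bdv_l2 Hh) (aeD_and Ef Eh)) => t _ [lh [E1 E2]].
by exists (bdv h (expi t)); rewrite -?E1.
Qed.

Lemma unitary_ae :
  aeD (fun t => unitary_op (rowm (bdm Y (expi t)) (conjm (bdm T (expi t))))).
Proof.
have H := aeD_and (aeD_and (inner_orthonormal HY) (inner_orthonormal HT))
  (aeD_and symbol_orth minor_vec_range).
apply: aeD_imp H => t _ [[oY oT] [YT ranT]].
apply: pointwise_unitary => // s j0.
have [y ly E] := ranT [ffun i => s i] j0; exists y => //; rewrite -E; congr (minor_vec _ _ _).
by apply/funext => i; rewrite ffunE.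
Qed.

End KernelRange.

(** * Density *)

Section Projection.
Context {R : realType} {I : countType}.
Implicit Types x y : I -> R[i].

Lemma real_between (a b : nat -> R) : (forall n m, a n <= b m) -> exists s, forall n, a n <= s <= b n.
Proof.
move=> H; exists (sup (range a)) => n; apply/andP; split.
  by apply: ub_le_sup; [exists (b 0%N) => _ [m _ <-]|exists n].
by apply: ge_sup; [exists (a 0%N); exists 0%N|move=> _ [m _ <-]].
Qed.

(** Completeness with an explicit rate [d]. Coordinates of the limit are suprema, separately for
    real and imaginary parts; the factor 2 is the loss in [sqnD] when a finite partial sum passes
    from v_n through some v_m to the limit. *)
Lemma l2_complete (v : nat -> I -> R[i]) (d : nat -> R) : (forall n, 0 <= d n) ->
  (forall (e : R), 0 < e -> exists N, forall n, (N <= n)%N -> d n <= e) ->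
  (forall n m, (n <= m)%N -> (sqs (fun i => v n i - v m i)%R <= (d n ^+ 2)%:E)%E) ->
  exists w, forall n, (sqs (fun i => v n i - w i)%R <= (2 * d n ^+ 2)%:E)%E.
Proof.
move=> d0 dlim H.
have Hi n m i : normc (v n i - v m i) <= d n + d m.
  wlog nm : n m / (n <= m)%N => [h|].
    case/orP: (leq_total n m) => /h h'; first exact: h'.
    by rewrite -normcN opprB [leRHS]addrC; exact: h'.
  apply: (@le_trans _ _ (d n)); last by rewrite lerDl.
  rewrite -(@ler_pXn2r _ 2)// ?nnegrE ?normc_ge0// sqnE -lee_fin.
  exact: le_trans (@sqn_le_sqs R _ (fun i => v n i - v m i) i) (H n m nm).
have lim (P : R[i] -> R) : (forall z w, P (z - w) = P z - P w) -> (forall z, `|P z| <= normc z) ->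
    exists s : I -> R, forall n i, `|P (v n i) - s i| <= d n.
  move=> PB Pn.
  suff /choice[s Hs] : forall i, exists s, forall n, P (v n i) - d n <= s <= P (v n i) + d n.
    by exists s => n i; have /andP[h1 h2] := Hs i n; rewrite ler_norml; apply/andP; split; lra.
  move=> i; apply: real_between => n m.
  have := le_trans (Pn _) (Hi n m i); rewrite PB ler_norml => /andP[h1 h2]; lra.
have [a Ha] := lim (@complex.Re R) (fun z w => raddfB _ z w) (@Re_le R).
have [b Hb] := lim (@complex.Im R) (fun z w => raddfB _ z w) (@Im_le R).
exists (fun i => a i +i* b i) => n.
have dw m i : sqn (v m i - (a i +i* b i)) <= 2 * d m ^+ 2.
  have S (p : R) : `|p| <= d m -> p ^+ 2 <= d m ^+ 2.
    by move=> h; rewrite -real_normK ?num_real// lerXn2r ?nnegrE.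
  have := lerD (S _ (Ha m i)) (S _ (Hb m i)).
  rewrite (_ : d m ^+ 2 + d m ^+ 2 = 2 * d m ^+ 2); last by ring.
  by case: (v m i).
apply: essum_le_ub => [i|s us]; first exact: sqn_ge0.
rewrite lee_fin; apply/ler_addgt0Pr => e e0.
pose K : R := 4 * (size s)%:R; have K0 : 0 <= K by rewrite mulr_ge0.
pose q := Num.min 1 (e / (K + 1)).
have q0 : 0 < q by rewrite lt_min ltr01 divr_gt0// ltr_wpDl.
have q1 : q <= 1 by rewrite ge_min lexx.
have q2 : q * (K + 1) <= e by rewrite -ler_pdivlMr ?ltr_wpDl// ge_min lexx orbT.
have [N HN] := dlim q q0; pose m := maxn n N.
have dm : d m <= q by apply: HN; exact: leq_maxr.
have h1 : \sum_(i <- s) sqn (v n i - v m i) <= d n ^+ 2.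
  rewrite -lee_fin; apply: le_trans (H n m (leq_maxl _ _)).
  by apply: (sum_le_essum (p := fun i => sqn (v n i - v m i))) => // i; exact: sqn_ge0.
have h2 : \sum_(i <- s) sqn (v m i - (a i +i* b i)) <= (size s)%:R * (2 * d m ^+ 2).
  apply: le_trans (ler_sum _ (fun i _ => dw m i)) _.
  by rewrite big_const_seq count_predT iter_addr_0 [leRHS]mulr_natl.
have h3 : \sum_(i <- s) sqn (v n i - (a i +i* b i)) <=
    2 * \sum_(i <- s) sqn (v n i - v m i) + 2 * \sum_(i <- s) sqn (v m i - (a i +i* b i)).
  rewrite !mulr_sumr -big_split; apply: ler_sum => i _ /=.
  by apply: le_trans (sqnD _ _); rewrite addrA subrK.
have h4 : d m ^+ 2 <= q.
  by rewrite expr2 -[leRHS]mulr1; apply: ler_pM => //; exact: le_trans dm q1.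
have h5 : 2 * ((size s)%:R * (2 * d m ^+ 2)) <= K * q.
  rewrite (_ : 2 * _ = K * d m ^+ 2); last by rewrite /K; ring.
  exact: ler_wpM2l.
have E : q * (K + 1) = K * q + q by ring.
rewrite E in q2; lra.
Qed.

Variable V : (I -> R[i]) -> Prop.
Hypotheses (V0 : exists v, V v) (Vl2 : forall v, V v -> l2 v).
Hypothesis Vlin : forall a b v w, V v -> V w -> V (fun i => a * v i + b * w i).
Hypothesis Vorth : forall x, l2 x -> (forall v, V v -> csum (fun i => v i * conjc (x i)) = 0) ->
  forall i, x i = 0.

Let N x := fine (sqs x).

Let N_ge0 x : 0 <= N x. Proof. by rewrite fine_ge0// sqs_ge0. Qed.

Let NE x : l2 x -> sqs x = (N x)%:E. Proof. by move=> lx; rewrite fineK// l2_fin. Qed.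

Lemma l2B x y : l2 x -> l2 y -> l2 (fun i => x i - y i).
Proof. by move=> lx ly; apply: l2D => //; rewrite l2N. Qed.

Lemma parallelogram x y : l2 x -> l2 y ->
  N (fun i => x i - y i) = 2 * N x + 2 * N y - N (fun i => x i + y i).
Proof.
move=> lx ly; apply/eqP; rewrite -subr_eq0 opprB addrA subr_eq0 -eqe EFinD; apply/eqP.
rewrite -!NE; [|exact: l2D|exact: l2B].
rewrite [RHS]EFinD !EFinM -!NE// /sqs -!essumZ//; try by move=> i; exact: sqn_ge0.
rewrite -!essumD; try by move=> i; rewrite ?mulr_ge0 ?sqn_ge0.
by apply: eq_essum => i; rewrite /sqn; case: (x i) (y i) => a b [c d] /=; ring.
Qed.

(** Displacing x along w by a multiple of conj(p) lowers the squared norm at first order in tau, by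
    2 tau |p|^2; a nearly minimal distance therefore forces p to be small. *)
Lemma normB_dot x w : l2 x -> l2 w -> forall tau : R, let p := csum (fun i => w i * conjc (x i)) in
  N (fun i => x i - (tau%:C * conjc p) * w i) = N x - 2 * tau * sqn p + tau ^+ 2 * sqn p * N w.
Proof.
move=> lx lw tau p.
have lz : l2 (fun i => x i - (tau%:C * conjc p) * w i) by apply: l2B => //; exact: l2Z.
apply: complexI; rewrite -csum_sqn//.
have [axx aww awx] : [/\ asum (fun i => x i * conjc (x i)), asum (fun i => w i * conjc (w i)) &
    asum (fun i => w i * conjc (x i))] by split; apply: l2M; rewrite ?l2J.
have axw : asum (fun i => conjc (w i * conjc (x i))) by rewrite asumJ.
rewrite (eq_csum (y := fun i => (x i * conjc (x i) - (tau%:C * conjc p) * (w i * conjc (x i))) -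
   ((tau%:C * p) * conjc (w i * conjc (x i)) - (tau ^+ 2 * sqn p)%:C * (w i * conjc (w i))))); last first.
  move=> i; rewrite !(conjB, conjM) !conjcK -[conjc tau%:C]/(tau -i* 0)%C oppr0.
  rewrite -[tau +i* 0]/(tau%:C) (_ : (tau ^+ 2 * sqn p)%:C = tau%:C ^+ 2 * (p * conjc p)); last first.
    by rewrite mulJc rmorphM rmorphXn.
  by ring.
have aB (x1 x2 : I -> R[i]) : asum x1 -> asum x2 -> asum (fun i => x1 i - x2 i).
  by move=> a1 a2; apply: asumD => //; rewrite asumN.
have a1 := asumZ (tau%:C * conjc p) awx.
have a2 := asumZ (tau%:C * p) axw.
have a3 := asumZ (tau ^+ 2 * sqn p)%:C aww.
rewrite (csumB (aB _ _ axx a1) (aB _ _ a2 a3)) (csumB axx a1) (csumB a2 a3).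
rewrite (csumZ _ awx) (csumZ _ axw) (csumZ _ aww) csumJ !csum_sqn// -/p.
rewrite (_ : tau%:C * conjc p * p = (tau * sqn p)%:C); last by rewrite -mulrA [_ * p]mulrC mulJc rmorphM.
rewrite (_ : tau%:C * p * conjc p = (tau * sqn p)%:C); last by rewrite -mulrA mulJc rmorphM.
rewrite -!rmorphM -!rmorphB; congr (_%:C); rewrite -/(N x) -/(N w); ring.
Qed.

(* A minimizing sequence for the distance from [g] to [V] is Cauchy by the parallelogram law. *)
Lemma dense_of_orth g (e : R) : l2 g -> 0 < e -> exists2 v, V v & (sqs (fun i => v i - g i)%R <= e%:E)%E.
Proof.
move=> lg e0; have [v00 Vv00] := V0.
pose S := [set N (fun i => g i - v i) | v in [set v | V v]].
have S0 : has_inf S.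
  by split; [exists (N (fun i => g i - v00 i)); exists v00|exists 0 => _ [v _ <-]].
(* With errors 4^-n, the parallelogram law bounds the squared distance from v_n to v_m by 4 q_n, the
   square of 2^(1-n): a geometric rate. *)
pose d := inf S; pose q n : R := 4^-1 ^+ n.
have q0 n : 0 < q n by rewrite exprn_gt0// invr_gt0.
have dle v : V v -> d <= N (fun i => g i - v i).
  by move=> Vv; apply: ge_inf; [case: S0|exists v].
have /choice[v Hv] : forall n, exists v, V v /\ N (fun i => g i - v i) <= d + q n.
  by move=> n; have [_ [v Vv <-] /ltW h] := inf_adherent (q0 n) S0; exists v.
have lgv n : l2 (fun i => g i - v n i) by apply: l2B => //; apply: Vl2; case: (Hv n).
have vc n m : (n <= m)%N -> (sqs (fun i => v n i - v m i)%R <= ((2 * 2^-1 ^+ n) ^+ 2)%:E)%E.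
  move=> nm; have [Vn hn] := Hv n; have [Vm hm] := Hv m.
  have lnm : l2 (fun i => v n i - v m i) by apply: l2B; exact: Vl2.
  have := parallelogram (lgv m) (lgv n).
  rewrite (_ : (fun i => _ - _) = (fun i => v n i - v m i)); last by apply/funext => i; ring.
  (* This sum is twice the difference between g and the midpoint of v_m and v_n, which lies in [V],
     so that [d] bounds its norm from below. *)
  have -> : N (fun i => g i - v m i + (g i - v n i)) =
      4 * N (fun i => g i - (2^-1)%:C * (v m i + v n i)).
    have lx : l2 (fun i => g i - (2^-1)%:C * (v m i + v n i)).
      by apply: l2B => //; apply: l2Z; apply: l2D; exact: Vl2.
    have := sqsZ 2%:R%:C (fun i => g i - (2^-1)%:C * (v m i + v n i)).
    rewrite (_ : sqn _ = 4); last by rewrite /sqn /= expr0n addr0 -natrX.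
    rewrite (NE lx) => h; rewrite /N -[RHS]/(fine (4 * N _)%:E) EFinM -h; congr fine.
    apply: eq_sqs => i; rewrite mulrBr mulrA Cinv ?pnatr_eq0// mul1r.
    by rewrite (rmorph_nat (real_complex R) 2); ring.
  have : d <= N (fun i => g i - (2^-1)%:C * (v m i + v n i)).
    apply: dle; rewrite (_ : (fun i => _) = (fun i => ((2^-1)%:C * v m i) + (2^-1)%:C * v n i)).
      exact: Vlin.
    by apply/funext => i; rewrite mulrDr.
  rewrite (NE lnm) lee_fin exprMn -exprM mulnC exprM.
  rewrite (_ : 2^-1 ^+ 2 = 4^-1); last by rewrite exprVn -natrX.
  have : q m <= q n by rewrite /q ler_wiXn2l// ?invr_ge0// invf_le1// ler1n.
  rewrite -/(q n) (_ : 2 ^+ 2 = 4 :> R) -?natrX//; lra.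
have i0 : 0 <= 2^-1 :> R by rewrite invr_ge0.
have i1 : 2^-1 < 1 :> R by rewrite invf_lt1// ltr1n.
have t0 n : 0 <= 2 * 2^-1 ^+ n :> R by rewrite mulr_ge0// exprn_ge0.
have [w Hw'] := l2_complete t0 (fun e e0 => geom_small i0 i1 (ler0n R 2) e0) vc.
have Hw n : (sqs (fun i => v n i - w i)%R <= (8 * q n)%:E)%E.
  apply: le_trans (Hw' n) _; rewrite lee_fin exprMn -exprM mulnC exprM.
  rewrite (_ : 2^-1 ^+ 2 = 4^-1); last by rewrite exprVn -natrX.
  by rewrite -/(q n) mulrA -natrX -natrM.
have lvw n : l2 (fun i => v n i - w i) by apply: le_lt_trans (Hw n) (ltry _).
pose x i := g i - w i.
have xE n i : x i = (g i - v n i) + (v n i - w i) by rewrite addrA subrK.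
have lx : l2 x by under [x]funext do rewrite (xE 0%N); exact: l2D.
have qlim (C : R) : 0 <= C -> forall e, 0 < e -> exists n, C * q n <= e.
  move=> C0 e' e'0; have j0 : 0 <= 4^-1 :> R by rewrite invr_ge0.
  have j1 : 4^-1 < 1 :> R by rewrite invf_lt1// ltr1n.
  by have [n Hn] := geom_small j0 j1 C0 e'0; exists n; exact: Hn.
have x0 : forall i, x i = 0.
  apply: Vorth => // u Vu; have lu := Vl2 Vu; apply: sqn_eq0; set p := csum _.
  (* For every n the pairing splits as p1 + p2: near-minimality of v_n controls p1 and convergence
     of v_n to [w] controls p2, so p = 0. *)
  pose p1 n := csum (fun i => u i * conjc (g i - v n i)).
  pose p2 n := csum (fun i => u i * conjc (v n i - w i)).
  have pE n : p = p1 n + p2 n.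
    rewrite -csumD; [|by apply: l2M => //; rewrite l2J..].
    by apply: eq_csum => i; rewrite -mulrDr -conjD -xE.
  have W0 := N_ge0 u; have W1 : 0 < N u + 1 by rewrite ltr_wpDl.
  (* Moving v_n along u inside [V] cannot bring the squared distance below [d], and v_n is within
     q_n of it; tau = 1 / (N u + 1) avoids a division by 0. *)
  have h1 n : sqn (p1 n) <= (N u + 1) * q n.
    have [Vn hn] := Hv n; pose tau := (N u + 1)^-1.
    have := normB_dot (lgv n) lu tau; rewrite -/(p1 n) => h.
    have Vd : V (fun i => 1 * v n i + (tau%:C * conjc (p1 n)) * u i) by exact: Vlin.
    have := dle _ Vd; rewrite (_ : (fun i => g i - _) =
      (fun i => g i - v n i - (tau%:C * conjc (p1 n)) * u i)); last first.
      by apply/funext => i; rewrite mul1r opprD addrA.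
    rewrite h => h2; have s0 := sqn_ge0 (p1 n).
    have h3 : 2 * tau * sqn (p1 n) - tau ^+ 2 * sqn (p1 n) * N u <= q n by lra.
    have tE : tau * (N u + 1) = 1 by rewrite /tau mulVf// gt_eqF.
    have t0' : 0 < tau by rewrite invr_gt0.
    have : tau ^+ 2 * sqn (p1 n) * N u <= tau * sqn (p1 n).
      rewrite (_ : tau ^+ 2 * sqn (p1 n) * N u = tau * sqn (p1 n) * (tau * N u)); last by ring.
      rewrite -[leRHS]mulr1; apply: ler_wpM2l; first by rewrite mulr_ge0// ltW.
      by rewrite -tE ler_pM2l// lerDl.
    move=> h4; have h5 : tau * sqn (p1 n) <= q n by lra.
    by rewrite mulrC -ler_pdivrMr// mulrC.
  have h2 n : sqn (p2 n) <= N u * (8 * q n).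
    have lc : l2 (fun i => conjc (v n i - w i)) by rewrite l2J.
    apply: le_trans (cauchy_schwarz lu lc) _; apply: ler_wpM2l => //.
    rewrite -lee_fin fineK ?l2_fin//; apply: le_trans (Hw n).
    by rewrite /sqs (eq_essum (n := fun i => sqn (v n i - w i))) => [//|i]; rewrite sqnJ.
  apply/eqP; rewrite eq_le sqn_ge0 andbT; apply/ler_addgt0Pr => e' e'0; rewrite add0r.
  have [|n Hn] := qlim (2 * (N u + 1) + 16 * N u) _ e' e'0.
    by rewrite addr_ge0// mulr_ge0// ltW.
  apply: le_trans Hn; rewrite (pE n); apply: le_trans (sqnD _ _) _.
  have := h1 n; have := h2 n; move: (sqn (p1 n)) (sqn (p2 n)) (q n) (N u) => a b c k.
  rewrite (_ : k * (8 * c) = 8 * (k * c)); last by ring.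
  rewrite (_ : (k + 1) * c = k * c + c); last by ring.
  rewrite (_ : (2 * (k + 1) + 16 * k) * c = 18 * (k * c) + 2 * c); last by ring.
  by lra.
have [n Hn] := qlim 8 (ler0n _ _) e e0.
exists (v n); first by case: (Hv n).
apply: le_trans (_ : (8 * q n)%:E <= _)%E; last by rewrite lee_fin.
apply: le_trans (Hw n); rewrite le_eqVlt; apply/orP; left; apply/eqP; apply: eq_sqs => i.
by congr (_ - _); apply/eqP; rewrite -subr_eq0; apply/eqP; exact: x0.
Qed.

End Projection.

(** * Pairings, shifts and vector polynomials *)

Section Pairing.
Context {R : realType}.

Lemma rsum_pair (J K : choiceType) (y : J -> K -> R) : fsum (fun p : J * K => y p.1 p.2) ->
  rsum (fun p : J * K => y p.1 p.2) = rsum (fun j => rsum (y j)).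
Proof.
move=> fy; rewrite rsum_iterated; last first.
  by move: fy; rewrite /fsum (essum_pair (p := fun j k => `|y j k|)).
by rewrite -(essum_pair (p := fun j => pos (y j))) -?(essum_pair (p := fun j => neg (y j)))// => j k;
  rewrite ?pos_ge0 ?neg_ge0.
Qed.

Lemma csum_pair (J K : choiceType) (y : J -> K -> R[i]) : asum (fun p : J * K => y p.1 p.2) ->
  csum (fun p : J * K => y p.1 p.2) = csum (fun k => csum (fun j => y j k)).
Proof.
move=> ay; rewrite -csum_exchange; last first.
  rewrite -(essum_pair (p := fun j k => normc (y j k))); last by move=> *; exact: normc_ge0.
  by move: ay; rewrite /asum fsum_pos// => p; exact: normc_ge0.
apply: complexP; rewrite ?Re_csum ?Im_csum.
  exact: rsum_pair (asum_Re ay).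
exact: rsum_pair (asum_Im ay).
Qed.

(** Parseval for two functions. [has_psum] at the point 1 serves as the notion of a convergent
    series, so that uniqueness of limits applies. *)
Lemma HB_pairing a b (g h : R -> R[i]) : HB a g -> HB b h ->
  cmean (fun t => g t * conjc (h t)) = csum (fun k => a k * conjc (b k)).
Proof.
move=> Hg Hh; have [Ih _] := Hh; have la := HB_l2 Hg; have lb := HB_l2 Hh.
apply: (psum_unique (a := fun k => a k * conjc (b k)) (z := 1)).
  move=> e e0; have [N HN] := HB_mean Hg (cint2J Ih) e0; exists N => n /HN.
  congr (normc (_ - _) <= _); apply: eq_bigr => k _; rewrite expr1n mulr1; congr (_ * _).
  rewrite -(HB_coef k Hh) -cmeanJ; last exact: cint2M Ih (cint2J (cint2_expiX k)).
  by apply: eq_cmean => t; rewrite conjM conjcK mulrC.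
have -> : csum (fun k => a k * conjc (b k)) = csum (fun k => a k * conjc (b k) * 1 ^+ k).
  by apply: eq_csum => k; rewrite expr1n mulr1.
apply: csum_psum; under [X in asum X]funext do rewrite expr1n mulr1.
by apply: l2M => //; rewrite l2J.
Qed.

Definition shift (T : Type) (z : T) n (a : nat -> T) m := if (n <= m)%N then a (m - n)%N else z.

Lemma HB_shift n a (g : R -> R[i]) : HB a g -> HB (shift 0 n a) (fun t => expi t ^+ n * g t).
Proof.
move=> Hg; have [[mg fg] _] := Hg.
have H : HB (fun m => cmean (fun t => expi t ^+ n * g t * conjc (expi t ^+ m)))
    (fun t => expi t ^+ n * g t).
  apply: HB_of_coef.
    split; first by apply: cmeasM => //; exact: cmeas_expiX.
    by rewrite /m2; under eq_mE do rewrite sqnM sqn_expiX mul1r.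
  move=> m; rewrite -(HB_coefN (n + m) Hg); apply: eq_cmean => t.
  by rewrite mulrAC -exprD mulrC addnS.
have E : (fun m => cmean (fun t => expi t ^+ n * g t * conjc (expi t ^+ m))) = shift 0 n a.
  apply/funext => m; rewrite /shift -(cmean_expiM _ _ Hg); apply: eq_cmean => t; by rewrite mulrA.
by rewrite -E.
Qed.

Lemma psum_shift n a (z w : R[i]) : has_psum a z w -> has_psum (shift 0 n a) z (z ^+ n * w).
Proof.
move=> H e e0; have Z : 0 < normc (z ^+ n) + 1 by rewrite ltr_wpDl// normc_ge0.
have [N HN] := H _ (divr_gt0 e0 Z); exists (n + N)%N => m nm.
have [p mE] : exists p, m = (n + p)%N by exists (m - n)%N; rewrite subnKC// (leq_trans _ nm)// leq_addr.
rewrite {m}mE in nm *; rewrite leq_add2l in nm.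
rewrite big_split_ord /= big1 => [|k _]; last by rewrite /shift leqNgt ltn_ord mul0r.
rewrite add0r (eq_bigr (fun k : 'I_p => z ^+ n * (a k * z ^+ k))); last first.
  by move=> k _; rewrite /shift leq_addr addnC addnK exprD; ring.
rewrite -mulr_sumr -mulrBr normcM; apply: le_trans (ler_wpM2l (normc_ge0 _) (HN p nm)) _.
by rewrite mulrA ler_pdivrMr// mulrC ler_pM2l// lerDl.
Qed.

Lemma vanalytic_shift (I : countType) n (a : nat -> I -> R[i]) f : vanalytic a f ->
  vanalytic (fun m i => shift 0 n (fun k => a k i) m) (fun z i => z ^+ n * f z i).
Proof. by move=> Hf i z z1; apply: psum_shift; exact: Hf. Qed.

Lemma vanalyticL (I : countType) (c d : R[i]) (a b : nat -> I -> R[i]) f g : vanalytic a f -> vanalytic b g ->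
  vanalytic (fun k i => c * a k i + d * b k i) (fun z i => c * f z i + d * g z i).
Proof.
move=> Hf Hg i z z1; have af := da_asum (Hf i) z1; have ag := da_asum (Hg i) z1.
have E k : (c * a k i + d * b k i) * z ^+ k = c * (a k i * z ^+ k) + d * (b k i * z ^+ k) by ring.
have -> : c * f z i + d * g z i = csum (fun k => (c * a k i + d * b k i) * z ^+ k).
  rewrite (eq_csum E) csumD ?csumZ//; try exact: asumZ.
  by rewrite -(da_csum (Hf i) z1) -(da_csum (Hg i) z1).
apply: csum_psum; under [X in asum X]funext do rewrite E.
by apply: asumD; exact: asumZ.
Qed.

Lemma l2_disk (I : countType) (f : R[i] -> I -> R[i]) z : analyticv f -> disk z -> l2 (f z).
Proof.
move=> [a [la H]] z1.
have [|N HN] := (ecvg0P _).1 (H z z1) 1 ltr01; first by move=> n; exact: sqrte_ge0.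
have := HN N (leqnn N); rewrite l2norm_le// => h.
have -> : f z = fun i => (f z i - \sum_(k < N) z ^+ k * a k i) + \sum_(k < N) z ^+ k * a k i.
  by apply/funext => i; rewrite subrK.
apply: l2D; first by apply: le_lt_trans h (ltry _).
by apply: l2_sum => k; apply: l2Z; apply/in_l2P.
Qed.

Lemma vec_polyL (I : choiceType) (c d : R[i]) (p q : R[i] -> I -> R[i]) : vec_poly p -> vec_poly q ->
  vec_poly (fun z i => c * p z i + d * q z i).
Proof.
move=> [n [a [la ->]]] [m [b [lb ->]]].
(* Padding with zero coefficients brings both polynomials to the common length n + m. *)
pose cut n (a : nat -> I -> R[i]) k i := if (k < n)%N then a k i else 0.
have lcut l x k : (forall k, in_l2 (x k)) -> l2 (cut l x k).
  move=> lx; rewrite /cut; case: (k < l)%N; first exact/in_l2P.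
  exact: (l2_seq (s := [::])).
have cutE l (x : nat -> I -> R[i]) N (z : R[i]) i : (l <= N)%N ->
    \sum_(k < l) z ^+ k * x k i = \sum_(k < N) z ^+ k * cut l x k i.
  move=> lN; rewrite (big_ord_widen N (fun k => z ^+ k * x k i) lN) big_mkcond; apply: eq_bigr => k _.
  by rewrite /cut; case: ifP; rewrite ?mulr0.
exists (n + m)%N, (fun k i => c * cut n a k i + d * cut m b k i); split.
  by move=> k; apply/in_l2P; apply: l2D; apply: l2Z; exact: lcut.
apply/funext => z; apply/funext => i.
rewrite (cutE n a (n + m)%N)// ?leq_addr// (cutE m b (n + m)%N)// ?leq_addl//.
rewrite !mulr_sumr -big_split; apply: eq_bigr => k _ /=; ring.
Qed.

Lemma vec_poly_monomial (I : choiceType) n (x : I -> R[i]) : l2 x -> vec_poly (fun z i => z ^+ n * x i).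
Proof.
move=> lx; exists n.+1, (fun k i => if k == n then x i else 0); split.
  by move=> k; apply/in_l2P; case: (k == n) => //; exact: (l2_seq (s := [::])).
apply/funext => z; apply/funext => i; rewrite big_ord_recr /= eqxx big1 ?add0r// => k _.
by rewrite ltn_eqF ?mulr0.
Qed.

Lemma vec_poly_l2 (I : choiceType) (q : R[i] -> I -> R[i]) z : vec_poly q -> l2 (q z).
Proof. by move=> [n [a [la ->]]]; apply: l2_sum => k; apply: l2Z; apply/in_l2P. Qed.

End Pairing.

(** * Co-outerness *)

Section CoOuter.
Context {R : realType} {r : nat} {I : countType}.
Variables (Y : R[i] -> mx R nat 'I_r) (T : R[i] -> mx R nat I).
Hypotheses (HY : inner Y) (HT : inner T).
Hypothesis kerY : ker_toeplitz (bdm (fun z => trm (Y z))) = range_H2 T.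

Let HT2 : in_H2s T. Proof. by case: HT. Qed.

(* If [f], with coefficients [x], is orthogonal to all [z^n T^t e_j], then the conjugate of [zeta f]
   is mapped by [T] into the kernel [T H^2], so that it is itself the boundary value of some [h]
   in [H^2]; being orthogonal to [f], [h] forces [f = 0]. *)
Lemma orth_coefs_eq0 (x : nat -> I -> R[i]) (c : nat -> nat -> I -> R[i]) :
  (h2sq x < +oo)%E ->
  (forall j, (h2sq (c j) < +oo)%E /\
    forall k, HB (fun m => c j m k) (fun t => bdm T (expi t) j k)) ->
  (forall n j, csum (fun p : nat * I => shift 0 n (fun m => c j m p.2) p.1 * conjc (x p.1 p.2)) = 0) ->
  forall n k, x n k = 0.
Proof.
move=> fx Hc Ho.
pose f z k := csum (fun n => x n k * z ^+ n).
have Hf : vanalytic x f by move=> k; apply: danalytic_csum; exact: h2sq_l2_row.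
have Hb k : HB (fun n => x n k) (fun t => bdv f (expi t) k) := HB_bdv k Hf fx.
have mb k : cmeas (fun t => bdv f (expi t) k) by case: (Hb k) => -[].
have mT j k : cmeas (fun t => bdm T (expi t) j k) by exact: cmeas_bdm.
pose s t k := conjc (bdv f (expi t) k).
have ms k : cmeas (fun t => s t k) := cmeasJ (mb k).
have sqs_s t : sqs (s t) = sqs (bdv f (expi t)) by apply: eq_essum => k; rewrite sqnJ.
have fs : (\esum_(k in [set: I]) m2 (fun t => s t k) < +oo)%E.
  rewrite (_ : esum _ _ = h2sq x)// (h2sq_m2 Hb); apply: eq_esum => k _.
  by apply: eq_mE => t; rewrite sqnJ.
pose phi t j := mulmv (bdm T (expi t)) (s t) j.
(* The orthogonality hypothesis at z^n T^t e_j is the mean of [phi] against zeta^n; since n = 0 is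
   included, no frequency <= 0 is left in [phi]. *)
have Hphi n j : cint1 (fun t => phi t j) /\ cmean (fun t => phi t j * expi t ^+ n) = 0.
  have fT : (\esum_(k in [set: I]) m2 (fun t => bdm T (expi t) j k) < +oo)%E.
    by rewrite -(h2sq_m2 (Hc j).2); case: (Hc j).
  have [I1 E] := dot_mul (mT j) ms fT fs (cmeas_expiX n) (fun t => normc_expiX t n).
  split=> //; rewrite [LHS]E -(Ho n j).
  rewrite (csum_pair (y := fun m k => shift 0 n (fun m => c j m k) m * conjc (x m k))); last first.
    apply: l2M; last by rewrite l2J.
    have Hs k := HB_shift n ((Hc j).2 k).
    have := mE_sqs Hs; rewrite /h2sq /l2 /= => <-.
    rewrite (eq_mE (q := fun t => sqs (bdm T (expi t) j))).
      by rewrite (mE_sqs (Hc j).2); case: (Hc j).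
    by move=> t; apply: eq_essum => k; rewrite sqnM sqn_expiX mul1r.
  apply: eq_csum => k; rewrite -(HB_pairing (HB_shift n ((Hc j).2 k)) (Hb k)).
  by apply: eq_cmean => t; rewrite -/(s t k); ring.
have mphi j : cmeas (fun t => phi t j) by have [[]] := Hphi 0%N j.
pose y t k := conjc (expi t) * s t k.
(* Multiplication by conj(zeta) lowers frequencies by one: those of [phi] start at 1, so those of
   [u] start at 0, as [vec_boundary] requires. *)
pose u t j := conjc (expi t) * phi t j.
have ls : aeD (fun t => l2 (s t)).
  by apply: aeD_imp (aeD_l2 Hb fx) => t _; rewrite /l2 sqs_s.
have ly : aeD (fun t => l2 (y t)) by apply: aeD_imp ls => t _; exact: l2Z.
have e1 (t : R) : expi t * conjc (expi t) = 1 by have := expiXJ t 1.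
have sqe (t : R) : sqn (conjc (expi t)) = 1 by rewrite sqnJ; have := sqn_expiX t 1.
have uE : aeD (fun t => u t = mulmv (bdm T (expi t)) (y t)).
  apply: aeD_imp (aeD_and ls (inner_orthonormal HT)) => t _ [lst [lT eT]].
  by apply/funext => j; rewrite /u -mulmvZ//; exact: opb_row (isometry_opb lT eT) _.
have mu' j : cmeas (fun t => u t j).
  by apply: cmeasM => //; apply: cmeasJ; exact: (cmeas_expiX 1).
have [||w [F [_ _ HF _ EF]]] := vec_boundary mu'.
- apply: (@le_lt_trans _ _ (mE (fun t => sqs (s t)))).
    apply: ae_le_mE.
    + by move=> t; exact: sqs_ge0.
    + by move=> t; exact: sqs_ge0.
    + exact: measurable_sqs.
    + exact: measurable_sqs.
    + apply: aeD_imp (aeD_and ls (inner_orthonormal HT)) => t _ [lst [lT eT]].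
      rewrite (_ : sqs (u t) = sqs (phi t)); last by apply: eq_essum => j; rewrite sqnM sqe mul1r.
      by apply: le_trans (opb_le (isometry_opb lT eT) lst) _; rewrite expr1n mul1e.
  by rewrite (eq_mE sqs_s) (mE_sqs Hb).
- move=> j n; rewrite -(Hphi n j).2; apply: eq_cmean => t.
  by rewrite /u exprS mulrACA [conjc _ * _]mulrC e1 mul1r.
have [|h [Hh Eh]] := kernel_range HY HT kerY HF.
  have H := aeD_and (aeD_and ly EF) (aeD_and uE (aeD_and (inner_orthonormal HY)
    (aeD_and (inner_orthonormal HT) (symbol_orth HY kerY)))).
  apply: aeD_imp H => t _ [[lyt ->] [-> [oY [oT YT]]]] i.
  exact: orth_range.
have [b' Hb' fb'] := in_H2_coef Hh.
(* The function [u] equals both T y and T h on the circle; applying the adjoint of the isometry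
   gives y = h. *)
have yE : aeD (fun t => y t = bdv h (expi t)).
  have H := aeD_and (aeD_and ly (bdv_l2 Hh)) (aeD_and (aeD_and EF uE)
    (aeD_and Eh (inner_orthonormal HT))).
  apply: aeD_imp H => t _ [[lyt lht] [[E1 E2] [E3 [lT eT]]]].
  by rewrite -(isometry_adj lT eT lyt) -(isometry_adj lT eT lht) -E2 -E1 -E3.
(* The n-th coefficient of f is the conjugate of the mean of h zeta^(n+1), because conj(f) = zeta h;
   that mean vanishes as h has no negative frequencies. *)
move=> n k; rewrite -(HB_coef n (Hb k)).
have HBh := HB_bdv k Hb' fb'; have [Ih _] := HBh.
rewrite -[RHS]conjc0 -(HB_coefN n HBh) -cmeanJ; last exact: cint2M Ih (cint2_expiX _).
apply: ae_eq_cmean.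
- by apply: cmeasM => //; apply: cmeasJ; exact: cmeas_expiX.
- by apply: cmeasJ; apply: cmeasM; [exact: cmeas_bdv|exact: cmeas_expiX].
- apply: aeD_imp yE => t _ Et; rewrite -Et /y /s !conjM !conjcK exprS conjM.
  by rewrite -[LHS]mul1r -(e1 t); ring.
Qed.

(** The H^2 norm is the l^2 norm of the coefficients, so density is decided by [dense_of_orth] in
    l^2 of pairs; [orth_coefs_eq0] says that only 0 is orthogonal to the coefficients of all z^n T^t
    e_j. *)
Lemma co_outer_kernel : co_outer T.
Proof.
have [anT _] := HT2; split.
  split=> [|x /in_l2P lx]; first exact: analyticm_trm.
  by have [c [Hc fc _]] := inner_tr_H2 HT lx; exact: in_H2_intro Hc fc.
move=> g Hg e e0; have [b Hb fb] := in_H2_coef Hg.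
have /choice[c Hc] := fun j => inner_tr_H2 HT (@l2_deltav R nat j).
have cT j k : HB (fun m => c j m k) (fun t => bdm T (expi t) j k).
  by have [_ _ H] := Hc j; have := H k; congr HB; apply/funext => t; rewrite mulmv_deltav.
pose Tq (q : R[i] -> nat -> R[i]) z := mulmv (trm (T z)) (q z).
(* [V] consists of the coefficient families of the functions T^t q; recording analyticity on the
   disk spares an explicit formula for them. *)
pose V (v : nat * I -> R[i]) := l2 v /\
  exists2 q, vec_poly q & vanalytic (fun n k => v (n, k)) (Tq q).
have Vmem n j : V (fun p => shift 0 n (fun m => c j m p.2) p.1).
  split.
    have Hs k := HB_shift n (cT j k).
    have := mE_sqs Hs; rewrite /h2sq /l2 /= => <-.
    rewrite (eq_mE (q := fun t => sqs (bdm T (expi t) j))).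
      by rewrite (mE_sqs (cT j)); case: (Hc j).
    by move=> t; apply: eq_essum => k; rewrite sqnM sqn_expiX mul1r.
  exists (fun z i => z ^+ n * deltav j i); first by apply: vec_poly_monomial; exact: l2_deltav.
  have [H _ _] := Hc j; have := vanalytic_shift n H; congr vanalytic.
  apply/funext => z; apply/funext => k; rewrite mulmv_deltav /Tq.
  rewrite (mulmv_fin _ _ (s := [:: j]) isT) => [|i /deltav_supp ->]; last by rewrite mulr0.
  by rewrite big_seq1 /deltav eqxx mulr1 mulrC.
have Vlin d d' v w : V v -> V w -> V (fun p => d * v p + d' * w p).
  move=> [lv [p Hp Ap]] [lw [q Hq Aq]]; split; first by apply: l2D; exact: l2Z.
  exists (fun z i => d * p z i + d' * q z i); first exact: vec_polyL.
  move=> k z z1; have lT : l2 (fun j => T z j k) by exact: l2_disk (H2s_col k HT2).1 z1.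
  have lp : l2 (p z) by exact: vec_poly_l2.
  have lq : l2 (q z) by exact: vec_poly_l2.
  rewrite /Tq mulmvD ?mulmvZ//; try exact: l2Z.
  exact: (vanalyticL d d' Ap Aq).
have Vorth x : l2 x -> (forall v, V v -> csum (fun p => v p * conjc (x p)) = 0) -> forall p, x p = 0.
  move=> lx H [n k].
  apply: (@orth_coefs_eq0 (fun n k => x (n, k)) c) => [|j|{}n j].
  - by move: lx; rewrite /l2 (eq_sqs (y := fun p => x (p.1, p.2)))// => -[].
  - by split=> //; case: (Hc j).
  - rewrite -[RHS](H _ (Vmem n j)); apply: eq_csum => -[m l] //.
(* The bound of [dense_of_orth] is on a squared norm, and halving [e] yields the strict inequality
   of [outer]. *)
have e2 : 0 < (e / 2) ^+ 2 by rewrite exprn_gt0// divr_gt0.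
have [|v [_ [q Hq Aq]] Hv] := dense_of_orth _ (fun v (Vv : V v) => Vv.1) Vlin Vorth fb e2.
  by exists (fun p => shift 0 0%N (fun m => c 0%N m p.2) p.1).
exists q => //; have A := vanalyticL 1 (-1) Aq Hb.
have -> : (fun z k => mulmv (trm (T z)) (q z) k - g z k) = (fun z k => 1 * Tq q z k + -1 * g z k).
  by apply/funext => z; apply/funext => k; rewrite mul1r mulN1r.
rewrite (h2normE A) /h2sq -l2norm_sqs; apply: (@le_lt_trans _ _ (e / 2)%:E); last first.
  by rewrite lte_fin ltr_pdivrMr// ltr_pMr// ltr1n.
rewrite l2norm_le ?divr_ge0 ?(ltW e0)//; apply: le_trans Hv.
rewrite le_eqVlt; apply/orP; left; apply/eqP; apply: eq_sqs => -[n k] /=.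
by rewrite mul1r mulN1r.
Qed.

End CoOuter.

Theorem theorem3p1 (R : realType) (r : nat) (hr : (0 < r)%N)
    (Upsilon : R[i] -> mx R nat 'I_r)
    (hUpsilon : in_Hinf Upsilon) (hUpsilon_inner : inner Upsilon)
    (K : hdim) (hK : K = InfDim \/ exists m : nat, (0 < m)%N /\ K = FinDim m)
    (Theta : R[i] -> mx R nat (idx K)) (hTheta_inner : inner Theta)
    (hL : ker_toeplitz (bdm (fun z => trm (Upsilon z))) = range_H2 Theta) :
  co_outer Theta /\
  ae_circle (fun zeta =>
    unitary_op (rowm (bdm Upsilon zeta) (conjm (bdm Theta zeta)))).
Proof.
(* [idx K] is only a choice type; the case analysis exposes ['I_m] or [nat], whose countability is
   needed for termwise integration and for countable intersections of full sets. *)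
case: K hK Theta hTheta_inner hL => [m|] _ T HT kerY; split.
- exact: (co_outer_kernel (I := 'I_m) hUpsilon_inner HT kerY).
- exact: (unitary_ae (I := 'I_m) hUpsilon_inner HT kerY).
- exact: (co_outer_kernel (I := nat) hUpsilon_inner HT kerY).
- exact: (unitary_ae (I := nat) hUpsilon_inner HT kerY).
Qed.
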